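(* Let $0<\alpha\le 1$, and let $H^\omega = H_0+\sum_{j\in\mathbb{Z}^d}\omega_j P_j$ be the Anderson model on $\ell^2(\mathbb{Z}^d)$ described in the context. Assume that the single site distribution $\mu$ is uniformly $\alpha$-Hölder continuous. Assume also that the exponential localization hypothesis (Loc) of the context holds on an interval $[a,b]$, and let $E\in\sigma(H^\omega)\cap[a,b]$. Let $I\subset\mathbb{R}$ be a bounded open interval, and let $(L_n)_{n\ge1}=(L_n(I))_{n\ge 1}$ be a sequence of positive integers with $L_n\to\infty$ such that the limit $$\gamma_{E,I}=\lim_{n\to\infty}\mathbb{E}\big(\xi^\omega_{L_n,E}(I)\big)$$ exists and is non-zero. Then the random variables $\xi^\omega_{L_n,E}(I)$ converge in distribution, as $n\to\infty$, to a Poisson random variable with parameter $\gamma_{E,I}$.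
   Context: Model: $d\ge1$; $H_0$ is a bounded self-adjoint operator on $\ell^2(\mathbb{Z}^d)$ commuting with the translations of $\mathbb{Z}^d$ (typically $H_0$ is the discrete Laplacian without its diagonal part; $H_0=0$ is also allowed). $P_j$ is the orthogonal projection onto $\ell^2(\{j\})$, and $\{\omega_j\}_{j\in\mathbb{Z}^d}$ are i.i.d. real random variables with common law $\mu$ (the single site distribution), a probability measure on $\mathbb{R}$. Here $\sigma(H^\omega)$ denotes the almost surely constant spectrum of $H^\omega$. Uniform $\alpha$-Hölder continuity of $\mu$: there is a constant $U<\infty$ such that $\sup_{x\in\mathbb{R}}\mu([x,x+s])\le U s^\alpha$ for all small $s>0$. For $\Lambda\subseteq\mathbb{Z}^d$, $H^\omega_\Lambda$ is the compression of $H^\omega$ to $\ell^2(\Lambda)$. $\{\delta_n\}$ is the standard basis, and $\mathbb{C}^+$ is the open upper half plane. Hypothesis (Loc): there are constants $s>0$, $0<\gamma<\infty$, $C<\infty$ such that for every large cube $\Lambda\subseteq\mathbb{Z}^d$ and all $n,m\in\Lambda$, $$\sup_{z\in\mathbb{C}^+,\ \mathrm{Re}(z)\in[a,b]}\mathbb{E}\big(|\langle\delta_n,(H^\omega_\Lambda-z)^{-1}\delta_m\rangle|^s\big)\le C e^{-\gamma|n-m|}.$$ For $L\in\mathbb{N}$ let $\Lambda_L=(-L-1,L]^d\cap\mathbb{Z}^d=\{-L,\dots,L\}^d$, $H^\omega_L=H^\omega_{\Lambda_L}$, $\beta_L=(2L+1)^{d/\alpha}$. For a self-adjoint operator $A$,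 $E_A(\cdot)$ denotes its spectral projection. Define the random measure $$\xi^\omega_{L,E}(I)=\mathrm{Tr}\big(E_{\beta_L(H_L^\omega-E)}(I)\big),$$ i.e. the number of eigenvalues, counted with multiplicity, of $H^\omega_L$ in $E+\beta_L^{-1}I$. *)

(* Defs.v *)
From HB Require Import structures.
From mathcomp Require Import all_boot all_order all_algebra.
From mathcomp Require Import finmap.
From mathcomp Require Import complex.
From mathcomp Require Import all_classical all_reals all_analysis.
From mathcomp Require Import lra.

Set Implicit Arguments.
Unset Strict Implicit.
Unset Printing Implicit Defensive.

Import Order.TTheory GRing.Theory Num.Theory.
Import numFieldNormedType.Exports.
Import Normc.

Local Open Scope classical_set_scope.
Local Open Scope ring_scope.
Local Open Scope complex_scope.

Notation lattice d := 'rV[int]_d.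

Section Ell2.
Variables (R : realType) (d : nat).

(* [R[i]^o] carries the module structure of C over itself. *)
Definition sqsum : {pred lattice d -> R[i]^o} := fun u =>
  `[< (\esum_(x in [set: lattice d]) (normc (u x) ^+ 2)%:E < +oo)%E >].

Lemma sqsumP (u : lattice d -> R[i]^o) : reflect
  (\esum_(x in [set: lattice d]) (normc (u x) ^+ 2)%:E < +oo)%E (u \in sqsum).
Proof. exact: asboolP. Qed.

Lemma sqr_normc (z : R[i]) :
  normc z ^+ 2 = complex.Re z ^+ 2 + complex.Im z ^+ 2.
Proof. by case: z => a b /=; rewrite sqr_sqrtr ?addr_ge0 ?sqr_ge0. Qed.

Lemma sqsum_submod_closed : GRing.submod_closed sqsum.
Proof.
split=> [|c u v /sqsumP hu /sqsumP hv]; apply/sqsumP.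
  by rewrite esum1 // => x _; rewrite normc0 expr0n.
pose k := normc c ^+ 2 * 2.
have k0 : 0 <= k by rewrite mulr_ge0 ?sqr_ge0.
have le x : (normc ((c *: u + v) x) ^+ 2 <=
             k * normc (u x) ^+ 2 + 2 * normc (v x) ^+ 2).
  have -> : (c *: u + v) x = c * u x + v x :> R[i] by [].
  rewrite /k mulrAC -exprMn -normcM; move: (c * u x) (v x) => y z.
  rewrite !sqr_normc; case: y z => [y1 y2] [z1 z2] /=.
  have := sqr_ge0 (y1 - z1); have := sqr_ge0 (y2 - z2); nra.
apply: (@le_lt_trans _ _ (\esum_(x in [set: lattice d])
    (k%:E * (normc (u x) ^+ 2)%:E + 2%:E * (normc (v x) ^+ 2)%:E))%E).
  by apply: le_esum => x _; rewrite -!EFinM -EFinD lee_fin.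
rewrite esumD; last 2 first.
- by move=> x _; rewrite -EFinM lee_fin mulr_ge0 ?sqr_ge0.
- by move=> x _; rewrite -EFinM lee_fin mulr_ge0 ?sqr_ge0.
have Z (t : R) (w : lattice d -> R[i]) : 0 <= t ->
  (\esum_(x in [set: lattice d]) (normc (w x) ^+ 2)%:E < +oo)%E ->
  (\esum_(x in [set: lattice d]) (t%:E * (normc (w x) ^+ 2)%:E) < +oo)%E.
  move=> t0 hw; set S := esum _ _ in hw.
  have Sfin : S \is a fin_num.
    by rewrite ge0_fin_numE // esum_ge0 // => x _; rewrite lee_fin sqr_ge0.
  apply: (@le_lt_trans _ _ (t%:E * S)%E); last first.
    by rewrite -(fineK Sfin) -EFinM ltry.
  apply: ge_ereal_sup => _ [F [finF _] <-].
  rewrite -ge0_mule_fsumr; last by move=> x; rewrite lee_fin sqr_ge0.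
  by apply: lee_wpmul2l; rewrite ?lee_fin //; apply: ereal_sup_ubound; exists F.
by apply: lte_add_pinfty; apply: Z.
Qed.

HB.instance Definition _ :=
  GRing.isSubmodClosed.Build R[i] (lattice d -> R[i]^o) sqsum
    sqsum_submod_closed.

Record ell2 := Ell2 { ell2_fun :> lattice d -> R[i]^o ; _ : ell2_fun \in sqsum }.
HB.instance Definition _ := [isSub for ell2_fun].
HB.instance Definition _ := [Choice of ell2 by <:].
HB.instance Definition _ := [SubChoice_isSubLmodule of ell2 by <:].

Lemma sqsum_delta (j : lattice d) :
  (fun x => (x == j)%:R : R[i]^o) \in sqsum.
Proof.
apply/sqsumP; rewrite (esumID [set j]) => [|x _]; last first.
  by rewrite lee_fin sqr_ge0.
rewrite [X in (_ + X)%E]esum1 ?adde0 => [|x [_ /eqP/negPf ->]]; last first.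
  by rewrite normc0 expr0n.
by rewrite setTI esum_set1 ?ltry// lee_fin sqr_ge0.
Qed.

Definition delta j : ell2 := Ell2 (sqsum_delta j).

Lemma sqsum_translate (a : lattice d) (u : ell2) :
  (fun x => u (x - a)) \in sqsum.
Proof.
apply/sqsumP; have /sqsumP := valP u; congr (_ < _)%E.
apply: (@reindex_esum _ _ _ _ _ (fun x => x - a)).
by rewrite setTT_bijective; exists (fun x => x + a) => x; rewrite ?subrK ?addrK.
Qed.

Definition translate a u : ell2 := Ell2 (sqsum_translate a u).

Definition l2norm (u : ell2) : R :=
  Num.sqrt (fine (\esum_(x in [set: lattice d]) (normc (u x) ^+ 2)%:E)).

(* The sum of an absolutely summable family, as the difference of the sums of
   its positive and negative parts. *)
Definition lattice_sum (f : lattice d -> R) : R :=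
  fine (\esum_(x in [set: lattice d]) (f^\+ x)%:E) -
  fine (\esum_(x in [set: lattice d]) (f^\- x)%:E).

(* Antilinear in the first argument. *)
Definition l2dot (u v : ell2) : R[i] :=
  lattice_sum (fun x => complex.Re ((u x : R[i])^* * v x)) +i*
  lattice_sum (fun x => complex.Im ((u x : R[i])^* * v x)).

Definition bounded_op (A : ell2 -> ell2) : Prop :=
  exists M : R, forall u, l2norm (A u) <= M * l2norm u.

Definition selfadjoint_op (A : ell2 -> ell2) : Prop :=
  forall u v, l2dot (A u) v = l2dot u (A v).

Definition translation_invariant (A : ell2 -> ell2) : Prop :=
  forall a u, A (translate a u) = translate a (A u).

(* A possibly unbounded operator A is given by its graph: [A u v] means that
   u lies in the domain and A u = v.  The condition on G then reads
   G = (A - z)^-1. *)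
Definition resolvent_set (A : ell2 -> ell2 -> Prop) : set R[i] :=
  [set z | exists2 G : {linear ell2 -> ell2}, bounded_op G &
           forall f u, G f = u <-> A u (f + z *: u)].

Definition spectrum (A : ell2 -> ell2 -> Prop) : set R[i] :=
  ~` resolvent_set A.

End Ell2.

Section Anderson.
Variables (R : realType) (d : nat).
Variables (H0 : {linear ell2 R d -> ell2 R d}) (V : lattice d -> R).

(* P_j u is the function u 0 outside j, so that (sum_j V_j P_j) u = V u. *)
Definition anderson_fun (u : ell2 R d) : lattice d -> R[i] :=
  fun x => H0 u x + (V x)%:C * u x.

(* The domain consists of the u such that V u is again square summable; on it
   the operator is self-adjoint. *)
Definition anderson (u v : ell2 R d) : Prop := v =1 anderson_fun u.

(* Matrix of the compression to l^2(Lambda) in the standard basis: the entry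
   at (n, m) is <delta_n, H delta_m>. *)
Definition compression (Lambda : {fset lattice d}) :
    'M[R[i]]_#|{: Lambda}| :=
  \matrix_(i, j) anderson_fun (delta R (val (enum_val j))) (val (enum_val i)).

Definition green (Lambda : {fset lattice d}) (z : R[i]) (n m : Lambda) : R[i] :=
  invmx (compression Lambda - z%:M) (enum_rank n) (enum_rank m).

End Anderson.

Definition cube (d : nat) (x : lattice d) (l : nat) : {fset lattice d} :=
  let pt (f : {ffun 'I_d -> 'I_l}) : lattice d := \row_i (x ord0 i + (f i)%:Z) in
  [fset pt f | f in {: {ffun 'I_d -> 'I_l}}]%fset.

Lemma in_cube (d : nat) (x : lattice d) (l : nat) (y : lattice d) :
  (y \in cube x l) =
  [forall i : 'I_d, x ord0 i <= y ord0 i < x ord0 i + l%:Z].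
Proof.
apply/imfsetP/forallP => [[f _ ->] i|xy].
  by rewrite mxE lerDl ltrD2l ltz_nat ltn_ord.
have H i : (`|(y ord0 i - x ord0 i)%R|%N < l)%N.
  have /andP[h1 h2] := xy i.
  by rewrite -ltz_nat gez0_abs ?subr_ge0// ltrBlDl.
exists [ffun i => Ordinal (H i)] => //.
apply/rowP => i; rewrite mxE ffunE /=.
by have /andP[h1 _] := xy i; rewrite gez0_abs ?subr_ge0// subrKC.
Qed.

(* {-L, ..., L}^d *)
Definition box (d L : nat) : {fset lattice d} :=
  cube (const_mx (- L%:Z)) (2 * L).+1.

Definition euclid_dist (R : realType) (d : nat) (x y : lattice d) : R :=
  Num.sqrt (\sum_i ((x ord0 i - y ord0 i)%:~R) ^+ 2).

Section EigenvalueStatistics.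
Variable R : realType.

(* The spectral projection of a Hermitian matrix, defined by applying the
   indicator function of I to a unitary diagonalisation. *)
Definition spectral_proj (n : nat) (A : 'M[R[i]]_n) (I : set R) : 'M[R[i]]_n :=
  invmx (spectralmx A) *m
  diag_mx (map_mx (\1_(real_complex R @` I)) (spectral_diag A)) *m
  spectralmx A.

Definition beta (d : nat) (alpha : R) (L : nat) : R :=
  (2 * L).+1%:R `^ (d%:R / alpha).

Definition xi (d : nat) (H0 : {linear ell2 R d -> ell2 R d}) (alpha : R)
    (L : nat) (E : R) (I : set R) (V : lattice d -> R) : R :=
  complex.Re (\tr (spectral_proj
    ((beta d alpha L)%:C *: (compression H0 V (box d L) - (E%:C)%:M)) I)).

End EigenvalueStatistics.

Section Probability.
Context (R : realType) (disp : measure_display) (T : measurableType disp)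
  (P : probability T R).

Definition mutually_independent (I : choiceType) (X : I -> {RV P >-> R}) :=
  forall (J : {fset I}) (A : I -> set R), (forall j, measurable (A j)) ->
  P (\bigcap_(j in [set` J]) (X j @^-1` A j)) =
  (\prod_(j <- J) P (X j @^-1` A j))%E.

Definition identically_distributed (I : Type) (X : I -> {RV P >-> R})
    (mu : probability R R) :=
  forall j (A : set R), measurable A -> distribution P (X j) A = mu A.

Definition uniformly_holder (alpha : R) (mu : probability R R) :=
  exists U : R, \forall s \near 0^'+,
    forall x, (mu `[x, (x + s)%R]%classic <= (U * s `^ alpha)%:E)%E.

Definition cvg_in_distribution (X : nat -> T -> R) (disp' : measure_display)
    (T' : measurableType disp') (Q : probability T' R) (Y : T' -> R) :=
  (forall n, measurable_fun [set: T] (X n)) /\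
  forall f : R -> R, continuous f -> (exists M, forall x, `|f x| <= M) ->
    ('E_P[f \o X n])%E @[n --> \oo] --> ('E_Q[f \o Y])%E.

Definition exp_localized (d : nat) (H0 : {linear ell2 R d -> ell2 R d})
    (omega : lattice d -> {RV P >-> R}) (a b : R) :=
  exists s gamma C : R, [/\ 0 < s, 0 < gamma &
    exists l0 : nat, forall (x : lattice d) (l : nat), (l0 <= l)%N ->
    forall (n m : cube x l) (z : R[i]),
      0 < complex.Im z -> a <= complex.Re z <= b ->
      ('E_P[fun w => (normc (green H0 (omega ^~ w) z n m) `^ s)%R] <=
       (C * expR (- gamma * euclid_dist R (val n) (val m)))%:E)%E].

End Probability.

(* Main.v *)
(** The box of side M = 2L+1 is cut into cells of side s^2, where s is about
M^(1/4).  The indicator of ]c, e[ is approximated by p(v), where p is a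
polynomial and v(x) = (y^2 + (c+e)x - ce) / (x^2 + y^2) is the real part of a
multiple of 1/(x - iy).  Only the Green functions at the single point
E + iy/beta are therefore needed: at a site deep inside a cell, their
exponential decay makes the diagonal entries of p(v) for the box and for the
cell nearly equal, and the remaining sites have density O(1/s).  The error of
the approximation and the remaining sites are controlled by a Wegner estimate,
in which Hoelder continuity enters through
int r^2/((t-u)^2 + r^2) dmu(t) = O(r^alpha); the normalisation is such that
beta^alpha = M^d.  So the count of the box is close in L^1 to the sum of the
counts of the cells, which are independent.  By a Minami estimate, obtained
from rank-one interlacing and resampling of one site, the count of a cell is
close in L^1 to the indicator of the event that it is positive.  Finally, the
sum S of independent events with probabilities p_k satisfies
|(j+1) P(S=j+1) - (sum p_k) P(S=j)| <= sum p_k^2, which forces the Poisson law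
when sum p_k -> gamma and sum p_k^2 -> 0. *)
Require Import Defs.
From mathcomp Require Import all_boot all_order all_algebra.
From mathcomp Require Import finmap.
From mathcomp Require Import complex.
From mathcomp Require Import all_classical all_reals all_analysis.
From mathcomp Require Import measurable_realfun.
From mathcomp Require Import ring lra zify.

Set Implicit Arguments.
Unset Strict Implicit.
Unset Printing Implicit Defensive.

Import Order.TTheory GRing.Theory Num.Theory.
Import numFieldNormedType.Exports.
Import Normc.

Local Open Scope classical_set_scope.
Local Open Scope ring_scope.
Local Open Scope complex_scope.

(** * Functional calculus of Hermitian matrices *)

Import spectral sesquilinear.
Local Open Scope sesquilinear_scope.

(** A trace over the box sums about M^d sites, so a uniformly small error in approximating the
    indicator is useless: every error must be dominated by Poisson kernels [pk], whose mean at a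
    site is O(M^-d). Hence the form of the bound in [window_approx]: narrow kernels at the two
    endpoints, where a continuous approximation must fail, and a wide kernel with a small factor
    elsewhere. Staying with one resolvent has a second benefit: E + iy/beta has real part exactly E,
    so (Loc) applies even when E is an endpoint of [a,b]. (Loc) bounds fractional moments, which do
    not multiply, so products of Green functions are never averaged. All entries at distance more
    than s are compared with a threshold theta; the event that one exceeds it is handled in the
    manner of Markov's inequality. The resulting factors exp(-const s) beat every power of M, since
    M < (s+1)^4. A polynomial p of fixed degree needs a buffer of width O(s) only, which is small
    against the side s^2. For this, eps and p are fixed before L grows. *)

Section HermitianCalculus.
Variable R : realType.
Local Notation C := R[i].

Lemma normc_ge0 (x : C) : 0 <= normc x.
Proof. by case: x => a b; exact: sqrtr_ge0. Qed.

Lemma normc_sum (I : Type) (r : seq I) (Q : pred I) (F : I -> C) :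
  normc (\sum_(i <- r | Q i) F i) <= \sum_(i <- r | Q i) normc (F i).
Proof.
elim/big_ind2: _ => [|x1 x2 y1 y2 le1 le2|//]; first by rewrite normc0.
by apply: le_trans (le_normcD _ _) _; apply: lerD.
Qed.

Lemma normc_conj (x : C) : normc x^* = normc x.
Proof. by case: x => a b /=; rewrite sqrrN. Qed.

Lemma normc_real (x : R) : normc x%:C = `|x|.
Proof. by rewrite /= expr0n addr0 sqrtr_sqr. Qed.

Lemma mulconjc (x : C) : x^* * x = (normc x ^+ 2)%:C.
Proof.
by rewrite Defs.sqr_normc; case: x => a b; apply/eqP; rewrite eq_complex /=;
   apply/andP; split; apply/eqP; ring.
Qed.

Lemma ReD (x y : C) : complex.Re (x + y) = complex.Re x + complex.Re y.
Proof. by case: x y => [? ?] []. Qed.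

Lemma ImD (x y : C) : complex.Im (x + y) = complex.Im x + complex.Im y.
Proof. by case: x y => [? ?] []. Qed.

Lemma Re_sum (I : Type) (r : seq I) (Q : pred I) (F : I -> C) :
  complex.Re (\sum_(i <- r | Q i) F i) = \sum_(i <- r | Q i) complex.Re (F i).
Proof. by rewrite (big_morph _ ReD (erefl _)). Qed.

Lemma Im_sum (I : Type) (r : seq I) (Q : pred I) (F : I -> C) :
  complex.Im (\sum_(i <- r | Q i) F i) = \sum_(i <- r | Q i) complex.Im (F i).
Proof. by rewrite (big_morph _ ImD (erefl _)). Qed.

Lemma ImZ (a : R) (x : C) : complex.Im (a%:C * x) = a * complex.Im x.
Proof. by case: x => b c /=; rewrite mul0r addr0. Qed.

Lemma realcM (x y : R) : (x * y)%:C = x%:C * y%:C.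
Proof. by apply/eqP; rewrite eq_complex /= !mulr0 mul0r subr0 addr0 !eqxx. Qed.

Variable n : nat.
Implicit Types A B : 'M[C]_n.

Definition hermitian A := forall i j, A j i = (A i j)^*.

Lemma hermitianP A : hermitian A -> A \is hermsymmx.
Proof.
move=> hA; apply/is_hermitianmxP; rewrite expr0 scale1r.
by apply/matrixP => i j; rewrite !mxE hA.
Qed.

Definition eigval A (i : 'I_n) : R := complex.Re (spectral_diag A ord0 i).

Definition spectral_adj A := (spectralmx A)^t*.

(** Only the real parts of the diagonal enter; for Hermitian A they are the eigenvalues, and
    [fcalc_id] recovers A. The algebraic rules below rest on the unitarity of [spectralmx A]
    alone. *)
Definition fcalc A (g : R -> C) : 'M[C]_n :=
  spectral_adj A *m diag_mx (\row_i g (eigval A i)) *m spectralmx A.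

(** Mass that the spectral measure of the k-th basis vector gives to the i-th eigenvalue. Both sums
    equal 1: over i this makes [site] an average, over k it makes the sites add up to the trace. *)
Definition weight A (i k : 'I_n) : R := normc (spectralmx A i k) ^+ 2.

Lemma weight_ge0 A i k : 0 <= weight A i k.
Proof. exact: sqr_ge0. Qed.

Lemma spectralmx_tV A : spectral_adj A *m spectralmx A = 1%:M.
Proof.
rewrite /spectral_adj.
by rewrite -invmx_unitary ?spectral_unitarymx// mulVmx// spectral_unit.
Qed.

Lemma spectralmx_Vt A : spectralmx A *m spectral_adj A = 1%:M.
Proof. exact/unitarymxP/spectral_unitarymx. Qed.

Lemma sum_weight A k : \sum_i weight A i k = 1.
Proof.
have /matrixP/(_ k k) := spectralmx_tV A; rewrite !mxE eqxx /= => h.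
apply: complexI; rewrite rmorph_sum /= -[RHS]h; apply: eq_bigr => i _.
by rewrite !mxE /weight -mulconjc.
Qed.

Lemma sum_weight_row A i : \sum_k weight A i k = 1.
Proof.
have /matrixP/(_ i i) := spectralmx_Vt A; rewrite !mxE eqxx /= => h.
apply: complexI; rewrite rmorph_sum /= -[RHS]h; apply: eq_bigr => k _.
by rewrite !mxE /weight -mulconjc mulrC.
Qed.

Lemma spectral_diag_eigval A : hermitian A ->
  spectral_diag A = \row_i (eigval A i)%:C.
Proof.
move=> /hermitianP/hermitian_spectral_diag_real/mxOverP h.
apply/rowP => i; rewrite mxE /eigval; have := h ord0 i.
by move=> /RRe_real ->.
Qed.

Lemma eq_fcalc A f g : (forall i, f (eigval A i) = g (eigval A i)) ->
  fcalc A f = fcalc A g.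
Proof.
move=> fg; suff e : \row_i f (eigval A i) = \row_i g (eigval A i).
  by rewrite /fcalc e.
by apply/rowP => i; rewrite !mxE.
Qed.

Lemma fcalc_id A : hermitian A -> fcalc A (real_complex R) = A.
Proof.
move=> hA; rewrite /fcalc -spectral_diag_eigval// /spectral_adj.
rewrite -invmx_unitary ?spectral_unitarymx//.
by have /hermitianP/hermitian_normalmx/orthomx_spectralP <- := hA.
Qed.

Lemma fcalcE A g k l : fcalc A g k l =
  \sum_i g (eigval A i) * ((spectralmx A i k)^* * spectralmx A i l).
Proof.
rewrite /fcalc mxE; apply: eq_bigr => i _.
by rewrite mul_mx_diag !mxE mulrAC mulrC.
Qed.

Lemma fcalcM A f g : fcalc A f *m fcalc A g = fcalc A (fun x => f x * g x).
Proof.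
rewrite /fcalc; move: (spectralmx_Vt A).
move: (spectral_adj A) (spectralmx A) => Q P PQ.
rewrite !mulmxA -(mulmxA _ P Q) PQ mulmx1.
rewrite -(mulmxA Q (diag_mx _) (diag_mx _)) mulmx_diag.
set u := \row__ _; set v := \row__ _; suff -> : u = v by [].
by apply/rowP => i; rewrite !mxE.
Qed.

Lemma fcalcD A f g : fcalc A f + fcalc A g = fcalc A (fun x => f x + g x).
Proof.
apply/matrixP => k l.
rewrite [LHS]mxE (fcalcE A f) (fcalcE A g) (fcalcE A (fun x => f x + g x)).
rewrite -big_split; by apply: eq_bigr => i _; rewrite mulrDl.
Qed.

Lemma fcalcZ A c f : c *: fcalc A f = fcalc A (fun x => c * f x).
Proof.
apply/matrixP => k l; rewrite mxE (fcalcE A f) fcalcE mulr_sumr.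
by apply: eq_bigr => i _; rewrite mulrA.
Qed.

Lemma fcalc_cst A c : fcalc A (fun=> c) = c%:M.
Proof.
transitivity (c *: fcalc A (fun=> 1)).
  by rewrite fcalcZ; apply: eq_fcalc => i; rewrite mulr1.
rewrite -[RHS]scalemx1; congr (_ *: _).
rewrite /fcalc -[RHS](spectralmx_tV A); congr (_ *m _).
rewrite (_ : \row_i _ = const_mx 1) ?diag_const_mx ?mulmx1//.
by apply/rowP => i; rewrite !mxE.
Qed.

Lemma fcalcB A f g : fcalc A f - fcalc A g = fcalc A (fun x => f x - g x).
Proof.
by rewrite -scaleN1r fcalcZ fcalcD; apply: eq_fcalc => i; rewrite mulN1r.
Qed.

Lemma fcalcX A f k : fcalc A f ^+ k = fcalc A (fun x => f x ^+ k).
Proof.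
elim: k => [|k IH]; first by rewrite expr0 -[RHS]/(fcalc A (fun=> 1)) fcalc_cst.
rewrite exprS IH -[_ * _]/(_ *m _) fcalcM; apply: eq_fcalc => i.
by rewrite exprS.
Qed.

Lemma fcalc_ct A f k l : (fcalc A f l k)^* = fcalc A (fun x => (f x)^*) k l.
Proof.
rewrite (fcalcE A f) fcalcE rmorph_sum /=; apply: eq_bigr => i _.
by rewrite !rmorphM /= conjcK; congr (_ * _); rewrite mulrC.
Qed.

Lemma fcalc_inv A (f : R -> C) : (forall i, f (eigval A i) != 0) ->
  (fcalc A f \in unitmx) /\ invmx (fcalc A f) = fcalc A (fun x => (f x)^-1).
Proof.
move=> f0.
have e : fcalc A f *m fcalc A (fun x => (f x)^-1) = 1%:M.
  rewrite fcalcM -(fcalc_cst A); apply: eq_fcalc => i.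
  by rewrite divff.
have [u _] := mulmx1_unit e; split => //.
by rewrite -[LHS]mulmx1 -e mulKmx.
Qed.

Lemma resolventE A (z : C) : hermitian A -> complex.Im z != 0 ->
  (A - z%:M \in unitmx) /\
  invmx (A - z%:M) = fcalc A (fun x => (x%:C - z)^-1).
Proof.
move=> hA z0.
have -> : A - z%:M = fcalc A (fun x => x%:C - z).
  by rewrite -fcalcB fcalc_cst fcalc_id.
apply: fcalc_inv => i; apply: contra z0; rewrite subr_eq0 => /eqP <-.
by [].
Qed.

Lemma fcalc_diag A f k :
  fcalc A f k k = \sum_i (weight A i k)%:C * f (eigval A i).
Proof.
rewrite fcalcE; apply: eq_bigr => i _.
by rewrite mulconjc mulrC.
Qed.

Lemma fcalc_tr A f : \tr (fcalc A f) = \sum_i f (eigval A i).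
Proof.
rewrite /mxtrace (eq_bigr _ (fun k _ => fcalc_diag A f k)) exchange_big /=.
apply: eq_bigr => i _; rewrite -mulr_suml -rmorph_sum /=.
by rewrite sum_weight_row mul1r.
Qed.

(* Cauchy-Schwarz for the two columns of the unitary diagonalising matrix. *)
Lemma normc_fcalc_le A f (M : R) k l :
  (forall i, normc (f (eigval A i)) <= M) -> normc (fcalc A f k l) <= M.
Proof.
move=> fM; rewrite fcalcE.
have -> : M = \sum_i M * ((weight A i k + weight A i l) / 2).
  rewrite -mulr_sumr -mulr_suml big_split /= !sum_weight.
  by rewrite -[1 + 1]/(2%:R) divff ?mulr1 ?pnatr_eq0.
apply: le_trans (normc_sum _ _ _) _; apply: ler_sum => i _.
rewrite !normcM normc_conj; apply: ler_pM => //.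
- exact: normc_ge0.
- by rewrite mulr_ge0 ?normc_ge0.
rewrite /weight; move: (normc _) (normc (spectralmx A i l)) => x y.
have := sqr_ge0 (x - y); nra.
Qed.

(** The diagonal entry of g(A) at k, as the integral of g against the spectral measure of the k-th
    basis vector (the local density of states). *)
Definition site A (g : R -> R) (k : 'I_n) : R :=
  \sum_i weight A i k * g (eigval A i).

Definition strace A (g : R -> R) : R := \sum_i g (eigval A i).

Lemma sum_site A g : \sum_k site A g k = strace A g.
Proof.
rewrite /site exchange_big /=; apply: eq_bigr => i _.
by rewrite -mulr_suml sum_weight_row mul1r.
Qed.

Lemma fcalc_site A g k : fcalc A (fun x => (g x)%:C) k k = (site A g k)%:C.
Proof.
rewrite fcalc_diag /site (rmorph_sum (real_complex R)).
by apply: eq_bigr => i _; rewrite [RHS]realcM.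
Qed.

Lemma siteD A f g k : site A (fun x => f x + g x) k = site A f k + site A g k.
Proof. by rewrite -big_split; apply: eq_bigr => i _; rewrite mulrDr. Qed.

Lemma siteZ A c g k : site A (fun x => c * g x) k = c * site A g k.
Proof. by rewrite mulr_sumr; apply: eq_bigr => i _; rewrite mulrCA. Qed.

Lemma le_site A f g k : (forall x, f x <= g x) -> site A f k <= site A g k.
Proof.
by move=> fg; apply: ler_sum => i _; apply: ler_wpM2l => //; exact: weight_ge0.
Qed.

Lemma site_cst A c k : site A (fun=> c) k = c.
Proof. by rewrite /site -mulr_suml sum_weight mul1r. Qed.

Lemma site_ge0 A g k : (forall x, 0 <= g x) -> 0 <= site A g k.
Proof. by move=> g0; rewrite -(site_cst A 0 k); exact: le_site. Qed.

Lemma le_norm_siteB A f g k :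
  `|site A f k - site A g k| <= site A (fun x => `|f x - g x|) k.
Proof.
rewrite /site -sumrB; apply: le_trans (ler_norm_sum _ _ _) _.
apply: ler_sum => i _; rewrite -mulrBr normrM ger0_norm//.
exact: weight_ge0.
Qed.

End HermitianCalculus.

(** * Rank-one interlacing of eigenvalue counts *)

Section Interlacing.
Variable R : realType.
Local Notation C := R[i].

Definition sqnorm m (v : 'rV[C]_m) : R := \sum_j normc (v 0 j) ^+ 2.

Lemma sqnormE m (v : 'rV[C]_m) : (sqnorm v)%:C = (v *m (map_mx conjc v^T)) 0 0.
Proof.
rewrite mxE (rmorph_sum (real_complex R)); apply: eq_bigr => j _.
by rewrite !mxE mulrC mulconjc.
Qed.

Lemma sqnorm_isometry m p (v : 'rV[C]_m) (W : 'M[C]_(m, p)) :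
  W *m (map_mx conjc W^T) = 1%:M -> sqnorm (v *m W) = sqnorm v.
Proof.
move=> W1; apply: (@complexI R); rewrite !sqnormE trmx_mul map_mxM.
by rewrite -mulmxA [W *m _]mulmxA W1 mul1mx.
Qed.

Variable n : nat.
Implicit Types A B : 'M[C]_n.

Section Rows.
Variables (A : 'M[C]_n) (F : pred 'I_n).

(** With P = [spectralmx A] one has P A = D P, so the rows of P are left eigenvectors; hence the row
    vectors and row spaces of this section. *)
Definition eigrows : 'M[C]_(#|F|, n) := rowsub enum_val (spectralmx A).

Lemma eigrows_isometry : eigrows *m (map_mx conjc eigrows^T) = 1%:M.
Proof.
have /matrixP e := spectralmx_Vt A.
apply/matrixP => i j; have := e (enum_val i) (enum_val j).
rewrite !mxE (inj_eq enum_val_inj) => <-.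
by apply: eq_bigr => l _; rewrite !mxE.
Qed.

Lemma rank_eigrows : \rank eigrows = #|F|.
Proof.
apply/eqP; apply/row_freeP; exists (map_mx conjc eigrows^T).
exact: eigrows_isometry.
Qed.

Lemma sqnorm_eigrows (hA : hermitian A) (x0 : R) (a : 'rV[C]_#|F|) :
  sqnorm (a *m eigrows *m (A - (x0%:C)%:M)) =
  \sum_j normc (a 0 j) ^+ 2 * (eigval A (enum_val j) - x0) ^+ 2.
Proof.
have PA : eigrows *m (A - (x0%:C)%:M) =
    diag_mx (\row_j ((eigval A (enum_val j) - x0)%:C)) *m eigrows.
  have e : A - (x0%:C)%:M = fcalc A (fun x => (x - x0)%:C).
    rewrite -[in LHS](fcalc_id hA) -(fcalc_cst A) fcalcB.
    by apply: eq_fcalc => i; rewrite rmorphB.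
  have {}e : spectralmx A *m (A - (x0%:C)%:M) =
     diag_mx (\row_i ((eigval A i - x0)%:C)) *m spectralmx A.
    by rewrite e /fcalc !mulmxA spectralmx_Vt mul1mx.
  apply/matrixP => i j; move/matrixP/(_ (enum_val i) j) : e.
  rewrite !mul_diag_mx !mxE => <-.
  by apply: eq_bigr => l _; rewrite !mxE.
rewrite -mulmxA PA mulmxA sqnorm_isometry; last exact: eigrows_isometry.
apply: eq_bigr => j _; rewrite mul_mx_diag !mxE normcM exprMn.
by rewrite normc_real real_normK ?num_real.
Qed.

End Rows.

Lemma strace_indic A (I : set R) :
  strace A \1_I = #|[pred i | `[< I (eigval A i) >]]|%:R.
Proof.
rewrite /strace -sum1_card natr_sum [RHS]big_mkcond /=.
by apply: eq_bigr => i _; rewrite indicE !inE; case: asboolP => //;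
  rewrite /in_mem /= /in_set; case: asboolP.
Qed.

(* The eigenvectors of A with eigenvalue in the interval, those of B with
   eigenvalue outside it, and the hyperplane on which A and B agree would
   otherwise have a common nonzero vector u, and |u (A - x0)| = |u (B - x0)|
   would be both < r |u| and >= r |u|, where x0 is the centre and r the radius
   of the interval. *)
Lemma rank1_interlacing A B (k : 'I_n) (c e : R) :
  c < e -> hermitian A -> hermitian B -> (forall i j, i != k -> A i j = B i j) ->
  strace A \1_(`]c, e[%classic) <= strace B \1_(`]c, e[%classic) + 1.
Proof.
move=> ce hA hB AB; rewrite !strace_indic natr1 ler_nat.
set FA := (X in (#|X| <= _)%N).
set FB := (X in (_ <= #|X|.+1)%N).
pose FC := predC FB.
pose dk : 'cV[C]_n := \col_i (i == k)%:R.
pose S := eigrows A FA; pose T := eigrows B FC; pose K := kermx dk.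
rewrite leqNgt; apply/negP => lt.
have rC : (#|FB| + #|FC| = n)%N by rewrite cardC card_ord.
have rK : (n <= (\rank K).+1)%N.
  by have := rank_leq_col dk; rewrite mxrank_ker; lia.
have c1 := mxrank_sum_cap S K; have c2 := mxrank_sum_cap (S :&: K)%MS T.
have l1 := rank_leq_col (S + K)%MS; have l2 := rank_leq_col (S :&: K + T)%MS.
rewrite rank_eigrows in c1; rewrite rank_eigrows in c2.
(* The dimension is at least #FA + (n - 1) + (n - #FB) - 2n, positive because [lt] says #FA > #FB +
   1. *)
have : (S :&: K :&: T)%MS != 0.
  rewrite -mxrank_eq0 -lt0n.
  have aux (x y z w fa fb fc rk m : nat) : (x + y = fa + rk)%N ->
      (z + w = y + fc)%N -> (x <= m)%N -> (z <= m)%N -> (fb.+1 < fa)%N ->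
      (fb + fc = m)%N -> (m <= rk.+1)%N -> (0 < w)%N by lia.
  exact: (aux _ _ _ _ _ _ _ _ _ c1 c2 l1 l2 lt rC rK).
move=> /rowV0Pn[u]; rewrite !sub_capmx => /andP[/andP[uS uK] uT] u0.
have /submxP[a ua] := uS; have /submxP[b ub] := uT.
have uk : u 0 k = 0.
  have /sub_kermxP/matrixP/(_ 0 0) := uK; rewrite !mxE => <-.
  rewrite (bigD1 k)//= mxE eqxx mulr1 big1 ?addr0// => i /negPf ik.
  by rewrite mxE ik mulr0.
pose x0 := (c + e) / 2; pose r := (e - c) / 2.
have eAB : u *m (A - (x0%:C)%:M) = u *m (B - (x0%:C)%:M).
  rewrite !mulmxBr; congr (_ - _); apply/rowP => j; rewrite !mxE.
  apply: eq_bigr => i _; have [->|/AB ->//] := eqVneq i k.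
  by rewrite uk !mul0r.
have ge : r ^+ 2 * sqnorm u <= sqnorm (u *m (B - (x0%:C)%:M)).
  rewrite ub sqnorm_eigrows// sqnorm_isometry; last exact: eigrows_isometry.
  rewrite mulr_sumr; apply: ler_sum => j _; rewrite mulrC.
  apply: ler_wpM2l; first exact: sqr_ge0.
  have /asboolP : ~~ `[< `]c, e[%classic (eigval B (enum_val j)) >].
    exact: (enum_valP j).
  rewrite /= in_itv /= => /negP; rewrite negb_and -!leNgt => h; rewrite -subr_ge0.
  set l := eigval _ _ in h *.
  have -> : (l - x0) ^+ 2 - r ^+ 2 = (l - c) * (l - e).
    by rewrite /r /x0; field.
  case/orP: h => h; first by apply: mulr_le0; lra.
  by apply: mulr_ge0; lra.
have le : sqnorm (u *m (A - (x0%:C)%:M)) < r ^+ 2 * sqnorm u.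
  have [j aj] : exists j, a 0 j != 0.
    apply/existsP; apply: contraNT u0 => /existsPn a0.
    rewrite ua (_ : a = 0) ?mul0mx//; apply/rowP => j; rewrite mxE.
    by have := a0 j; rewrite negbK => /eqP.
  rewrite ua sqnorm_eigrows// sqnorm_isometry; last exact: eigrows_isometry.
  rewrite mulr_sumr.
  have bd i : (eigval A (enum_val (i : 'I_#|FA|)) - x0) ^+ 2 < r ^+ 2.
    have /asboolP : `[< `]c, e[%classic (eigval A (enum_val i)) >].
      exact: (enum_valP i).
    rewrite /= in_itv /= => /andP[h1 h2]; rewrite -subr_gt0.
    set l := eigval _ _ in h1 h2 *.
    have -> : r ^+ 2 - (l - x0) ^+ 2 = (l - c) * (e - l).
      by rewrite /r /x0; field.
    by apply: mulr_gt0; lra.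
  rewrite (bigD1 j)//= [ltRHS](bigD1 j)//=; apply: ltr_leD.
    rewrite mulrC ltr_pM2r// exprn_gt0// lt_neqAle normc_ge0 andbT.
    by apply: contra aj => /eqP/esym/eq0_normc ->.
  by apply: ler_sum => i _; rewrite mulrC ler_wpM2r ?sqr_ge0// ltW.
by move: le; rewrite eAB ltNge ge.
Qed.

End Interlacing.

(** * Poisson kernels and rank-one perturbations *)

Lemma mulmx_delta_entry (K : comNzRingType) (n : nat) (M N : 'M[K]_n) (t : K) k :
  (M *m (t *: delta_mx k k) *m N) k k = t * M k k * N k k.
Proof.
have -> : delta_mx k k = delta_mx k (0 : 'I_1) *m delta_mx 0 k :> 'M[K]_n.
  by rewrite mul_delta_mx.
rewrite -scalemxAr -scalemxAl mulmxA -colE -mulmxA -rowE.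
by rewrite !mxE big_ord1 !mxE mulrA.
Qed.

Section PoissonKernel.
Variable R : realType.
Local Notation C := R[i].

(** The Poisson kernel normalised to peak value 1. For z = u + is it is both s Im (x - z)^-1 and s^2
    |x - z|^-2; the equality of the two is behind [herfindahl]. *)
Definition pk (s u x : R) : R := s ^+ 2 / ((x - u) ^+ 2 + s ^+ 2).

Lemma pk_ge0 s u x : 0 <= pk s u x.
Proof. by rewrite divr_ge0 ?addr_ge0 ?sqr_ge0. Qed.

Lemma pk_le1 s u x : 0 < s -> pk s u x <= 1.
Proof.
move=> s0; rewrite ler_pdivrMr ?ltr_wpDl ?sqr_ge0 ?exprn_gt0//.
by rewrite mul1r lerDr sqr_ge0.
Qed.

Lemma ImV_shift (s u x : R) : 0 < s ->
  complex.Im ((x%:C - (u +i* s))^-1) = s^-1 * pk s u x.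
Proof.
move=> s0 /=; rewrite sub0r sqrrN mulNr opprK /pk.
have h : (x - u) ^+ 2 + s ^+ 2 != 0.
  by rewrite gt_eqF// ltr_wpDl ?sqr_ge0 ?exprn_gt0.
by field; rewrite h gt_eqF.
Qed.

Lemma normcV_shift (s u x : R) : 0 < s ->
  normc ((x%:C - (u +i* s))^-1) ^+ 2 = s^-1 ^+ 2 * pk s u x.
Proof.
move=> s0; rewrite normcV [LHS]exprVn Defs.sqr_normc /= sub0r sqrrN /pk.
have h : (x - u) ^+ 2 + s ^+ 2 != 0.
  by rewrite gt_eqF// ltr_wpDl ?sqr_ge0 ?exprn_gt0.
by field; rewrite h gt_eqF.
Qed.

Lemma normcV_shift_le (s u x : R) : 0 < s ->
  normc ((x%:C - (u +i* s))^-1) <= s^-1.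
Proof.
move=> s0; have sV : 0 <= s^-1 by rewrite invr_ge0 ltW.
rewrite -(@ler_pXn2r _ 2) ?nnegrE ?normc_ge0//.
rewrite normcV_shift// -[leRHS]mulr1 ler_wpM2l ?sqr_ge0//.
exact: pk_le1.
Qed.

Variable n : nat.
Implicit Types (A : 'M[C]_n) (s u : R) (k : 'I_n).

Lemma site_pk A s u k : hermitian A -> 0 < s ->
  site A (pk s u) k = s * complex.Im (invmx (A - (u +i* s)%:M) k k).
Proof.
move=> hA s0; have [|_ ->] := @resolventE _ _ A (u +i* s) hA.
  by rewrite gt_eqF.
rewrite fcalc_diag Im_sum mulr_sumr; apply: eq_bigr => i _.
by rewrite ImZ ImV_shift// [RHS]mulrCA mulVKf// gt_eqF.
Qed.

(** For a single eigenvalue this is an equality; in general the Green function averages (x - z)^-1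
    over the spectral probability weights, and the square of a mean is at most the mean of the
    squares. *)
Lemma herfindahl A s u k : hermitian A -> 0 < s ->
  s * normc (invmx (A - (u +i* s)%:M) k k) ^+ 2 <=
  complex.Im (invmx (A - (u +i* s)%:M) k k).
Proof.
move=> hA s0; have [|_ ->] := @resolventE _ _ A (u +i* s) hA.
  by rewrite gt_eqF.
set g := fcalc A _ k k.
pose a i := normc (((eigval A i)%:C - (u +i* s))^-1).
pose w i := weight A i k.
have le : normc g <= \sum_i w i * a i.
  rewrite /g fcalc_diag; apply: le_trans (normc_sum _ _ _) _.
  apply: ler_sum => i _; rewrite normcM normc_real ger0_norm//.
  exact: weight_ge0.
have -> : complex.Im g = s * \sum_i w i * a i ^+ 2.
  rewrite /g fcalc_diag Im_sum mulr_sumr; apply: eq_bigr => i _.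
  by rewrite ImZ ImV_shift// /a normcV_shift// /w; field; rewrite gt_eqF.
rewrite ler_pM2l//; have [m mE] : exists m, m = \sum_i w i * a i by eexists.
rewrite -mE in le.
have : normc g ^+ 2 <= m ^+ 2.
  by rewrite ler_pXn2r// nnegrE ?normc_ge0// (le_trans _ le)// normc_ge0.
move=> /le_trans; apply.
(* The variance of the moduli [a] under the weights [w]. *)
have : 0 <= \sum_i w i * (a i - m) ^+ 2.
  by apply: sumr_ge0 => i _; rewrite mulr_ge0 ?weight_ge0 ?sqr_ge0.
have -> : \sum_i w i * (a i - m) ^+ 2 =
    \sum_i w i * a i ^+ 2 - 2 * m * (\sum_i w i * a i) + m ^+ 2 * \sum_i w i.
  rewrite !mulr_sumr -sumrB -big_split; apply: eq_bigr => i _ /=.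
  by ring.
have -> : \sum_i w i = 1 by exact: sum_weight.
by rewrite -mE; nra.
Qed.

(** The perturbed Green function at k is h = 1 / (t + 1/g), where g is the one at t = 0. Its
    imaginary part is therefore a Poisson kernel in t, with centre - Re (1/g) and width r = - Im
    (1/g) = Im g / |g|^2, and [herfindahl] gives r >= s. *)
Lemma rank1_site A k s u : hermitian A -> 0 < s ->
  exists v r, s <= r /\ forall t, hermitian (A + t%:C *: delta_mx k k) /\
    site (A + t%:C *: delta_mx k k) (pk s u) k = s / r * pk r v t.
Proof.
move=> hA s0.
have hAt t : hermitian (A + t%:C *: delta_mx k k).
  move=> i j; rewrite !mxE rmorphD rmorphM/= -hA oppr0; congr (_ + _ * _).
  by rewrite andbC; case: (_ && _); rewrite ?conjc1 ?conjc0.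
set z := u +i* s; have z0 : complex.Im z != 0 by rewrite gt_eqF.
have [uA _] := resolventE hA z0.
set g := invmx (A - z%:M) k k.
have kg := herfindahl u k hA s0; rewrite -/z -/g in kg.
(* If g vanished, so would its imaginary part, a sum of nonnegative terms with positive kernel
   values; all weights at k would be 0, but they sum to 1. *)
have g0 : g != 0.
  apply/eqP => g0.
  have [_ e] := resolventE hA z0.
  have : \sum_i weight A i k * (s^-1 * pk s u (eigval A i)) = 0.
    transitivity (complex.Im g); last by rewrite g0.
    rewrite /g e fcalc_diag Im_sum; apply: eq_bigr => i _.
    by rewrite ImZ ImV_shift.
  move/eqP; rewrite psumr_eq0; last first.
    move=> i _; apply: mulr_ge0; first exact: weight_ge0.
    by apply: mulr_ge0; rewrite ?pk_ge0// invr_ge0 ltW.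
  move=> /allP h; have /eqP := sum_weight A k.
  rewrite big1 ?(eq_sym 0) ?oner_eq0// => i _.
  have := h i (mem_index_enum i); rewrite implyTb mulf_eq0 => /orP[/eqP//|].
  rewrite mulf_eq0 invr_eq0 gt_eqF//= mulf_eq0 expf_eq0 gt_eqF//=.
  by rewrite invr_eq0 gt_eqF// ltr_wpDl ?sqr_ge0 ?exprn_gt0.
exists (- complex.Re g^-1), (- complex.Im g^-1).
have ng : 0 < normc g ^+ 2.
  rewrite exprn_gt0// lt_neqAle normc_ge0 andbT.
  by apply: contra g0 => /eqP/esym/eq0_normc ->.
have ImgV : - complex.Im g^-1 = complex.Im g / normc g ^+ 2.
  by rewrite Defs.sqr_normc; case: (g) => a b /=; rewrite opprK.
have sr : s <= - complex.Im g^-1 by rewrite ImgV ler_pdivlMr.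
split=> // t; split; first exact: hAt.
have [uB _] := resolventE (hAt t) z0.
rewrite site_pk// -/z.
set B := A + _ - _ in uB *; set h := invmx B k k.
(* The (k,k) entry of the resolvent identity reads h + t g h = g. *)
have e : h * (t%:C + g^-1) = 1.
  have e1 : invmx (A - z%:M) *m B *m invmx B = invmx (A - z%:M).
    by rewrite -mulmxA mulmxV// mulmx1.
  have BE : B = (A - z%:M) + t%:C *: delta_mx k k by rewrite /B addrAC.
  have : h + t%:C * g * h = g.
    move/matrixP/(_ k k) : e1; rewrite {1}BE mulmxDr mulVmx// mulmxDl mul1mx.
    rewrite [LHS]mxE -/h -/g => {2}<-; congr (_ + _).
    by rewrite mulmx_delta_entry.
  move=> e2; apply: (mulfI g0); rewrite mulr1 -[RHS]e2.
  by field.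
have {e}-> : h = (t%:C + g^-1)^-1.
  have : t%:C + g^-1 != 0.
    by apply/eqP => e0; move/eqP: e; rewrite e0 mulr0 eq_sym oner_eq0.
  by move=> h0; rewrite -[LHS](mulfK h0) e mul1r.
move: sr; case: (g^-1) => h1 h2 /= sr; rewrite /pk add0r opprK sqrrN.
have r0 : h2 != 0 by rewrite lt_eqF//; lra.
have q0 : (t + h1) ^+ 2 + h2 ^+ 2 != 0.
  by rewrite gt_eqF// ltr_wpDl ?sqr_ge0// exprn_even_gt0.
by field; rewrite r0 q0.
Qed.

Lemma spectral_proj_trace A (I : set R) : hermitian A ->
  complex.Re (\tr (spectral_proj A I)) = strace A \1_I.
Proof.
move=> hA; transitivity (complex.Re (\tr (fcalc A (fun x => (\1_I x)%:C)))).
  congr (complex.Re (\tr _)); rewrite /spectral_proj /fcalc.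
  have -> : invmx (spectralmx A) = spectral_adj A.
    exact: invmx_unitary (spectral_unitarymx A).
  suff -> : map_mx (\1_(real_complex R @` I) : C -> C) (spectral_diag A) =
     \row_i (\1_I (eigval A i))%:C by [].
  rewrite spectral_diag_eigval//; apply/rowP => i; rewrite !mxE !indicE.
  rewrite rmorph_nat; congr ((nat_of_bool _)%:R); apply/idP/idP.
    by rewrite !inE => -[x Ix /complexI <-].
  by rewrite !inE => h; exists (eigval A i).
by rewrite fcalc_tr Re_sum.
Qed.

End PoissonKernel.

(** * Approximation of the indicator of an interval *)

Section Window.
Variable R : realType.

Lemma bernoulli_lower (t : R) k : 0 <= t <= 1 -> 1 - k%:R * t <= (1 - t) ^+ k.
Proof.
move=> /andP[t0 t1]; elim: k => [|k IH]; first by rewrite mul0r subr0 expr0.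
have kt : 0 <= k%:R * t by rewrite mulr_ge0.
apply: (@le_trans _ _ ((1 - t) * (1 - k%:R * t))).
  by rewrite -natr1; nra.
by rewrite exprS ler_wpM2l// subr_ge0.
Qed.

Lemma bernoulli_upper (t : R) k : 0 <= t <= 1 ->
  (1 - t) ^+ k <= (1 + k%:R * t)^-1.
Proof.
move=> /andP[t0 t1].
have kt : 0 < 1 + k%:R * t by rewrite ltr_wpDr ?mulr_ge0.
rewrite -[leRHS]mul1r ler_pdivlMr//.
have B : 1 + k%:R * t <= (1 + t) ^+ k.
  elim: k {kt} => [|k IH]; first by rewrite mul0r addr0 expr0.
  have kt : 0 <= k%:R * t by rewrite mulr_ge0.
  apply: (@le_trans _ _ ((1 + t) * (1 + k%:R * t))).
    by rewrite -natr1; nra.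
  by rewrite exprS ler_wpM2l// addr_ge0.
apply: (@le_trans _ _ ((1 - t) ^+ k * (1 + t) ^+ k)).
  by apply: ler_wpM2l => //; rewrite exprn_ge0// subr_ge0.
by rewrite -exprMn exprn_ile1//; nra.
Qed.

Definition window_fun (c e y x : R) : R :=
  (y ^+ 2 + (c + e) * x - c * e) / (x ^+ 2 + y ^+ 2).

(* [window_fun] exceeds 1 exactly on the interval. The powers
   1 - (1 - (v/K)^(2n))^(K^(2n)) of v = window_fun, small where |v| < 1 and
   close to 1 where v > 1, approximate its indicator. *)
Lemma window_approx (c e : R) : c < e -> exists2 y : R, 0 < y &
  forall eps : R, 0 < eps -> exists (p : {poly R}) (M : R), 0 <= M /\ forall x,
  [/\ 0 <= p.[window_fun c e y x], p.[window_fun c e y x] <= 1,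
      p.[window_fun c e y x] <= M * pk y 0 x &
      `|\1_(`]c, e[%classic) x - p.[window_fun c e y x]| <=
      2 * pk eps c x + 2 * pk eps e x + eps * pk y 0 x].
Proof.
move=> ce.
(* Large enough to force v >= -1/2 ([vN]). Outside the interval this excludes v near -1, so that v
   <= 1 - kap with kap <= 1/2 yields v^2 <= 1 - kap. *)
pose y2 : R := 1 + `|c * e| + (c + e) ^+ 2.
have y20 : 0 < y2 by rewrite /y2; have := sqr_ge0 (c + e); have := normr_ge0 (c * e); lra.
pose y : R := Num.sqrt y2.
have y0 : 0 < y by rewrite sqrtr_gt0.
have yy : y ^+ 2 = y2 by rewrite sqr_sqrtr// ltW.
exists y => // eps eps0.
have q0 x : 0 < x ^+ 2 + y ^+ 2 by rewrite ltr_wpDl ?sqr_ge0 ?exprn_gt0.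
set v := window_fun c e y.
have vE x : v x = 1 - (x - c) * (x - e) / (x ^+ 2 + y ^+ 2).
  by rewrite /v /window_fun; field; rewrite gt_eqF.
have vN x : - (1 / 2) <= v x.
  rewrite /v /window_fun ler_pdivlMr// -subr_ge0.
  have : 0 <= (x + (c + e)) ^+ 2 / 2 + (y2 * 3 / 2 - c * e - (c + e) ^+ 2 / 2).
    have := ler_norm (c * e); rewrite /y2.
    have := sqr_ge0 (c + e); have := sqr_ge0 (x + (c + e)).
    have := normr_ge0 (c * e); lra.
  by rewrite -yy; nra.
(* Cauchy-Schwarz: (z + s x)^2 <= (z^2/y^2 + s^2)(y^2 + x^2), where z + s x is the numerator of v.
   So v^2 decays like the kernel [pk y 0]. *)
pose D := (y ^+ 2 - c * e) ^+ 2 / y ^+ 2 + (c + e) ^+ 2.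
pose C1 := 2 * D / y ^+ 2.
have C10 : 0 <= C1.
  have D0 : 0 <= D by rewrite addr_ge0 ?sqr_ge0// divr_ge0 ?sqr_ge0.
  by rewrite divr_ge0 ?sqr_ge0// mulr_ge0.
have v2 x : v x ^+ 2 <= C1 * pk y 0 x.
  have y2n : y ^+ 2 != 0 by rewrite gt_eqF ?exprn_gt0.
  have -> : C1 * pk y 0 x = 2 * D * (x ^+ 2 + y ^+ 2) / (x ^+ 2 + y ^+ 2) ^+ 2.
    rewrite /C1 /pk subr0; field.
    by rewrite gt_eqF// gt_eqF.
  rewrite /v /window_fun expr_div_n ler_wpM2r ?invr_ge0 ?sqr_ge0//.
  rewrite /D; set z := y ^+ 2 - c * e; set s := c + e.
  have -> : y ^+ 2 + s * x - c * e = z + s * x by rewrite /z; ring.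
  have E : z ^+ 2 / y ^+ 2 * y ^+ 2 = z ^+ 2 by rewrite mulfVK.
  have h1 : 0 <= z ^+ 2 / y ^+ 2 * x ^+ 2 by rewrite mulr_ge0 ?divr_ge0 ?sqr_ge0.
  have h2 : 0 <= s ^+ 2 * y ^+ 2 by rewrite mulr_ge0 ?sqr_ge0.
  have h3 := sqr_ge0 (z - s * x).
  move: E h1; generalize (z ^+ 2 / y ^+ 2) => w E h1.
  by move: h2 h3 E h1; clear; nra.
(* v^2 <= C1 <= K^2, so t = (v^2/K^2)^(n+1) lies in [0,1] and both Bernoulli bounds apply; with the
   exponent N = K^(2(n+1)) chosen in [p], the product N t is exactly v^(2(n+1)). *)
pose K := (Num.truncn C1).+1.
have C1K : C1 <= K%:R by rewrite ltW// truncnS_gt.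
have K1 : (1 <= K%:R :> R) by rewrite ler1n.
(* If x is at distance at least eps from both endpoints, then |x| + y is at most m times either
   distance. Hence |v - 1| >= kap = 1/(2 m^2) there. *)
pose m := 1 + (`|c| + `|e| + y) / eps.
have m1 : 1 <= m by rewrite /m lerDl divr_ge0 ?addr_ge0 ?normr_ge0 ?ltW.
pose kap := (2 * m ^+ 2)^-1.
have m0 : 0 < m by apply: lt_le_trans m1.
have kap0 : 0 < kap by rewrite invr_gt0 mulr_gt0 ?exprn_gt0.
have kap1 : kap <= 1 / 2.
  rewrite /kap invfM div1r ler_piMr// invf_le1 ?exprn_gt0//.
  by rewrite exprn_ege1.
have far x : eps <= `|x - c| -> eps <= `|x - e| ->
    kap * (x ^+ 2 + y ^+ 2) <= `|(x - c) * (x - e)|.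
  move=> xc xe.
  have A z : `|z| <= `|c| + `|e| -> eps <= `|x - z| -> `|x| + y <= m * `|x - z|.
    move=> zz xz; have h1 : `|x| <= `|x - z| + `|z|.
      by rewrite -{1}(subrK z x) ler_normD.
    have h2 : `|c| + `|e| + y <= (`|c| + `|e| + y) / eps * `|x - z|.
      rewrite mulrAC ler_pdivlMr// ler_wpM2l// !addr_ge0 ?normr_ge0//.
      exact: ltW.
    by rewrite /m mulrDl mul1r; lra.
  have Ac := A c _ xc; have Ae := A e _ xe.
  have {}Ac : `|x| + y <= m * `|x - c| by apply: Ac; rewrite lerDl.
  have {}Ae : `|x| + y <= m * `|x - e| by apply: Ae; rewrite lerDr.
  have xy0 : 0 <= `|x| + y by rewrite addr_ge0 ?normr_ge0 ?ltW.
  have le : (`|x| + y) ^+ 2 <= m ^+ 2 * `|(x - c) * (x - e)|.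
    rewrite normrM [leRHS](_ : _ = (m * `|x - c|) * (m * `|x - e|)); last by ring.
    by rewrite expr2 ler_pM.
  have le2 : x ^+ 2 + y ^+ 2 <= (`|x| + y) ^+ 2.
    rewrite -[x ^+ 2]real_normK ?num_real//.
    have : 0 <= `|x| * y by rewrite mulr_ge0 ?normr_ge0 ?ltW.
    by nra.
  rewrite /kap mulrC ler_pdivrMr ?mulr_gt0 ?exprn_gt0//.
  have : 0 <= m ^+ 2 * `|(x - c) * (x - e)| by rewrite mulr_ge0 ?sqr_ge0 ?normr_ge0.
  by lra.
(* A lower bound for [pk y 0] on the interval: it turns a constant error inside into a multiple of
   the kernel. *)
pose pmin := y ^+ 2 / ((`|c| + `|e|) ^+ 2 + y ^+ 2).
have pmin0 : 0 < pmin.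
  by rewrite divr_gt0 ?exprn_gt0// ltr_wpDl ?sqr_ge0 ?exprn_gt0.
have pminP x : c < x < e -> pmin <= pk y 0 x.
  move=> /andP[cx xe]; rewrite /pmin /pk subr0.
  rewrite ler_pM2l ?exprn_gt0// lef_pV2 ?posrE// ?ltr_wpDl ?sqr_ge0 ?exprn_gt0//.
  rewrite lerD2r -[leLHS]real_normK ?num_real// ler_pXn2r ?nnegrE ?addr_ge0//.
  rewrite ler_norml; apply/andP; split.
    by have := ler_norm (- c); have := normr_ge0 e; rewrite normrN; lra.
  by have := ler_norm e; have := normr_ge0 c; lra.
(* Two demands: 1/(n kap) <= eps pmin inside the interval, and C1/(1 + n kap) <= eps outside. *)
pose n := (Num.truncn ((C1 / eps + (eps * pmin)^-1) / kap)).+1.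
have n_big : C1 / eps + (eps * pmin)^-1 <= n%:R * kap.
  by rewrite -ler_pdivrMr// ltW// truncnS_gt.
pose p : {poly R} :=
  1%:P - (1%:P - ((K%:R ^+ 2)^-1 ^+ n.+1) *: 'X^(2 * n.+1)) ^+ (K ^ (2 * n.+1)).
have pE z : p.[z] = 1 - (1 - (z ^+ 2 / K%:R ^+ 2) ^+ n.+1) ^+ (K ^ (2 * n.+1)).
  rewrite /p hornerD hornerN horner_exp hornerD hornerN hornerZ hornerXn !hornerC.
  by rewrite (exprM z 2) -exprMn [_^-1 * _]mulrC.
have tb x : 0 <= (v x ^+ 2 / K%:R ^+ 2) ^+ n.+1 <= 1.
  rewrite exprn_ge0 ?divr_ge0 ?sqr_ge0//= exprn_ile1 ?divr_ge0 ?sqr_ge0//.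
  rewrite ler_pdivrMr ?exprn_gt0 ?ltr0n// mul1r (le_trans (v2 x))//.
  apply: (@le_trans _ _ C1); first by rewrite ler_piMr// pk_le1.
  by rewrite (le_trans C1K)// expr2 ler_peMr.
have Nt x : (K ^ (2 * n.+1))%:R * (v x ^+ 2 / K%:R ^+ 2) ^+ n.+1 = (v x ^+ 2) ^+ n.+1.
  rewrite natrX exprM -exprMn mulrC mulfVK// gt_eqF// exprn_gt0// ltr0n//.
have key (t : R) N : 0 <= t <= 1 -> [/\ 1 - (1 - t) ^+ N <= N%:R * t,
    1 - (1 - (1 - t) ^+ N) <= (1 + N%:R * t)^-1 & 0 <= 1 - (1 - t) ^+ N <= 1].
  move=> t01; split.
  - by rewrite lerBlDr -lerBlDl bernoulli_lower.
  - by rewrite subKr bernoulli_upper.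
  - have /andP[t0 t1] := t01; rewrite subr_ge0 lerBlDr lerDl.
    by rewrite exprn_ge0 ?subr_ge0// exprn_ile1 ?subr_ge0// lerBlDr lerDl.
have pub x : p.[v x] <= (v x ^+ 2) ^+ n.+1.
  by rewrite pE -Nt; have [] := key _ (K ^ (2 * n.+1))%N (tb x).
have plb x : 1 - p.[v x] <= (1 + (v x ^+ 2) ^+ n.+1)^-1.
  by rewrite pE -Nt; have [] := key _ (K ^ (2 * n.+1))%N (tb x).
have p0 x : 0 <= p.[v x] <= 1.
  by rewrite pE; have [] := key _ (K ^ (2 * n.+1))%N (tb x).
clearbody p; clear pE Nt tb key.
exists p, (C1 ^+ n.+1); split=> [|x]; first exact: exprn_ge0.
have /andP[p0x p1x] := p0 x.
have v2n0 k : 0 <= (v x ^+ 2) ^+ k by exact/exprn_ge0/sqr_ge0.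
have v2C : v x ^+ 2 <= C1 by rewrite (le_trans (v2 x))// ler_piMr// pk_le1.
split=> //.
  apply: le_trans (pub x) _; rewrite exprS [C1 ^+ _]exprSr mulrC -mulrA.
  apply: ler_pM (v2 x); [exact/exprn_ge0/sqr_ge0|exact: sqr_ge0|].
  by apply: lerXn2r; rewrite ?nnegrE ?sqr_ge0.
have np : `|\1_(`]c, e[%classic) x - p.[v x]| <= 1.
  by rewrite indicE; case: (_ \in _); rewrite ler_norml /=; lra.
have pk0 s u : 0 <= pk s u x by exact: pk_ge0.
(* Within eps of an endpoint the trivial error 1 is charged to the narrow kernel, which is at least
   1/2 there. *)
have near z : `|x - z| < eps -> 1 <= 2 * pk eps z x.
  move=> xz; rewrite /pk mulrA ler_pdivlMr ?ltr_wpDl ?sqr_ge0 ?exprn_gt0//.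
  rewrite mul1r -[(x - z) ^+ 2]real_normK ?num_real//.
  have := normr_ge0 (x - z); nra.
have b1 := pk0 eps c; have b2 := pk0 eps e.
have b3 : 0 <= eps * pk y 0 x by rewrite mulr_ge0// ltW.
have [/near xc|xc] := ltP `|x - c| eps; first by lra.
have [/near xe|xe] := ltP `|x - e| eps; first by lra.
have fx := far x xc xe.
suff : `|\1_(`]c, e[%classic) x - p.[v x]| <= eps * pk y 0 x by lra.
have kk : kap <= `|(x - c) * (x - e)| / (x ^+ 2 + y ^+ 2) by rewrite ler_pdivlMr.
have [cxe|cxe] := boolP (c < x < e).
  have -> : \1_(`]c, e[%classic) x = 1 :> R.
    by rewrite indicE mem_set//= in_itv.
  rewrite ger0_norm ?subr_ge0//; apply: le_trans (plb x) _.
  have v1 : 1 + kap <= v x.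
    rewrite vE; move: kk; rewrite ler0_norm; first by rewrite mulNr; lra.
    by move: cxe => /andP[]; nra.
  apply: (@le_trans _ _ (n%:R * kap)^-1).
    rewrite lef_pV2 ?posrE ?mulr_gt0 ?ltr0n//; last first.
      by rewrite ltr_wpDr.
    have B : 1 + n.+1%:R * kap <= (1 + kap) ^+ n.+1.
      elim: (n.+1) => [|k IH]; first by rewrite mul0r addr0 expr0.
      apply: (@le_trans _ _ ((1 + kap) * (1 + k%:R * kap))).
        have : 0 <= k%:R * kap by rewrite mulr_ge0// ltW.
        by rewrite -natr1; nra.
      by rewrite exprS ler_wpM2l// addr_ge0// ltW.
    have : (1 + kap) ^+ n.+1 <= (v x ^+ 2) ^+ n.+1.
      by apply: lerXn2r; rewrite ?nnegrE; nra.
    by move: B; rewrite -[n.+1%:R]natr1 mulrDl mul1r; lra.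
  apply: (@le_trans _ _ (eps * pmin)); last by rewrite ler_pM2l// pminP.
  have ep : 0 < eps * pmin by exact: mulr_gt0.
  have nk : 0 < n%:R * kap by rewrite mulr_gt0 ?ltr0n.
  rewrite invf_ple ?posrE//.
  have : 0 <= C1 / eps by rewrite divr_ge0// ltW.
  by lra.
have -> : \1_(`]c, e[%classic) x = 0 :> R.
  by rewrite indicE memNset//= in_itv /=; apply/negP.
rewrite sub0r normrN ger0_norm//; apply: le_trans (pub x) _.
have v1 : v x <= 1 - kap.
  rewrite vE; move: kk; rewrite ger0_norm; first by lra.
  move: cxe; rewrite negb_and -!leNgt => /orP[] h.
    by apply: mulr_le0; lra.
  by apply: mulr_ge0; lra.
have v2k : v x ^+ 2 <= 1 - kap by have := vN x; nra.
rewrite exprS; apply: (@le_trans _ _ (C1 * pk y 0 x * (1 - kap) ^+ n)).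
  apply: ler_pM (v2 x) _; [exact: sqr_ge0|exact/exprn_ge0/sqr_ge0|].
  by apply: lerXn2r => //; rewrite nnegrE ?sqr_ge0//; lra.
rewrite mulrAC; apply: ler_wpM2r; first exact: pk0.
have kb : 0 <= kap <= 1 by lra.
apply: (@le_trans _ _ (C1 * (1 + n%:R * kap)^-1)).
  by rewrite ler_wpM2l// bernoulli_upper.
have nk : 0 < 1 + n%:R * kap by rewrite ltr_wpDr ?mulr_ge0 ?ltW.
rewrite ler_pdivrMr// mulrC -ler_pdivrMr//.
have : 0 <= (eps * pmin)^-1 by rewrite invr_ge0 ltW// mulr_gt0.
by lra.
Qed.

End Window.

(** * Comparison of resolvents and their polynomials on two nested regions *)

Section Decoupling.
Variables (R : realType) (T : choiceType).
Local Notation C := R[i].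
Implicit Types (F G H : T -> T -> C) (L : {fset T}).

(** Kernels are functions on all of T and the region enters only through the summation, so that the
    kernels of a box and of a cell inside it can be subtracted. *)
Fixpoint kpow L F (k : nat) (x y : T) : C :=
  if k is k'.+1 then \sum_(u <- L) F x u * kpow L F k' u y else (x == y)%:R.

Lemma normc_sum_fset_le L (F : T -> C) (P : pred T) (M : R) : 0 <= M ->
  (forall u, u \in L -> P u -> normc (F u) <= M) ->
  normc (\sum_(u <- L | P u) F u) <= #|` L|%:R * M.
Proof.
move=> M0 FM; apply: le_trans (normc_sum _ _ _) _.
rewrite big_seq_cond; apply: (@le_trans _ _ (\sum_(u <- L) M)).
  rewrite [leRHS]big_seq big_mkcondr /=; apply: ler_sum => u uL.
  by case: ifP => // Pu; exact: FM.
by rewrite big_const_seq count_predT iter_addr_0 mulr_natl.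
Qed.

(** [far r x y] stands for a distance larger than r; [far_tri] is the contrapositive of the triangle
    inequality. *)
Variable far : nat -> rel T.
Hypothesis far_refl : forall r x, far r x x = false.
Hypothesis far_sym : forall r x y, far r x y = far r y x.
Hypothesis far_tri : forall r s x u y, far (r + s)%N x y -> far r x u || far s u y.

Variables (L L' : {fset T}).
Hypothesis LL' : {subset L' <= L}.
Local Notation N := (#|` L|%:R : R).

Let in' (x : T) : C := (x \in L')%:R.

(** The distance is taken to L \ L' only: faces that the cell shares with the box do not count as
    boundary. *)
Definition deep r y := (y \in L') && [forall u : L, (val u \notin L') ==> far r y (val u)].

Lemma deepP r y u : deep r y -> u \in L -> u \notin L' -> far r y u.
Proof.
by move=> /andP[_ /forallP h] uL; have := h [` uL]%fset => /implyP; apply.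
Qed.

Section Resolvents.
Variables (H G G' : T -> T -> C) (z : C).
Hypothesis GH : forall x y, x \in L -> y \in L ->
  \sum_(u <- L) G x u * (H u y - z * (u == y)%:R) = (x == y)%:R.
Hypothesis HG' : forall x y, x \in L' -> y \in L' ->
  \sum_(u <- L') (H x u - z * (x == u)%:R) * G' u y = (x == y)%:R.

(** The double sum S of G (H - z) G', with u in L and h in L', is evaluated twice: summing over u
    first uses G (H - z) = 1 on L, summing over h first uses (H - z) G' = 1 on L'. The second
    evaluation leaves over the terms with u outside L', where u differs from h and z drops out. *)
Lemma geometric_resolvent x y : x \in L -> y \in L' ->
  G x y - in' x * G' x y =
  - \sum_(u <- L | u \notin L') \sum_(h <- L') G x u * H u h * G' h y.
Proof.
move=> xL yL'.
pose S := \sum_(u <- L) \sum_(h <- L')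
  G x u * (H u h - z * (u == h)%:R) * G' h y.
have S1 : S = in' x * G' x y.
  rewrite /S exchange_big /=.
  transitivity (\sum_(h <- L') (x == h)%:R * G' h y).
    rewrite [LHS]big_seq [RHS]big_seq; apply: eq_bigr => h hL'.
    by rewrite -mulr_suml GH// LL'.
  rewrite /in'; have [xL'|xL'] := boolP (x \in L').
    rewrite (big_fsetD1 x)//= eqxx mul1r big_seq big1 ?addr0 ?mul1r// => h.
    by rewrite !inE => /andP[/negPf hx _]; rewrite eq_sym hx mul0r.
  rewrite mul0r big_seq big1// => h hL'.
  by have [xh|_] := eqVneq x h; [rewrite xh hL' in xL'|rewrite mul0r].
have S2 : S = G x y + \sum_(u <- L | u \notin L') \sum_(h <- L') G x u * H u h * G' h y.
  rewrite /S (bigID (mem L'))/=; congr (_ + _).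
    transitivity (\sum_(u <- L | u \in L') G x u * (u == y)%:R).
      rewrite [LHS]big_seq_cond [RHS]big_seq_cond.
      apply: eq_bigr => u /andP[uL uL']; rewrite -HG'// mulr_sumr.
      by apply: eq_bigr => h _; rewrite mulrA.
    have yL := LL' yL'.
    rewrite big_mkcond (big_fsetD1 y)//= yL' eqxx mulr1 big_seq big1 ?addr0// => h.
    by rewrite !inE => /andP[/negPf hy _]; rewrite hy mulr0 if_same.
  rewrite [LHS]big_seq_cond [RHS]big_seq_cond.
  apply: eq_bigr => u /andP[uL uL'].
  rewrite [LHS]big_seq [RHS]big_seq; apply: eq_bigr => h hL'.
  have -> : (u == h) = false by apply/eqP => uh; rewrite uh hL' in uL'.
  by rewrite mulr0 subr0.
by rewrite -S1 S2 opprD addNKr.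
Qed.

Variables (g h0 theta : R) (r : nat).
Hypotheses (g0 : 0 <= g) (h00 : 0 <= h0) (theta0 : 0 <= theta).
Hypothesis Hh0 : forall u h, u != h -> normc (H u h) <= h0.
Hypothesis G'g : forall x y, x \in L' -> y \in L' -> normc (G' x y) <= g.
Hypothesis Gfar : forall x y, x \in L -> y \in L -> far r x y ->
  normc (G x y) <= theta.
Hypothesis G'far : forall x y, x \in L' -> y \in L' -> far r x y ->
  normc (G' x y) <= theta.

(** If x is far from y, both Green functions are small. Otherwise x is within r of y, and as y has
    depth 2r, every u outside L' is far from x, which makes each term of [geometric_resolvent]
    small. H may have infinite range, so all pairs (u, h) are counted, whence N^2. *)
Lemma resolvent_decoupling x y : x \in L -> deep (r + r) y ->
  normc (G x y - in' x * G' x y) <= theta * (2 + N ^+ 2 * h0 * g).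
Proof.
move=> xL dy; have /andP[yL' _] := dy; have yL := LL' yL'.
have N0 : 0 <= N by [].
have hg : 0 <= theta * (N ^+ 2 * h0 * g) by rewrite !mulr_ge0.
have [fxy|nfxy] := boolP (far r x y).
  apply: (@le_trans _ _ (theta + theta)); last by rewrite mulrDr; lra.
  apply: le_trans (le_normcD _ _) _; apply: lerD; first exact: Gfar.
  rewrite normcN /in'; have [xL'|_] := boolP (x \in L').
    by rewrite mul1r G'far.
  by rewrite mul0r normc0.
rewrite geometric_resolvent// normcN.
apply: (@le_trans _ _ (N * (N * (theta * h0 * g)))); last first.
  rewrite (_ : N * _ = theta * (N ^+ 2 * h0 * g)); last by ring.
  by rewrite mulrDr lerDr mulr_ge0.
apply: normc_sum_fset_le => [|u uL uL']; first by rewrite !mulr_ge0.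
apply: (@le_trans _ _ (#|` L'|%:R * (theta * h0 * g))); last first.
  rewrite ler_wpM2r ?mulr_ge0// ler_nat; apply: fsubset_leq_card.
  by apply/fsubsetP.
apply: normc_sum_fset_le => [|h hL' _]; first by rewrite !mulr_ge0.
rewrite !normcM; apply: ler_pM; rewrite ?mulr_ge0 ?normc_ge0//; last exact: G'g.
apply: ler_pM; rewrite ?normc_ge0//.
  apply: Gfar => //; have := far_tri x (deepP dy uL uL').
  by rewrite far_sym (negPf nfxy).
by apply: Hh0; apply: contra uL' => /eqP ->.
Qed.

End Resolvents.

Section Powers.
Variables (B B' : T -> T -> C) (b theta : R) (r : nat).
Hypotheses (b1 : 1 <= b) (theta0 : 0 <= theta).
Hypothesis Bb : forall x y, x \in L -> y \in L -> normc (B x y) <= b.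
Hypothesis B'b : forall x y, x \in L' -> y \in L' -> normc (B' x y) <= b.
Hypothesis B'far : forall x y, x \in L' -> y \in L' -> far r x y ->
  normc (B' x y) <= theta.
Hypothesis BB' : forall x y, x \in L -> deep (r + r) y ->
  normc (B x y - in' x * B' x y) <= theta.

Let b0 : 0 <= b. Proof. exact: le_trans b1. Qed.
Let NL' : #|` L'|%:R <= N.
Proof. by rewrite ler_nat; apply: fsubset_leq_card; apply/fsubsetP. Qed.
Let Nb0 : 0 <= N * b. Proof. by rewrite mulr_ge0. Qed.
(** The factor 4 per step covers the four contributions of size N b eps in the induction of
    [kpow_decoupling]. *)
Let eps k : R := (4 * (N * b)) ^+ k * theta.
Let eps0 k : 0 <= eps k.
Proof. by rewrite mulr_ge0// exprn_ge0// mulr_ge0. Qed.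
Let epsS k : eps k.+1 = 4 * (N * b) * eps k.
Proof. by rewrite /eps exprS -[LHS]mulrA. Qed.
Let Nb_eps k : (N * b) ^+ k * theta <= eps k.
Proof.
rewrite ler_wpM2r//; apply: lerXn2r; rewrite ?nnegrE ?mulr_ge0//.
by rewrite ler_peMl//; lra.
Qed.

Let beps0 k : 0 <= b * eps k. Proof. exact: mulr_ge0. Qed.
Let Nbt0 k : 0 <= (N * b) ^+ k * theta.
Proof. by apply: mulr_ge0 => //; exact: exprn_ge0. Qed.

Lemma normc_kpow_le k x y : x \in L' -> y \in L' ->
  normc (kpow L' B' k x y) <= (N * b) ^+ k.
Proof.
elim: k x => [|k IH] x xL' yL' /=.
  rewrite expr0; case: (_ == _); first by rewrite normc1.
  by rewrite normc0.
have h : 0 <= b * (N * b) ^+ k by rewrite mulr_ge0// exprn_ge0.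
apply: (@le_trans _ _ (#|` L'|%:R * (b * (N * b) ^+ k))).
  apply: normc_sum_fset_le => // u uL' _; rewrite normcM.
  by apply: ler_pM; rewrite ?normc_ge0 ?B'b ?IH.
by rewrite exprS -mulrA ler_wpM2r.
Qed.

(** A chain of k steps covering a distance of more than k r contains a step longer than r. *)
Lemma kpow_far k x y : x \in L' -> y \in L' -> far (k * r) x y ->
  normc (kpow L' B' k x y) <= eps k.
Proof.
elim: k x => [|k IH] x xL' yL' fxy /=.
  have [xy|_] := eqVneq x y; first by rewrite xy far_refl in fxy.
  by rewrite normc0.
have h : 0 <= b * eps k + (N * b) ^+ k * theta by exact: addr_ge0.
apply: (@le_trans _ _ (#|` L'|%:R * (b * eps k + (N * b) ^+ k * theta))).
  apply: normc_sum_fset_le => // u uL' _; rewrite normcM.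
  rewrite mulSn in fxy; have /orP[fxu|fuy] := far_tri u fxy.
    apply: (@le_trans _ _ (theta * (N * b) ^+ k)).
      by apply: ler_pM; rewrite ?normc_ge0 ?B'far ?normc_kpow_le.
    by rewrite mulrC lerDr.
  apply: (@le_trans _ _ (b * eps k)).
    by apply: ler_pM; rewrite ?normc_ge0 ?B'b ?IH.
  by rewrite lerDl.
apply: (@le_trans _ _ (N * (b * eps k + (N * b) ^+ k * theta))).
  by rewrite ler_wpM2r.
have e1 : N * ((N * b) ^+ k * theta) <= N * b * eps k.
  rewrite -mulrA; apply: ler_wpM2l => //; apply: le_trans (Nb_eps k) _.
  by rewrite ler_peMl.
have := eps0 k; rewrite epsS => e2.
have : 0 <= N * b * eps k by exact: mulr_ge0.
by rewrite mulrDr; lra.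
Qed.

(** Telescoping: B B^k - B' B'^k = B (B^k - B'^k) + (B - B') B'^k. In the second term, either the
    intermediate point u is at distance more than k r from y and B'^k is small, or u still has depth
    2r and B - B' is small. Depth (k + 2) r is exactly what this alternative consumes. *)
Lemma kpow_decoupling k x y : x \in L -> deep ((k + 2) * r) y ->
  normc (kpow L B k x y - in' x * kpow L' B' k x y) <= eps k.
Proof.
elim: k x => [|k IH] x xL dy /=; have /andP[yL' _] := dy.
  rewrite /in'; have [xL'|xL'] := boolP (x \in L').
    by rewrite mul1r subrr normc0.
  rewrite mul0r subr0; have [xy|_] := eqVneq x y; last by rewrite normc0.
  by rewrite xy yL' in xL'.
have yL := LL' yL'.
have dy' : deep ((k + 2) * r) y.
  apply/andP; split=> //; apply/forallP => u; apply/implyP => uL'.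
  have := deepP dy (valP u) uL'; rewrite !addSn mulSn addnC => /(far_tri (val u)).
  by rewrite far_refl orbF.
have -> : \sum_(u <- L) B x u * kpow L B k u y -
    in' x * (\sum_(u <- L') B' x u * kpow L' B' k u y) =
    \sum_(u <- L) B x u * (kpow L B k u y - in' u * kpow L' B' k u y) +
    \sum_(u <- L') (B x u - in' x * B' x u) * kpow L' B' k u y.
  under [X in _ = X + _]eq_bigr do rewrite mulrBr.
  under [X in _ = _ + X]eq_bigr do rewrite mulrBl -mulrA.
  rewrite !sumrB -mulr_sumr -addrA; congr (_ + _).
  suff -> : \sum_(u <- L) B x u * (in' u * kpow L' B' k u y) =
      \sum_(u <- L') B x u * kpow L' B' k u y by rewrite addrA addNr add0r.
  rewrite -(@big_fset_incl _ _ _ _ L')/=; last 2 first.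
  - exact/fsubsetP.
  - by move=> u _ /negPf uL'; rewrite /in' uL' mul0r mulr0.
  rewrite [LHS]big_seq [RHS]big_seq; apply: eq_bigr => u uL'.
  by rewrite /in' uL' mul1r.
apply: le_trans (le_normcD _ _) _.
apply: (@le_trans _ _ (N * (b * eps k) +
    N * ((N * b) ^+ k * theta + 2 * b * eps k))).
  apply: lerD.
    apply: normc_sum_fset_le => [//|u uL _].
    by rewrite normcM; apply: ler_pM; rewrite ?normc_ge0 ?Bb ?IH.
  have b2 : 0 <= 2 * b * eps k by rewrite -mulrA mulr_ge0.
  have h : 0 <= (N * b) ^+ k * theta + 2 * b * eps k by exact: addr_ge0.
  apply: (@le_trans _ _ (#|` L'|%:R * ((N * b) ^+ k * theta + 2 * b * eps k))).
    apply: normc_sum_fset_le => // u uL' _; rewrite normcM.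
    have [fuy|fuy] := boolP (far (k * r) u y).
      apply: (@le_trans _ _ (2 * b * eps k)); last first.
        by rewrite lerDr.
      apply: ler_pM; rewrite ?normc_ge0 ?kpow_far//.
      apply: le_trans (le_normcD _ _) _.
      rewrite mulr_natl mulr2n; apply: lerD; first by rewrite Bb// LL'.
      rewrite normcN /in'; have [xL'|_] := boolP (x \in L').
        by rewrite mul1r B'b.
      by rewrite mul0r normc0.
    apply: (@le_trans _ _ ((N * b) ^+ k * theta)); last first.
      by rewrite lerDl.
    rewrite mulrC; apply: ler_pM; rewrite ?normc_ge0 ?normc_kpow_le//.
    apply: BB' => //; apply/andP; split=> //; apply/forallP => w.
    apply/implyP => wL'; have := deepP dy' (valP w) wL'.
    rewrite mulnDl mul2n -addnn => /(far_tri u).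
    by rewrite far_sym (negPf fuy).
  by rewrite ler_wpM2r.
rewrite epsS.
have e1 : N * ((N * b) ^+ k * theta) <= N * b * eps k.
  rewrite -mulrA; apply: ler_wpM2l => //; apply: le_trans (Nb_eps k) _.
  by rewrite ler_peMl.
by rewrite mulrDr; lra.
Qed.

End Powers.

End Decoupling.

(** * Matrix elements, distances and kernels on the lattice *)

Section Lattice.
Variables (R : realType) (d : nat).
Local Notation C := R[i].
Implicit Types (u v : ell2 R d) (x y : lattice d).

Lemma lattice_sum_supp (f : lattice d -> R) x : (forall y, y != x -> f y = 0) ->
  lattice_sum f = f x.
Proof.
move=> f0; have E (g : lattice d -> R) : (forall y, 0 <= g y) ->
    (forall y, y != x -> g y = 0) ->
    fine (\esum_(y in [set: lattice d]) (g y)%:E) = g x.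
  move=> g0 gx; rewrite (esumID [set x]) => [|y _]; last by rewrite lee_fin.
  rewrite [X in (_ + X)%E]esum1 ?adde0; last first.
    by move=> y [_ /eqP/gx ->].
  by rewrite setTI esum_set1 ?lee_fin.
rewrite /lattice_sum !E.
- by rewrite -[in RHS](funrposBneg f).
- by move=> y; rewrite funrneg_ge0.
- by move=> y /f0 fy; rewrite /funrneg fy oppr0 maxxx.
- by move=> y; rewrite funrpos_ge0.
- by move=> y /f0 fy; rewrite /funrpos fy maxxx.
Qed.

Lemma delta_same x : (delta R x x : C) = 1.
Proof. by rewrite /= eqxx. Qed.

Lemma delta_other x y : y != x -> (delta R x y : C) = 0.
Proof. by move=> /negPf yx; rewrite /= yx. Qed.

Lemma l2dot_delta_r u x : l2dot u (delta R x) = (u x : C)^*.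
Proof.
rewrite /l2dot !(@lattice_sum_supp _ x).
- by rewrite delta_same mulr1; case: (u x).
- by move=> y /delta_other ->; rewrite mulr0.
- by move=> y /delta_other ->; rewrite mulr0.
Qed.

Lemma l2dot_delta_l u x : l2dot (delta R x) u = u x.
Proof.
rewrite /l2dot !(@lattice_sum_supp _ x).
- rewrite delta_same; case: (u x : C) => p q /=.
  by rewrite oppr0 !mul0r !mul1r subr0 addr0.
- by move=> y /delta_other ->; case: (u y : C) => p q /=;
    rewrite oppr0 !mul0r ?subr0 ?addr0.
- by move=> y /delta_other ->; case: (u y : C) => p q /=;
    rewrite oppr0 !mul0r ?subr0 ?addr0.
Qed.

Lemma normc_le_l2norm u x : normc (u x : C) <= l2norm u.
Proof.
rewrite /l2norm -[leLHS](ger0_norm (normc_ge0 _)) -sqrtr_sqr ler_wsqrtr//.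
have /sqsumP fin := valP u; set S := esum _ _ in fin *.
have S0 : (0 <= S)%E by apply: esum_ge0 => y _; rewrite lee_fin sqr_ge0.
rewrite -lee_fin fineK ?ge0_fin_numE//.
have -> : (normc (u x : C) ^+ 2)%:E =
    (\esum_(y in [set x]) (normc (u y : C) ^+ 2)%:E)%E.
  by rewrite esum_set1// lee_fin sqr_ge0.
rewrite /S [leRHS](esumID [set x]) => [|y _]; last by rewrite lee_fin sqr_ge0.
rewrite setTI leeDl// esum_ge0// => y _; rewrite lee_fin; exact: sqr_ge0.
Qed.

Lemma l2norm_delta x : l2norm (delta R x) = 1.
Proof.
rewrite /l2norm (esumID [set x]) => [|y _]; last by rewrite lee_fin sqr_ge0.
rewrite [X in (_ + X)%E]esum1 ?adde0; last first.
  by move=> y [_ /eqP/negPf yx] /=; rewrite yx normc0 expr0n.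
rewrite setTI esum_set1 ?lee_fin ?sqr_ge0//= eqxx normc1 expr1n.
by rewrite sqrtr1.
Qed.

Variable H0 : {linear ell2 R d -> ell2 R d}.

Lemma anderson_delta V x y : anderson_fun H0 V (delta R y) x =
  (H0 (delta R y) x : C) + (V x * (x == y)%:R)%:C.
Proof.
rewrite /anderson_fun; congr (_ + _); have [->|xy] := eqVneq x y.
  by rewrite delta_same !mulr1.
by rewrite delta_other// !mulr0.
Qed.

Lemma bounded_op_entry : bounded_op H0 ->
  exists2 h0 : R, 0 <= h0 & forall x y, normc (H0 (delta R y) x : C) <= h0.
Proof.
move=> [M hM]; exists `|M| => // x y; apply: le_trans (normc_le_l2norm _ _) _.
apply: le_trans (hM _) _; rewrite l2norm_delta mulr1.
exact: ler_norm.
Qed.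

Lemma selfadjoint_entry : selfadjoint_op H0 ->
  forall x y, (H0 (delta R y) x : C) = (H0 (delta R x) y : C)^*.
Proof.
move=> sa x y; have := sa (delta R y) (delta R x).
by rewrite l2dot_delta_r l2dot_delta_l => <-; rewrite conjcK.
Qed.

(** The sup-norm distance, suited to cubes; [far_euclid] passes to the Euclidean distance of
    (Loc). *)
Definition far (r : nat) x y := [exists i, r%:Z < `|x ord0 i - y ord0 i|].

Lemma far_refl r x : far r x x = false.
Proof.
by apply/existsP => -[k]; rewrite subrr normr0.
Qed.

Lemma far_sym r x y : far r x y = far r y x.
Proof. by apply: eq_existsb => i; rewrite distrC. Qed.

Lemma far_tri r s x z y : far (r + s)%N x y -> far r x z || far s z y.
Proof.
move=> /existsP[i xy]; apply/orP.
have tri := ler_distD (z ord0 i) (x ord0 i) (y ord0 i).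
have [rx|xr] := ltP r%:Z `|x ord0 i - z ord0 i|.
  by left; apply/existsP; exists i.
right; apply/existsP; exists i.
rewrite PoszD in xy; lia.
Qed.

Lemma far_euclid r x y : far r x y -> r%:R <= euclid_dist R x y.
Proof.
move=> /existsP[i rxy].
have -> : r%:R = Num.sqrt (r%:R ^+ 2) :> R by rewrite sqrtr_sqr normr_nat.
apply: ler_wsqrtr; rewrite (bigD1 i)//= -[leLHS]addr0; apply: lerD; last first.
  by apply: sumr_ge0 => j _; exact: sqr_ge0.
rewrite -[leRHS]real_normK ?num_real//; apply: lerXn2r; rewrite ?nnegrE//.
by rewrite -intr_norm -[r%:R]/(r%:Z%:~R) ler_int ltW.
Qed.

Section Kernel.
Variable L : {fset lattice d}.
Implicit Types M N : 'M[C]_#|{: L}|.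

(** Extension by 0 outside L: matrices over different index types become functions on the same
    lattice. *)
Definition kernel M x y : C :=
  if (insub x, insub y) is (Some i, Some j)
  then M (enum_rank (i : L)) (enum_rank (j : L)) else 0.

Lemma kernelE M (i j : L) : kernel M (val i) (val j) = M (enum_rank i) (enum_rank j).
Proof. by rewrite /kernel !valK. Qed.

Lemma sum_index (I : nmodType) (F : 'I_#|{: L}| -> I) (G : lattice d -> I) :
  (forall i : L, F (enum_rank i) = G (val i)) ->
  \sum_i F i = \sum_(x <- L) G x.
Proof.
move=> FG; rewrite big_seq_fsetE /=.
rewrite (reindex (@enum_rank L))/=; first by apply: eq_bigr => i _; exact: FG.
exact/onW_bij/enum_rank_bij.
Qed.

Lemma kernelM M N x y : x \in L -> y \in L ->
  kernel (M *m N) x y = \sum_(u <- L) kernel M x u * kernel N u y.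
Proof.
move=> xL yL; rewrite -[x]/(val [` xL]%fset) -[y]/(val [` yL]%fset).
rewrite kernelE mxE; apply: sum_index => i.
by rewrite !kernelE.
Qed.

Lemma kernel1 (c : C) x y : x \in L -> y \in L -> kernel c%:M x y = c * (x == y)%:R.
Proof.
move=> xL yL; rewrite -[x]/(val [` xL]%fset) -[y]/(val [` yL]%fset).
rewrite kernelE mxE (inj_eq enum_rank_inj) -val_eqE/=.
by case: (x == y); rewrite ?mulr1 ?mulr0.
Qed.

Lemma kernelB M N x y : kernel (M - N) x y = kernel M x y - kernel N x y.
Proof.
rewrite /kernel; case: insubP => [i _ _|]; last by rewrite subr0.
by case: insubP => [j _ _|]; rewrite ?subr0// !mxE.
Qed.

Lemma kernelZ (c : C) M x y : kernel (c *: M) x y = c * kernel M x y.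
Proof.
rewrite /kernel; case: insubP => [i _ _|]; last by rewrite mulr0.
by case: insubP => [j _ _|]; rewrite ?mulr0// mxE.
Qed.

Lemma kernelX M k x y : x \in L -> y \in L ->
  kernel (M ^+ k) x y = kpow L (kernel M) k x y.
Proof.
elim: k x => [|k IH] x xL yL /=.
  by rewrite expr0 -[1]/(1%:M) kernel1// mul1r.
rewrite exprS [kernel _ _ _]kernelM// [LHS]big_seq [RHS]big_seq.
by apply: eq_bigr => u uL; rewrite IH.
Qed.

Lemma kernel_inv M x y : M \in unitmx -> x \in L -> y \in L ->
  \sum_(u <- L) kernel (invmx M) x u * kernel M u y = (x == y)%:R /\
  \sum_(u <- L) kernel M x u * kernel (invmx M) u y = (x == y)%:R.
Proof.
move=> uM xL yL.
by rewrite -!kernelM// mulVmx// mulmxV// kernel1// mul1r.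
Qed.

End Kernel.

End Lattice.

(** * Deterministic comparison of the box and a cell at one site *)

Section SiteDecoupling.
Variables (R : realType) (d : nat) (H0 : {linear ell2 R d -> ell2 R d}).
Hypothesis H0_selfadjoint : selfadjoint_op H0.
Local Notation C := R[i].
Implicit Types (L : {fset lattice d}) (V : lattice d -> R) (x y : lattice d).

Definition scaled_op (beta E : R) L V : 'M[C]_#|{: L}| :=
  beta%:C *: (compression H0 V L - (E%:C)%:M).

(** [site] indexed by lattice points, with value 0 outside L. *)
Definition lsite L (A : 'M[C]_#|{: L}|) (g : R -> R) x : R :=
  if insub x is Some i then site A g (enum_rank (i : L)) else 0.

Lemma lsiteE L A g (i : L) : lsite A g (val i) = site A g (enum_rank i).
Proof. by rewrite /lsite valK. Qed.

Lemma sum_lsite L (A : 'M[C]_#|{: L}|) g : \sum_(x <- L) lsite A g x = strace A g.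
Proof. by rewrite -sum_site; apply/esym/sum_index => i; rewrite lsiteE. Qed.

Lemma scaled_op_hermitian beta E L V : hermitian (scaled_op beta E L V).
Proof.
move=> i j; rewrite !mxE !anderson_delta (selfadjoint_entry H0_selfadjoint).
rewrite [j == i]eq_sym (inj_eq val_inj) (inj_eq enum_val_inj).
rewrite (inj_eq val_inj) (inj_eq enum_val_inj) [j == i]eq_sym.
case: (H0 _ _ : C) => p q; have [->|ij] := eqVneq i j.
  by apply/eqP; rewrite eq_complex /=; apply/andP; split; apply/eqP; ring.
by apply/eqP; rewrite eq_complex /=; apply/andP; split; apply/eqP; ring.
Qed.

Definition op_kernel (beta E : R) V x y : C :=
  beta%:C * (anderson_fun H0 V (delta R y) x - E%:C * (x == y)%:R).

Lemma kernel_scaled_op beta E L V x y : x \in L -> y \in L ->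
  kernel (scaled_op beta E L V) x y = op_kernel beta E V x y.
Proof.
move=> xL yL; rewrite kernelZ kernelB kernel1//; congr (_ * (_ - _)).
by rewrite -[x]/(val [` xL]%fset) -[y]/(val [` yL]%fset) kernelE mxE !enum_rankK.
Qed.

Lemma op_kernel_off beta E V x y : x != y ->
  op_kernel beta E V x y = beta%:C * (H0 (delta R y) x : C).
Proof.
move=> xy; by rewrite /op_kernel anderson_delta (negPf xy) !mulr0 subr0 addr0.
Qed.

Lemma scaled_resolvent beta E L V s : 0 < beta -> 0 < s ->
  invmx (scaled_op beta E L V - (0 +i* s)%:M) =
  (beta^-1)%:C *: invmx (compression H0 V L - (E +i* (s / beta))%:M).
Proof.
move=> b0 s0.
have e : scaled_op beta E L V - (0 +i* s)%:M =
    beta%:C *: (compression H0 V L - (E +i* (s / beta))%:M).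
  rewrite /scaled_op !scalerBr -addrA; congr (_ + _).
  rewrite -opprD; congr (- _); rewrite !scale_scalar_mx -raddfD/=.
  congr (_%:M); apply/eqP; rewrite eq_complex/=; apply/andP; split; apply/eqP.
    by ring.
  by field; rewrite gt_eqF.
have uX : scaled_op beta E L V - (0 +i* s)%:M \in unitmx.
  have [] // := @resolventE _ _ (scaled_op beta E L V) (0 +i* s).
    exact: scaled_op_hermitian.
  by rewrite gt_eqF.
have bu : beta%:C \is a GRing.unit.
  by rewrite unitfE eq_complex /= negb_and gt_eqF.
move: uX; rewrite e unitmxZ// => uA.
by rewrite invmxZ ?unitmxZ// fmorphV.
Qed.

(** The coefficient p + iq for which 2 Re ((p + iq) / (t - is)) has numerator 2(pt - qs) = (c + e) t
    + s^2 - ce. *)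
Definition window_coef (c e s : R) : C :=
  ((c + e) / 2) +i* (- ((s ^+ 2 - c * e) / (2 * s))).

Lemma window_funE (c e s t : R) : 0 < s ->
  (window_fun c e s t)%:C = window_coef c e s * (t%:C - (0 +i* s))^-1 +
    (window_coef c e s * (t%:C - (0 +i* s))^-1)^*.
Proof.
move=> s0; apply/eqP; rewrite eq_complex /=; apply/andP; split; apply/eqP.
  rewrite /window_fun subr0 sub0r sqrrN.
  have h : t ^+ 2 + s ^+ 2 != 0 by rewrite gt_eqF// ltr_wpDl ?sqr_ge0 ?exprn_gt0.
  by field; rewrite h gt_eqF.
by rewrite subrr.
Qed.

(** The conjugate of a function of A is the adjoint matrix, so the (l,k) entry of the resolvent
    appears next to the (k,l) entry. Decoupling is therefore needed in both orders of the
    indices. *)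
Lemma window_matrix n (A : 'M[C]_n) (c e s : R) k l : hermitian A -> 0 < s ->
  fcalc A (fun t => (window_fun c e s t)%:C) k l =
  window_coef c e s * invmx (A - (0 +i* s)%:M) k l +
  (window_coef c e s * invmx (A - (0 +i* s)%:M) l k)^*.
Proof.
move=> hA s0; have [|_ ->] := @resolventE _ _ A (0 +i* s) hA.
  by rewrite gt_eqF.
set a := window_coef c e s; pose g (t : R) : C := (t%:C - (0 +i* s))^-1.
rewrite -/g.
have -> : fcalc A (fun t => (window_fun c e s t)%:C) =
    fcalc A (fun t => a * g t) + fcalc A (fun t => (a * g t)^*).
  by rewrite fcalcD; apply: eq_fcalc => i; rewrite window_funE.
have Z k' l' : a * fcalc A g k' l' = fcalc A (fun t => a * g t) k' l'.
  by rewrite -fcalcZ [RHS]mxE.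
rewrite [LHS]mxE; congr (_ + _); first exact/esym/Z.
apply: etrans (esym (fcalc_ct A (fun t => a * g t) k l)) _.
by apply: congr1; exact/esym/Z.
Qed.

Lemma site_horner n (A : 'M[C]_n) (f : R -> R) (p : {poly R}) k :
  (site A (fun t => p.[f t]) k)%:C =
  \sum_(j < size p) (p`_j)%:C * (fcalc A (fun t => (f t)%:C) ^+ j) k k.
Proof.
rewrite -fcalc_site fcalc_diag.
under [RHS]eq_bigr do rewrite fcalcX fcalc_diag mulr_sumr.
rewrite exchange_big /=; apply: eq_bigr => i _.
rewrite horner_coef rmorph_sum mulr_sumr; apply: eq_bigr => j _.
rewrite [X in _ * X]realcM [X in _ * (_ * X)](rmorphXn (real_complex R)).
by rewrite [LHS]mulrCA.
Qed.

Lemma far_mono (r s : nat) x y : (s <= r)%N -> far r x y -> far s x y.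
Proof.
move=> sr /existsP[i h]; apply/existsP; exists i; apply: le_lt_trans h.
by rewrite lez_nat.
Qed.

Lemma deep_mono (r s : nat) L L' x : (s <= r)%N ->
  deep (@far d) L L' r x -> deep (@far d) L L' s x.
Proof.
move=> sr dx; have /andP[xL' _] := dx; apply/andP; split=> //.
apply/forallP => u; apply/implyP => uL'.
by apply: far_mono sr _; apply: deepP dx _ _ => //; exact: valP.
Qed.

(** The sum of |p_j|, times the growth (4 N b)^(size p) from [kpow_decoupling] with the entry bound
    b = 1 + 2a/s, times the one-step error 2a theta (2 + N^2 h g) from [resolvent_decoupling] with h
    = beta h0 and g = 1/s. *)
Definition decoupling_bound (N : nat) (c e s beta h0 theta : R) (p : {poly R}) : R :=
  let a := normc (window_coef c e s) in
  (\sum_(j < size p) `|p`_j|) * (4 * (N%:R * (1 + 2 * a * s^-1))) ^+ size p *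
  (2 * a * (theta * (2 + N%:R ^+ 2 * (beta * h0) * s^-1))).

Lemma site_decoupling (L L' : {fset lattice d}) V (beta E s theta h0 c e : R)
    (r : nat) (p : {poly R}) x :
  {subset L' <= L} -> 1 <= beta -> 0 < s -> 0 <= theta -> 0 <= h0 ->
  (forall x y, normc (H0 (delta R y) x : C) <= h0) ->
  (forall u v, u \in L -> v \in L -> far r u v ->
    normc (kernel (invmx (compression H0 V L - (E +i* (s / beta))%:M)) u v) <= theta) ->
  (forall u v, u \in L' -> v \in L' -> far r u v ->
    normc (kernel (invmx (compression H0 V L' - (E +i* (s / beta))%:M)) u v) <= theta) ->
  deep (@far d) L L' ((size p + 2) * r) x ->
  `|lsite (scaled_op beta E L V) (fun t => p.[window_fun c e s t]) x -
    lsite (scaled_op beta E L' V) (fun t => p.[window_fun c e s t]) x| <=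
  decoupling_bound #|` L| c e s beta h0 theta p.
Proof.
move=> LL' b1 s0 th0 h00 hH0 far1 far2 dx.
have b0 : 0 < beta by exact: lt_le_trans b1.
have /andP[xL' _] := dx; have xL := LL' _ xL'.
pose G (K : {fset lattice d}) := kernel (invmx (scaled_op beta E K V - (0 +i* s)%:M)).
have Gfar (K : {fset lattice d}) (th : forall u v, u \in K -> v \in K -> far r u v ->
    normc (kernel (invmx (compression H0 V K - (E +i* (s / beta))%:M)) u v) <= theta)
    (u v : lattice d) : u \in K -> v \in K -> far r u v -> normc (G K u v) <= theta.
  move=> uK vK fuv; rewrite /G scaled_resolvent// kernelZ normcM normc_real.
  rewrite -[leRHS]mul1r; apply: ler_pM; rewrite ?normc_ge0 ?th//.
  by rewrite gtr0_norm ?invr_gt0// invf_le1.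
have Gs (K : {fset lattice d}) (u v : lattice d) : u \in K -> v \in K -> normc (G K u v) <= s^-1.
  move=> uK vK; rewrite /G.
  have [||_ ->] := @resolventE _ _ (scaled_op beta E K V) (0 +i* s).
  - exact: scaled_op_hermitian.
  - by rewrite gt_eqF.
  rewrite -[u]/(val [` uK]%fset) -[v]/(val [` vK]%fset) kernelE.
  by apply: normc_fcalc_le => i; exact: normcV_shift_le.
pose Hk := op_kernel beta E V; pose z : C := 0 +i* s.
have GHG (K : {fset lattice d}) (u v : lattice d) : u \in K -> v \in K ->
    \sum_(w <- K) G K u w * (Hk w v - z * (w == v)%:R) = (u == v)%:R /\
    \sum_(w <- K) (Hk u w - z * (u == w)%:R) * G K w v = (u == v)%:R.
  move=> uK vK.
  have uX : scaled_op beta E K V - z%:M \in unitmx.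
    have [] // := @resolventE _ _ (scaled_op beta E K V) z.
      exact: scaled_op_hermitian.
    by rewrite gt_eqF.
  have kX (w t : lattice d) : w \in K -> t \in K ->
      kernel (scaled_op beta E K V - z%:M) w t = Hk w t - z * (w == t)%:R.
    move=> wK tK; rewrite kernelB kernel1//.
    by rewrite kernel_scaled_op.
  have [e1 e2] := kernel_inv uX uK vK.
  split; [rewrite -e1|rewrite -e2]; rewrite [LHS]big_seq [RHS]big_seq;
    apply: eq_bigr => w wK; by rewrite kX.
pose a := window_coef c e s.
pose B K u v := a * G K u v + (a * G K v u)^*.
set N : R := #|` L|%:R.
pose th1 := theta * (2 + N ^+ 2 * (beta * h0) * s^-1).
have sV0 : 0 <= s^-1 by rewrite invr_ge0 ltW.
have th01 : theta * 2 <= th1.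
  by rewrite ler_wpM2l// lerDl !mulr_ge0// ltW.
have bh0 : 0 <= beta * h0 by rewrite mulr_ge0// ltW.
have Hoff (u v : lattice d) : u != v -> normc (Hk u v) <= beta * h0.
  move=> uv; rewrite /Hk op_kernel_off// normcM normc_real.
  by rewrite gtr0_norm// ler_pM2l.
have dec1 (u v : lattice d) : u \in L -> deep (@far d) L L' (r + r) v ->
    normc (G L u v - (u \in L')%:R * G L' u v) <= th1.
  move=> uL dv.
  apply: (resolvent_decoupling (@far_sym d) (@far_tri d) LL' (H := Hk) (z := z)) => //.
  - by move=> ? ? ? ?; exact: (GHG L _ _ _ _).1.
  - by move=> ? ? ? ?; exact: (GHG L' _ _ _ _).2.
  - exact: Gs.
  - exact: Gfar.
  - exact: Gfar.
  - exact: dv.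
(* For the adjoint term: the same lemma applied to the transposed kernels, for which the two
   one-sided inverse identities exchange their roles. *)
have dec2 (u v : lattice d) : u \in L -> deep (@far d) L L' (r + r) v ->
    normc (G L v u - (u \in L')%:R * G L' v u) <= th1.
  move=> uL dv.
  apply: (resolvent_decoupling (@far_sym d) (@far_tri d) LL' (z := z)
    (H := fun x y => Hk y x) (G := fun x y => G L y x)
    (G' := fun x y => G L' y x)) => //.
  - move=> w t wL tL; rewrite [w == t]eq_sym -(GHG L _ _ tL wL).2.
    by apply: eq_bigr => i _; rewrite mulrC [i == t]eq_sym.
  - move=> w t wL tL; rewrite [w == t]eq_sym -(GHG L' _ _ tL wL).1.
    by apply: eq_bigr => i _; rewrite mulrC [w == i]eq_sym.
  - by move=> w t wt; apply: Hoff; rewrite eq_sym.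
  - by move=> w t wL tL; exact: Gs.
  - by move=> w t wL tL; rewrite far_sym; exact: Gfar.
  - by move=> w t wL tL; rewrite far_sym; exact: Gfar.
  - exact: dv.
pose A : R := normc a; have A0 : 0 <= A by exact: normc_ge0.
pose b := 1 + 2 * A * s^-1; pose thB := 2 * A * th1.
have Bb (K : {fset lattice d}) (u v : lattice d) : u \in K -> v \in K -> normc (B K u v) <= b.
  move=> uK vK; apply: le_trans (le_normcD _ _) _; rewrite normc_conj !normcM.
  have h1 : A * normc (G K u v) <= A * s^-1 by rewrite ler_wpM2l// Gs.
  have h2 : A * normc (G K v u) <= A * s^-1 by rewrite ler_wpM2l// Gs.
  by rewrite /b -/A; lra.
have Bfar (u v : lattice d) : u \in L' -> v \in L' -> far r u v -> normc (B L' u v) <= thB.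
  move=> uK vK fuv; apply: le_trans (le_normcD _ _) _; rewrite normc_conj !normcM.
  have h1 : A * normc (G L' u v) <= A * th1.
    by rewrite ler_wpM2l// (le_trans (Gfar _ far2 _ _ _ _ _))//; lra.
  have h2 : A * normc (G L' v u) <= A * th1.
    rewrite ler_wpM2l// (le_trans (Gfar _ far2 _ _ _ _ _))//; last by lra.
    by rewrite far_sym.
  by rewrite /thB -/A; lra.
have BB' (u v : lattice d) : u \in L -> deep (@far d) L L' (r + r) v ->
    normc (B L u v - (u \in L')%:R * B L' u v) <= thB.
  move=> uL dv.
  have -> : B L u v - (u \in L')%:R * B L' u v =
      a * (G L u v - (u \in L')%:R * G L' u v) +
      (a * (G L v u - (u \in L')%:R * G L' v u))^*.
    rewrite /B !(rmorphB, rmorphM) rmorph_nat; case: (u \in L') => /=.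
      by ring.
    by ring.
  apply: le_trans (le_normcD _ _) _; rewrite normc_conj !normcM.
  have h1 := ler_wpM2l A0 (dec1 u v uL dv).
  have h2 := ler_wpM2l A0 (dec2 u v uL dv).
  by rewrite /thB -/A; lra.
have th10 : 0 <= th1 by rewrite (le_trans _ th01)// mulr_ge0.
have thB0 : 0 <= thB by rewrite mulr_ge0// mulr_ge0.
have bb1 : 1 <= b by rewrite lerDl !mulr_ge0.
have powers k : (k < size p)%N ->
    normc (kpow L (B L) k x x - kpow L' (B L') k x x) <= (4 * (N * b)) ^+ size p * thB.
  move=> kp; have := @kpow_decoupling R _ (@far d) (@far_refl d) (@far_sym d)
    (@far_tri d) L L' LL' (B L) (B L') b thB r bb1 thB0 (Bb L) (Bb L') Bfar BB' k x x xL.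
  rewrite xL' mul1r => h; apply: (le_trans (h _)).
    by apply: deep_mono dx; rewrite leq_mul2r leq_add2r ltnW// orbT.
  rewrite ler_wpM2r// ler_weXn2l ?(ltnW kp)//.
  have N1 : 1 <= N.
    by rewrite ler1n cardfs_gt0; apply/fset0Pn; exists x.
  by rewrite -/N; have : 1 <= N * b; [rewrite -[leLHS]mulr1 ler_pM|lra].
have site_pow (K : {fset lattice d}) (xK : x \in K) :
    (lsite (scaled_op beta E K V) (fun t => p.[window_fun c e s t]) x)%:C =
    \sum_(j < size p) (p`_j)%:C * kpow K (B K) j x x.
  rewrite -[x in LHS]/(val [` xK]%fset) lsiteE site_horner.
  apply: eq_bigr => j _; congr (_ * _).
  rewrite -kernelE /= kernelX//.
  have : forall k u v, u \in K -> v \in K -> kpow K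
     (kernel (fcalc (scaled_op beta E K V) (fun t => (window_fun c e s t)%:C))) k u v =
     kpow K (B K) k u v.
    elim=> [//|k IH] u v uK vK /=.
    rewrite [LHS]big_seq [RHS]big_seq; apply: eq_bigr => w wK.
    rewrite IH//; congr (_ * _).
    rewrite /B /G -[u]/(val [` uK]%fset) -[w]/(val [` wK]%fset) !kernelE.
    by rewrite window_matrix//; exact: scaled_op_hermitian.
  by apply.
have -> : `|lsite (scaled_op beta E L V) (fun t => p.[window_fun c e s t]) x -
    lsite (scaled_op beta E L' V) (fun t => p.[window_fun c e s t]) x| =
    normc (\sum_(j < size p) (p`_j)%:C *
      (kpow L (B L) j x x - kpow L' (B L') j x x)).
  have rB (u w : R) : (u - w)%:C = u%:C - w%:C by rewrite rmorphB.
  rewrite -normc_real rB !site_pow// -sumrB; congr normc.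
  by apply: eq_bigr => j _; rewrite mulrBr.
apply: le_trans (normc_sum _ _ _) _.
rewrite /decoupling_bound -/a -/A -/N -/b -/th1 -/thB -mulrA mulr_suml.
apply: ler_sum => j _; rewrite normcM normc_real.
by apply: ler_wpM2l => //; exact: powers.
Qed.

End SiteDecoupling.

Section RealToComplex.
Variable R : realType.

Lemma realcD (x y : R) : (x + y)%:C = x%:C + y%:C.
Proof. exact: rmorphD. Qed.

Lemma realcX (x : R) k : (x ^+ k)%:C = x%:C ^+ k.
Proof. exact: rmorphXn. Qed.

Lemma realcV (x : R) : (x^-1)%:C = x%:C^-1.
Proof. exact: fmorphV. Qed.

End RealToComplex.

(** * Measurability of complex matrix functions *)

Section Measurability.
Context (R : realType) (disp : measure_display) (S : measurableType disp).
Local Notation C := R[i].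
Implicit Types (f g : S -> C).

(** Coordinatewise, so that only real-valued measurability is ever invoked. *)
Definition cmeasurable f : Prop :=
  measurable_fun [set: S] (fun s => complex.Re (f s)) /\
  measurable_fun [set: S] (fun s => complex.Im (f s)).

Lemma cmeasurable_cst c : cmeasurable (fun=> c).
Proof. by split; exact: measurable_cst. Qed.

Lemma cmeasurableD f g : cmeasurable f -> cmeasurable g ->
  cmeasurable (fun s => f s + g s).
Proof.
move=> [f1 f2] [g1 g2]; split.
  under eq_fun do rewrite ReD; exact: measurable_funD.
under eq_fun do rewrite ImD; exact: measurable_funD.
Qed.

Lemma cmeasurableM f g : cmeasurable f -> cmeasurable g ->
  cmeasurable (fun s => f s * g s).
Proof.
move=> [f1 f2] [g1 g2]; split.
  rewrite (_ : (fun s => _) = (fun s => complex.Re (f s) * complex.Re (g s) -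
     complex.Im (f s) * complex.Im (g s))).
    by apply: measurable_funB; exact: measurable_funM.
  by apply/funext => s; case: (f s) (g s) => ? ? [].
rewrite (_ : (fun s => _) = (fun s => complex.Re (f s) * complex.Im (g s) +
   complex.Im (f s) * complex.Re (g s))).
  by apply: measurable_funD; exact: measurable_funM.
by apply/funext => s; case: (f s) (g s) => ? ? [].
Qed.

Lemma cmeasurable_real (h : S -> R) : measurable_fun [set: S] h ->
  cmeasurable (fun s => (h s)%:C).
Proof. by move=> mh; split => //; exact: measurable_cst. Qed.

Lemma measurable_inv_ge0 (h : S -> R) : (forall s, 0 <= h s) ->
  measurable_fun [set: S] h -> measurable_fun [set: S] (fun s => (h s)^-1).
Proof.
move=> h0 mh; rewrite (_ : (fun s => _) = (@powR R ^~ (-1)) \o h).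
  by apply: measurableT_comp => //; exact: measurable_powR.
by apply/funext => s /=; rewrite powR_inv1.
Qed.

Lemma measurable_normc f : cmeasurable f ->
  measurable_fun [set: S] (fun s => normc (f s)).
Proof.
move=> [f1 f2].
rewrite (_ : (fun s => _) = (@powR R ^~ (2^-1)) \o
    (fun s => complex.Re (f s) ^+ 2 + complex.Im (f s) ^+ 2)).
  apply: measurableT_comp; first exact: measurable_powR.
  by apply: measurable_funD; exact: measurable_funX.
apply/funext => s /=; rewrite powR12_sqrt ?addr_ge0 ?sqr_ge0//.
by case: (f s).
Qed.

Lemma cmeasurableV f : cmeasurable f -> cmeasurable (fun s => (f s)^-1).
Proof.
move=> [f1 f2].
have mn : measurable_fun [set: S]
    (fun s => (complex.Re (f s) ^+ 2 + complex.Im (f s) ^+ 2)^-1).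
  apply: measurable_inv_ge0; first by move=> s; rewrite addr_ge0 ?sqr_ge0.
  by apply: measurable_funD; exact: measurable_funX.
split.
  rewrite (_ : (fun s => _) = (fun s => complex.Re (f s) *
     (complex.Re (f s) ^+ 2 + complex.Im (f s) ^+ 2)^-1)).
    exact: measurable_funM.
  by apply/funext => s; case: (f s).
rewrite (_ : (fun s => _) = (fun s => - (complex.Im (f s) *
   (complex.Re (f s) ^+ 2 + complex.Im (f s) ^+ 2)^-1))).
  by apply: measurable_funN; exact: measurable_funM.
by apply/funext => s; case: (f s).
Qed.

Lemma cmeasurable_sum (I : Type) (r : seq I) (Q : pred I) (F : I -> S -> C) :
  (forall i, cmeasurable (F i)) -> cmeasurable (fun s => \sum_(i <- r | Q i) F i s).
Proof.
move=> mF; elim: r => [|i r IH].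
  by under eq_fun do rewrite big_nil; exact: cmeasurable_cst.
under eq_fun do rewrite big_cons; case: (Q i) => //.
exact: cmeasurableD.
Qed.

Lemma cmeasurable_prod (I : Type) (r : seq I) (Q : pred I) (F : I -> S -> C) :
  (forall i, cmeasurable (F i)) -> cmeasurable (fun s => \prod_(i <- r | Q i) F i s).
Proof.
move=> mF; elim: r => [|i r IH].
  by under eq_fun do rewrite big_nil; exact: cmeasurable_cst.
under eq_fun do rewrite big_cons; case: (Q i) => //.
exact: cmeasurableM.
Qed.

Definition mxmeasurable m n (M : S -> 'M[C]_(m, n)) : Prop :=
  forall i j, cmeasurable (fun s => M s i j).

Lemma cmeasurable_det n (M : S -> 'M[C]_n) : mxmeasurable M ->
  cmeasurable (fun s => \det (M s)).
Proof.
move=> mM; apply: cmeasurable_sum => sg; apply: cmeasurableM.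
  exact: cmeasurable_cst.
by apply: cmeasurable_prod => i; exact: mM.
Qed.

Lemma cmeasurable_invmx n (M : S -> 'M[C]_n) i j :
  (forall s, M s \in unitmx) -> mxmeasurable M ->
  cmeasurable (fun s => invmx (M s) i j).
Proof.
move=> uM mM.
rewrite (_ : (fun s => _) = (fun s => (\det (M s))^-1 *
   ((-1) ^+ (j + i) * \det (row' j (col' i (M s)))))).
  apply: cmeasurableM; first by apply/cmeasurableV/cmeasurable_det.
  apply: cmeasurableM; first exact: cmeasurable_cst.
  apply: cmeasurable_det => k l.
  by under eq_fun do rewrite !mxE; exact: mM.
by apply/funext => s; rewrite /invmx uM !mxE.
Qed.

Lemma mxmeasurableM m n p (M : S -> 'M[C]_(m, n)) (N : S -> 'M[C]_(n, p)) :
  mxmeasurable M -> mxmeasurable N -> mxmeasurable (fun s => M s *m N s).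
Proof.
move=> mM mN i j; under eq_fun do rewrite mxE.
by apply: cmeasurable_sum => k; exact: cmeasurableM.
Qed.

Lemma mxmeasurableD m n (M N : S -> 'M[C]_(m, n)) :
  mxmeasurable M -> mxmeasurable N -> mxmeasurable (fun s => M s + N s).
Proof.
by move=> mM mN i j; under eq_fun do rewrite mxE; exact: cmeasurableD.
Qed.

Lemma mxmeasurableZ m n (c : C) (M : S -> 'M[C]_(m, n)) :
  mxmeasurable M -> mxmeasurable (fun s => c *: M s).
Proof.
move=> mM i j; under eq_fun do rewrite mxE.
by apply: cmeasurableM => //; exact: cmeasurable_cst.
Qed.

Lemma mxmeasurable_cst m n (M : 'M[C]_(m, n)) : mxmeasurable (fun=> M).
Proof. by move=> i j; exact: cmeasurable_cst. Qed.

Lemma mxmeasurableX n (M : S -> 'M[C]_n) k :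
  mxmeasurable M -> mxmeasurable (fun s => M s ^+ k).
Proof.
move=> mM; elim: k => [|k IH].
  by under eq_fun do rewrite expr0; exact: mxmeasurable_cst.
by under eq_fun do rewrite exprS; exact: mxmeasurableM.
Qed.

Lemma measurable_rsum (I : Type) (r : seq I) (F : I -> S -> R) :
  (forall i, measurable_fun [set: S] (F i)) ->
  measurable_fun [set: S] (fun s => \sum_(i <- r) F i s).
Proof.
move=> mF; elim: r => [|i r IH].
  by under eq_fun do rewrite big_nil; exact: measurable_cst.
by under eq_fun do rewrite big_cons; exact: measurable_funD.
Qed.

End Measurability.

(** * Measurability of eigenvalue counts *)

Section CountMeasurable.
Variable R : realType.
Local Notation C := R[i].

(** With w the affine map taking ]c, e[ to ]-1, 1[, this is 1/(1 + (m+1) w^(2(m+1)^2)), a rational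
    function without real poles. The factor m+1 sends the values at the endpoints, where w^2 = 1, to
    0; the exponent makes (m+1) w^(2(m+1)^2) vanish in the limit inside. *)
Definition sharp_window (c e : R) (m : nat) (x : R) : R :=
  (1 + m.+1%:R * ((2 * x - (c + e)) / (e - c)) ^+ (2 * (m.+1 * m.+1)))^-1.

Lemma cvg_sharp_window (c e x : R) : c < e ->
  sharp_window c e m x @[m --> \oo] --> (\1_(`]c, e[%classic) x : R).
Proof.
move=> ce; have ce0 : 0 < e - c by rewrite subr_gt0.
set w := (2 * x - (c + e)) / (e - c).
pose u := w ^+ 2; have u0 : 0 <= u by exact: sqr_ge0.
have hE m : sharp_window c e m x = (1 + m.+1%:R * u ^+ (m.+1 * m.+1))^-1.
  by rewrite /sharp_window -/w (exprM w 2).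
have E : 1 - u = 4 * ((x - c) * (e - x)) / (e - c) ^+ 2.
  by rewrite /u /w; field; rewrite gt_eqF.
clearbody u; clear w.
have harm : @harmonic R m @[m --> \oo] --> 0 by exact: cvg_harmonic.
have [cxe|cxe] := boolP (c < x < e).
  have -> : \1_(`]c, e[%classic) x = 1 :> R by rewrite indicE mem_set//= in_itv.
  have k0 : 0 < 1 - u.
    move: cxe => /andP[cx xe].
    by rewrite E divr_gt0 ?exprn_gt0// !mulr_gt0 ?subr_gt0.
  have [k kE] : exists k : R, k = 1 - u by eexists.
  rewrite -kE in k0.
  have lim : (1 - harmonic m * k^-1) @[m --> \oo] --> (1 : R).
    rewrite -[X in _ --> X]subr0; apply: cvgB; first exact: cvg_cst.
    by rewrite -[X in _ --> X](mul0r k^-1); apply: cvgMl.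
  apply: (squeeze_cvgr _ lim (cvg_cst (1 : R))).
  near=> m; rewrite hE.
  have t0 : 0 <= m.+1%:R * u ^+ (m.+1 * m.+1) by rewrite mulr_ge0 ?exprn_ge0.
  apply/andP; split; last by rewrite invf_le1 ?ltr_wpDr// lerDl.
  have k1 : 0 <= k <= 1 by rewrite ltW//= kE lerBlDr lerDl.
  have B := bernoulli_upper (m.+1 * m.+1) k1.
  have uk : u = 1 - k by rewrite kE subKr.
  have tb : m.+1%:R * u ^+ (m.+1 * m.+1) <= harmonic m * k^-1.
    rewrite uk; apply: (@le_trans _ _ (m.+1%:R * (1 + (m.+1 * m.+1)%:R * k)^-1)).
      by rewrite ler_wpM2l.
    rewrite natrM /harmonic; set M : R := m.+1%:R.
    have M0 : 0 < M by rewrite ltr0n.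
    have q0 : 0 < 1 + M * M * k by rewrite ltr_wpDr ?mulr_ge0 ?ltW ?mulr_gt0.
    rewrite ler_pdivrMr// -invfM mulrC ler_pdivlMr ?mulr_gt0//.
    by rewrite mulrA lerDr.
  set t := m.+1%:R * _ in t0 tb *.
  apply: (@le_trans _ _ (1 - t)); first by rewrite lerB.
  rewrite -[leRHS]mul1r ler_pdivlMr ?ltr_wpDr//.
  by rewrite mulrDr mulr1 mulrBl mul1r; nra.
have -> : \1_(`]c, e[%classic) x = 0 :> R.
  by rewrite indicE memNset//= in_itv /=; apply/negP.
have u1 : 1 <= u.
  rewrite -subr_le0 E mulr_le0_ge0 ?invr_ge0 ?sqr_ge0//.
  rewrite mulr_ge0_le0//; move: cxe; rewrite negb_and -!leNgt => /orP[] h.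
    by apply: mulr_le0_ge0; lra.
  by apply: mulr_ge0_le0; lra.
apply: (squeeze_cvgr _ (cvg_cst (0 : R)) harm).
near=> m; rewrite hE.
have t0 : m.+1%:R <= m.+1%:R * u ^+ (m.+1 * m.+1) :> R.
  by rewrite ler_peMr// exprn_ege1.
have M0 : 0 < m.+1%:R :> R by rewrite ltr0n.
rewrite invr_ge0 addr_ge0 ?(le_trans (ltW M0) t0)//=.
rewrite /harmonic lef_pV2 ?posrE//; first by apply: le_trans t0 _; rewrite lerDr.
by rewrite ltr_wpDr// (le_trans (ltW M0) t0).
Unshelve. all: by end_near.
Qed.

Context (disp : measure_display) (S : measurableType disp).

(** No measurable choice of eigenvalues or eigenvectors is made: the trace of a rational function of
    A is a rational function of the entries of A. *)
Lemma measurable_strace_window n (A : S -> 'M[C]_n) c e m :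
  (forall s, hermitian (A s)) -> mxmeasurable A ->
  measurable_fun [set: S] (fun s => strace (A s) (sharp_window c e m)).
Proof.
move=> hA mA.
pose W s := (2 / (e - c))%:C *: A s + (- ((c + e) / (e - c)))%:C%:M.
pose M s := 1%:M + (m.+1%:R)%:C *: (W s) ^+ (2 * (m.+1 * m.+1)).
pose w (x : R) : R := (2 * x - (c + e)) / (e - c).
pose q (x : R) : C := (1 + m.+1%:R * w x ^+ (2 * (m.+1 * m.+1)))%:C.
have ME s : M s = fcalc (A s) q.
  rewrite /M; have -> : W s = fcalc (A s) (fun x => (w x)%:C).
    rewrite /W -[in LHS](fcalc_id (hA s)) fcalcZ -(fcalc_cst (A s)) fcalcD.
    by apply: eq_fcalc => i; rewrite -realcM -rmorphD /=; congr (_%:C);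
      rewrite /w; ring.
  rewrite fcalcX fcalcZ -(fcalc_cst (A s)) fcalcD; apply: eq_fcalc => i.
  by rewrite /q realcD realcM realcX.
have q0 x : q x != 0.
  rewrite eq_complex /= negb_and gt_eqF// ltr_wpDr// mulr_ge0//.
  by rewrite exprM exprn_ge0// sqr_ge0.
have mM : mxmeasurable M.
  apply: mxmeasurableD; first exact: mxmeasurable_cst.
  apply/mxmeasurableZ/mxmeasurableX/mxmeasurableD.
    exact: mxmeasurableZ.
  exact: mxmeasurable_cst.
rewrite (_ : (fun s => _) = (fun s => complex.Re (\sum_i invmx (M s) i i))).
  suff [] : cmeasurable (fun s => \sum_i invmx (M s) i i) by [].
  apply: cmeasurable_sum => i; apply: cmeasurable_invmx => // s.
  by rewrite ME; have [] := fcalc_inv (A := A s) (f := q) (fun i => q0 _).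
apply/funext => s; rewrite ME.
have [_ ->] := fcalc_inv (A := A s) (f := q) (fun i => q0 _).
rewrite -/(\tr _) fcalc_tr Re_sum; apply: eq_bigr => i _.
by rewrite /q -realcV.
Qed.

Lemma measurable_count n (A : S -> 'M[C]_n) c e : c < e ->
  (forall s, hermitian (A s)) -> mxmeasurable A ->
  measurable_fun [set: S] (fun s => strace (A s) \1_(`]c, e[%classic)).
Proof.
move=> ce hA mA.
apply: (measurable_fun_cvg
  (h := fun m s => strace (A s) (sharp_window c e m))) => [m|s _].
  exact: measurable_strace_window.
rewrite /strace; elim: (index_enum _) => [|i r IH].
  by rewrite big_nil; under eq_cvg do rewrite big_nil; exact: cvg_cst.
rewrite big_cons; under eq_cvg do rewrite big_cons.
by apply: cvgD => //; exact: cvg_sharp_window.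
Qed.

Lemma measurable_site_pk n (A : S -> 'M[C]_n) (r u : R) k : 0 < r ->
  (forall s, hermitian (A s)) -> mxmeasurable A ->
  measurable_fun [set: S] (fun s => site (A s) (pk r u) k).
Proof.
move=> r0 hA mA; under eq_fun do rewrite site_pk//.
apply: measurable_funM; first exact: measurable_cst.
have uM s : A s - (u +i* r)%:M \in unitmx.
  by have [] := @resolventE _ _ (A s) (u +i* r) (hA s); rewrite ?gt_eqF.
suff [] : cmeasurable (fun s => invmx (A s - (u +i* r)%:M) k k) by [].
by apply: cmeasurable_invmx => //; apply: mxmeasurableD => //; exact: mxmeasurable_cst.
Qed.

Lemma measurable_site_horner n (A : S -> 'M[C]_n) (c e r : R) (p : {poly R}) k :
  0 < r -> (forall s, hermitian (A s)) -> mxmeasurable A ->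
  measurable_fun [set: S] (fun s => site (A s) (fun t => p.[window_fun c e r t]) k).
Proof.
move=> r0 hA mA.
pose B s := fcalc (A s) (fun t => (window_fun c e r t)%:C).
have mB : mxmeasurable B.
  move=> i j; rewrite /B; under eq_fun do rewrite window_matrix//.
  have uM s : A s - (0 +i* r)%:M \in unitmx.
    by have [] := @resolventE _ _ (A s) (0 +i* r) (hA s); rewrite ?gt_eqF.
  have m0 k' l' : cmeasurable (fun s => window_coef c e r *
      invmx (A s - (0 +i* r)%:M) k' l').
    apply: cmeasurableM; first exact: cmeasurable_cst.
    by apply: cmeasurable_invmx => //; apply: mxmeasurableD => //; exact: mxmeasurable_cst.
  apply: cmeasurableD => //; have [m1 m2] := m0 j i; split.
    rewrite (_ : (fun s => _) = (fun s => complex.Re (window_coef c e r *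
      invmx (A s - (0 +i* r)%:M) j i)))//.
    by apply/funext => s; case: (_ * _).
  rewrite (_ : (fun s => _) = (fun s => - complex.Im (window_coef c e r *
    invmx (A s - (0 +i* r)%:M) j i))); first exact: measurable_funN.
  by apply/funext => s; case: (_ * _).
rewrite (_ : (fun s => _) = (fun s => complex.Re
   (\sum_(j < size p) (p`_j)%:C * (B s ^+ j) k k))).
  suff [] : cmeasurable (fun s =>
    \sum_(j < size p) (p`_j)%:C * (B s ^+ j) k k) by [].
  apply: cmeasurable_sum => j; apply: cmeasurableM; first exact: cmeasurable_cst.
  exact: mxmeasurableX.
by apply/funext => s; rewrite -site_horner.
Qed.

End CountMeasurable.

(** * Independence of sigma-algebras and resampling of one coordinate *)

Section Independence.
Context (R : realType) (disp : measure_display) (T : measurableType disp)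
  (P : probability T R) (I : choiceType) (X : I -> {RV P >-> R}).
Local Open Scope ereal_scope.

Definition cylinders (J : set I) : set (set T) :=
  [set B | exists (K : {fset I}) (A : I -> set R),
    [/\ [set` K] `<=` J, forall j, measurable (A j) &
        B = \bigcap_(j in [set` K]) (X j @^-1` A j)]].

(** The same sample space with the smaller sigma-algebra generated by the X_j with j in J.
    Measurability on it expresses dependence on these coordinates only. *)
Definition sigma_of (J : set I) := g_sigma_algebraType (cylinders J).

Lemma cylinder_measurable J B : cylinders J B -> measurable B.
Proof.
move=> [K [A [_ mA ->]]]; apply: fin_bigcap_measurable => // j _.
by rewrite -[_ @^-1` _]setTI; exact: measurable_funPT.
Qed.

Lemma cylinderI J : setI_closed (cylinders J).
Proof.
move=> _ _ [K1 [A1 [KJ1 mA1 ->]]] [K2 [A2 [KJ2 mA2 ->]]].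
exists (K1 `|` K2)%fset, (fun j => (if j \in K1 then A1 j else setT) `&`
  (if j \in K2 then A2 j else setT)); split.
- by move=> j /=; rewrite in_fsetU => /orP[/KJ1|/KJ2].
- by move=> j; apply: measurableI; case: ifP.
- apply/seteqP; split=> [w [w1 w2] j _|w w12].
    by split; [case: ifP => jK; [exact: w1|] | case: ifP => jK; [exact: w2|]].
  split=> j /= jK; have := w12 j; rewrite /= in_fsetU jK ?orbT => /(_ isT) [].
    by [].
  by [].
Qed.

Lemma cylinderT J : cylinders J setT.
Proof.
exists fset0, (fun=> setT); split=> //.
by rewrite set_fset0 bigcap_set0.
Qed.

Lemma sigma_of_sub J (B : set T) : <<s cylinders J >> B -> measurable B.
Proof.
by apply: smallest_sub; [exact: sigma_algebra_measurable|exact: cylinder_measurable].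
Qed.

Lemma measurable_sigma_of J j : J j ->
  measurable_fun [set: sigma_of J] (X j : sigma_of J -> R).
Proof.
move=> Jj _ B mB; rewrite setTI; apply: sub_sigma_algebra.
exists [fset j]%fset, (fun=> B); split=> //.
- by move=> i /=; rewrite in_fset1 => /eqP ->.
- by rewrite set_fset1 bigcap_set1.
Qed.

Hypothesis Xindep : mutually_independent X.

Lemma cylinder_indep J1 J2 B1 B2 : [disjoint J1 & J2] ->
  cylinders J1 B1 -> cylinders J2 B2 -> P (B1 `&` B2) = P B1 * P B2.
Proof.
move=> /disj_setPS J12 [K1 [A1 [KJ1 mA1 ->]]] [K2 [A2 [KJ2 mA2 ->]]].
have K12 j : j \in K2 -> (j \in K1) = false.
  by move=> jK2; apply/negP => jK1; have [] := J12 j; split; [exact: KJ1|exact: KJ2].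
pose A j := if j \in K1 then A1 j else A2 j.
have mA j : measurable (A j) by rewrite /A; case: ifP.
have -> : \bigcap_(j in [set` K1]) (X j @^-1` A1 j) =
    \bigcap_(j in [set` K1]) (X j @^-1` A j).
  by apply: eq_bigcapr => j /= jK; rewrite /A jK.
have -> : \bigcap_(j in [set` K2]) (X j @^-1` A2 j) =
    \bigcap_(j in [set` K2]) (X j @^-1` A j).
  by apply: eq_bigcapr => j /= jK; rewrite /A K12.
rewrite -bigcap_setU -set_fsetU !Xindep//.
rewrite (big_fsetID _ (mem K1))/=; congr (_ * _); apply: eq_fbigl => j.
  by rewrite !inE /=; case: (j \in K1); rewrite ?andbF.
rewrite !inE /=; case: (boolP (j \in K2)) => [/K12 -> //|_].
by rewrite orbF; case: (j \in K1).
Qed.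

Let Pfin (B : set T) : measurable B -> P B \is a fin_num.
Proof. by move=> mB; exact: fin_num_measure. Qed.

Lemma sigma_of_indep J1 J2 (B1 B2 : set T) : [disjoint J1 & J2] ->
  <<s cylinders J1 >> B1 -> <<s cylinders J2 >> B2 ->
  P (B1 `&` B2) = P B1 * P B2.
Proof.
move=> J12.
have ext J (D : set T) (mD : measurable D) :
    (forall B, cylinders J B -> P (B `&` D) = P B * P D) ->
    forall B, <<s cylinders J >> B -> P (B `&` D) = P B * P D.
  move=> h B sB.
  have p0 : (0 <= fine (P D))%R by rewrite fine_ge0.
  pose m1 : {measure set T -> \bar R} := mrestr P mD.
  pose m2 : {measure set T -> \bar R} := mscale (NngNum p0) P.
  have E A : m2 A = P A * P D.
    by rewrite /m2 /= /mscale/= fineK ?Pfin//; exact: muleC.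
  rewrite -E -[LHS]/(m1 B).
  apply: (g_sigma_algebra_measure_unique (cylinders J) _ (fun=> setT)) => //.
  - exact: cylinder_measurable.
  - by move=> _; exact: cylinderT.
  - by rewrite bigcup_const.
  - exact: cylinderI.
  - by move=> A cA; rewrite E -h.
  - by move=> _; rewrite /m1 /= /mrestr setTI ltey_eq Pfin.
move=> s1 s2; apply: (ext J1) => //; first exact: sigma_of_sub s2.
move=> {s1 B1} B1 c1; rewrite setIC [RHS]muleC; move: B2 s2.
apply: (ext J2); first exact: cylinder_measurable c1.
by move=> B2 c2; rewrite setIC [RHS]muleC; exact: (cylinder_indep J12 c1 c2).
Qed.

Variable mu : probability R R.
Hypothesis Xdistr : identically_distributed X mu.

(* The law of w |-> (w, X_n w), when the first factor only remembers the other
   coordinates, is a product measure. *)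
Lemma integral_resample (n : I) (J := [set~ n] : set I)
    (phi : sigma_of J * R -> \bar R) :
  measurable_fun [set: sigma_of J * R] phi -> (forall z, 0 <= phi z) ->
  [/\ \int[P]_w phi ((w : sigma_of J), X n w) = \int[P]_w \int[mu]_t phi ((w : sigma_of J), t),
   measurable_fun [set: sigma_of J] (fun w => \int[mu]_t phi (w, t)) &
   measurable_fun [set: T] (fun w => \int[mu]_t phi ((w : sigma_of J), t))].
Proof.
move=> mphi phi0.
have mid : @measurable_fun _ _ T (sigma_of J) [set: T] idfun.
  by move=> _ B sB; rewrite setTI; exact: (@sigma_of_sub J).
have mpair : measurable_fun [set: T] (fun w => ((w : sigma_of J), X n w)).
  by apply/measurable_fun_pairP; split.
pose idJ : {mfun T >-> sigma_of J} := mfun_Sub (mem_set mid).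
pose pJ : {mfun T >-> (sigma_of J * R)%type} := mfun_Sub (mem_set mpair).
have mF : measurable_fun [set: sigma_of J] (fun w => \int[mu]_t phi (w, t)).
  exact: (measurable_fun_fubini_tonelli_F phi).
split=> //; last exact: (measurableT_comp mF mid).
transitivity (\int[distribution P pJ]_z phi z).
  by rewrite ge0_integral_distribution.
transitivity (\int[distribution P idJ \x mu]_z phi z).
  apply: eq_measure_integral => A mA _; apply/esym.
  apply: product_measure_unique => // B1 B2 mB1 mB2.
  transitivity (P B1 * P (X n @^-1` B2)); last by congr (_ * _); exact: Xdistr.
  apply: (@sigma_of_indep J [set n]) => //.
  - by apply/disj_setPS => j [].
  - by rewrite -[X in <<s _ >> X]setTI; apply: (@measurable_sigma_of [set n] n).
rewrite fubini_tonelli1//.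
rewrite ge0_integral_distribution//.
by move=> w; apply: integral_ge0 => t _.
Qed.

End Independence.

(** * Wegner and Minami estimates *)

Section HolderKernel.
Context (R : realType) (mu : probability R R) (alpha : R).
Hypotheses (alpha_gt0 : 0 < alpha) (alpha_le1 : alpha <= 1).
Hypothesis mu_holder : uniformly_holder alpha mu.

(** For s >= s0 the trivial bound mu <= 1 is absorbed by the additional constant 1/s0^alpha. *)
Lemma holder_all_scales : exists2 U : R, 0 <= U &
  forall s x, 0 < s -> (mu `[x, (x + s)%R]%classic <= (U * s `^ alpha)%:E)%E.
Proof.
have [U [e /= e0 Ue]] := mu_holder.
pose s0 := e / 2; have s00 : 0 < s0 by rewrite divr_gt0.
exists (`|U| + (s0 `^ alpha)^-1) => [|s x s_gt0].
  by rewrite addr_ge0// invr_ge0 powR_ge0.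
have ps : 0 < s0 `^ alpha by exact: powR_gt0.
have [se|es] := ltP s s0.
  apply: (@le_trans _ _ ((U * s `^ alpha)%:E)).
    apply: Ue => //=; rewrite sub0r normrN gtr0_norm//.
    by rewrite (lt_trans se)// /s0; lra.
  rewrite lee_fin ler_wpM2r ?powR_ge0//.
  by rewrite (le_trans (ler_norm _))// lerDl invr_ge0 ltW.
apply: (@le_trans _ _ 1%E); first exact: probability_le1.
rewrite lee_fin mulrDl; apply: ler_wpDl; first by rewrite mulr_ge0// powR_ge0.
rewrite mulrC ler_pdivlMr// mul1r; apply: ge0_ler_powR => //.
- exact: ltW.
- by rewrite nnegrE ltW.
- by rewrite nnegrE ltW.
Qed.

(** Dyadic majorant: outside the ball of radius 2^j r the kernel is at most 4^-j. Truncation at n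
    keeps the sum finite, at the price of the constant 4/4^n. *)
Let layer (r u : R) (n : nat) (t : R) : R :=
  \sum_(j < n) 4 / 4 ^+ j * \1_(`[u - 2 ^+ j * r, u + 2 ^+ j * r]%classic) t +
  4 / 4 ^+ n.

Let layer_bound r u n t : 0 < r -> pk r u t <= layer r u n t.
Proof.
move=> r0; elim: n => [|n IH].
  rewrite /layer big_ord0 expr0 divr1 add0r.
  by apply: le_trans (pk_le1 _ _ r0) _; rewrite ler1n.
have p4 : 0 < 4 ^+ n :> R by rewrite exprn_gt0.
have e4 : 4 / 4 ^+ n.+1 = (4 ^+ n)^-1 :> R.
  by rewrite exprS invfM mulVKf.
rewrite /layer big_ord_recr /= e4.
set S := \sum_(j < n) _.
have S0 : 0 <= S.
  by apply: sumr_ge0 => j _; rewrite mulr_ge0 ?divr_ge0 ?exprn_ge0.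
have i0 : 0 <= (4 ^+ n)^-1 :> R by rewrite invr_ge0 ltW.
have [tn|tn] := boolP (u - 2 ^+ n * r <= t <= u + 2 ^+ n * r).
  rewrite indicE mem_set ?mulr1; last by rewrite /= in_itv.
  by apply: le_trans IH _; rewrite /layer -/S lerDl.
rewrite indicE memNset ?mulr0 ?addr0; last by rewrite /= in_itv /=; apply/negP.
apply: (@le_trans _ _ ((4 ^+ n)^-1)); last by rewrite lerDr.
have q : (2 ^+ n * r) ^+ 2 <= (t - u) ^+ 2.
  rewrite -[leRHS]real_normK ?num_real//; apply: lerXn2r; rewrite ?nnegrE//.
    by rewrite mulr_ge0 ?exprn_ge0// ltW.
  rewrite ler_normr; move: tn; rewrite negb_and -!ltNge => /orP[] h.
    by apply/orP; right; lra.
  by apply/orP; left; lra.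
rewrite /pk ler_pdivrMr; last by rewrite ltr_wpDl ?sqr_ge0 ?exprn_gt0.
rewrite mulrC ler_pdivlMr// mulrC.
have e : 4 ^+ n * r ^+ 2 = (2 ^+ n * r) ^+ 2 :> R.
  by rewrite exprMn -exprM mulnC exprM; congr (_ ^+ _ * _); ring.
rewrite e; apply: le_trans q _; rewrite lerDl; exact: sqr_ge0.
Qed.

Lemma measurable_pk r u : 0 < r -> measurable_fun [set: R] (pk r u).
Proof.
move=> r0; apply: measurable_funM; first exact: measurable_cst.
apply: measurable_inv_ge0.
  by move=> s; rewrite addr_ge0 ?sqr_ge0.
apply: measurable_funD; last exact: measurable_cst.
by apply: measurable_funX; apply: measurable_funB.
Qed.

(** The ball of index j has mass at most U (2 * 2^j r)^alpha <= 2 * 2^j U r^alpha since alpha <= 1;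
    against the weights 4/4^j this sums to 16 U r^alpha. The final 1 in the constant pays for the
    truncation, with n such that 4/4^n <= r^alpha. *)
Lemma integral_pk : exists2 C : R, 0 <= C &
  forall r u : R, 0 < r -> (\int[mu]_t (pk r u t)%:E <= (C * r `^ alpha)%:E)%E.
Proof.
have [U U0 hU] := holder_all_scales; exists (16 * U + 1) => [|r u r0].
  by rewrite addr_ge0// mulr_ge0.
have ra0 : 0 < r `^ alpha by exact: powR_gt0.
have [n hn] : exists n : nat, 4 / 4 ^+ n <= r `^ alpha.
  exists (Num.truncn (4 / r `^ alpha)).+1.
  set k := (Num.truncn _).+1.
  have kb : 4 / r `^ alpha <= k%:R by rewrite ltW// truncnS_gt.
  rewrite ler_pdivrMr ?exprn_gt0// mulrC -ler_pdivrMr//.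
  apply: le_trans kb _; rewrite -natrX ler_nat ltnW//.
  exact: ltn_expl.
have ind_itv j : (\int[mu]_t (\1_(`[u - 2 ^+ j * r, u + 2 ^+ j * r]%classic) t)%:E <=
    (2 * 2 ^+ j * U * r `^ alpha)%:E)%E.
  rewrite integral_indic// setIT.
  have -> : u + 2 ^+ j * r = (u - 2 ^+ j * r) + 2 * 2 ^+ j * r by ring.
  have p2 : 0 < 2 * 2 ^+ j :> R by rewrite mulr_gt0 ?exprn_gt0.
  apply: le_trans (hU _ _ _) _; first exact: mulr_gt0.
  have qa : (2 * 2 ^+ j) `^ alpha <= 2 * 2 ^+ j :> R.
    rewrite -[leRHS](powRr1 (ltW p2)) ler_powR//.
    by rewrite -exprS exprn_ege1// ler1n.
  rewrite lee_fin (powRM _ (ltW p2) (ltW r0)) [leRHS](_ : _ = U * (2 * 2 ^+ j * r `^ alpha)).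
    by apply: ler_wpM2l => //; apply: ler_wpM2r => //; exact: ltW.
  by ring.
pose S m t : R :=
  \sum_(j < m) 4 / 4 ^+ j * \1_(`[u - 2 ^+ j * r, u + 2 ^+ j * r]%classic) t.
have S0 m t : 0 <= S m t.
  by apply: sumr_ge0 => j _; rewrite mulr_ge0 ?divr_ge0 ?exprn_ge0.
have mS m : measurable_fun [set: R] (S m).
  apply: measurable_rsum => j; apply: measurable_funM; first exact: measurable_cst.
  exact: measurable_indic.
have iS m : (\int[mu]_t (S m t)%:E <=
    (16 * U * r `^ alpha * (1 - (2 ^+ m)^-1))%:E)%E.
  elim: m => [|m IH].
    rewrite expr0 invr1 subrr mulr0 /S; under eq_integral do rewrite big_ord0.
    by rewrite integral0.
  under eq_integral do rewrite /S big_ord_recr /= EFinD EFinM.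
  rewrite ge0_integralD//; last 3 first.
  - by move=> t _; rewrite lee_fin; exact: S0.
  - by apply/measurable_EFinP; exact: mS.
  - apply/measurable_EFinP; apply: measurable_funM; first exact: measurable_cst.
    exact: measurable_indic.
  rewrite ge0_integralZl_EFin//; last first.
  - by apply/measurable_EFinP; exact: measurable_indic.
  apply: le_trans (leeD IH (lee_wpmul2l _ (ind_itv m))) _.
    by rewrite lee_fin divr_ge0 ?exprn_ge0.
  rewrite -EFinM -EFinD lee_fin le_eqVlt; apply/orP; left; apply/eqP.
  have -> : 4 ^+ m = 2 ^+ m * 2 ^+ m :> R.
    by rewrite -exprMn; congr (_ ^+ _); ring.
  by rewrite exprS; field; rewrite expf_neq0.
apply: (@le_trans _ _ (\int[mu]_t (layer r u n t)%:E)%E).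
  apply: ge0_le_integral => //.
  - by move=> t _; rewrite lee_fin pk_ge0.
  - by apply/measurable_EFinP; exact: measurable_pk.
  - apply/measurable_EFinP; apply: measurable_funD; last exact: measurable_cst.
    exact: mS.
  - by move=> t _; rewrite lee_fin layer_bound.
under eq_integral do rewrite /layer EFinD.
rewrite ge0_integralD//; last 2 first.
- by move=> t _; rewrite lee_fin; exact: S0.
- by apply/measurable_EFinP; exact: mS.
rewrite integral_cst// [X in (_ + _ * X)%E]probability_setT mule1.
apply: le_trans (leeD (iS n) (lexx _)) _; rewrite -EFinD lee_fin.
rewrite (_ : (16 * U + 1) * _ = 16 * U * r `^ alpha + r `^ alpha); last by ring.
apply: lerD => //; rewrite ler_piMr ?mulr_ge0//; exact: ltW.
Qed.

End HolderKernel.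

Lemma integral_cst_probability (R : realType) (disp : measure_display)
    (T : measurableType disp) (P : probability T R) (r : R) : (\int[P]_w r%:E = r%:E)%E.
Proof. by rewrite integral_cst// [X in (_ * X)%E]probability_setT mule1. Qed.

Section WegnerMinami.
Context (R : realType) (d : nat) (disp : measure_display)
  (T : measurableType disp) (P : probability T R)
  (H0 : {linear ell2 R d -> ell2 R d}).
Hypothesis H0_selfadjoint : selfadjoint_op H0.
Variables (mu : probability R R) (omega : lattice d -> {RV P >-> R}).
Hypotheses (omega_indep : mutually_independent omega)
  (omega_distr : identically_distributed omega mu).
Variables (alpha : R).
Hypotheses (alpha_gt0 : 0 < alpha) (alpha_le1 : alpha <= 1).
Hypothesis mu_holder : uniformly_holder alpha mu.
Local Notation C := R[i].
Implicit Types (L : {fset lattice d}) (V : lattice d -> R) (n x : lattice d).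

Lemma scaled_op_measurable (disp' : measure_display) (S : measurableType disp')
    (beta E : R) L (V : S -> lattice d -> R) :
  (forall x, x \in L -> measurable_fun [set: S] (fun s => V s x)) ->
  mxmeasurable (fun s => scaled_op H0 beta E L (V s)).
Proof.
move=> mV; apply: mxmeasurableZ; apply: mxmeasurableD; last exact: mxmeasurable_cst.
move=> i j; under eq_fun do rewrite mxE anderson_delta.
apply: cmeasurableD; first exact: cmeasurable_cst.
apply: cmeasurable_real; apply: measurable_funM; last exact: measurable_cst.
by apply: mV; exact: valP.
Qed.

Definition resample V n (t : R) : lattice d -> R := fun x => if x == n then t else V x.

Lemma resample_id V n : resample V n (V n) = V.
Proof. by apply/funext => x; rewrite /resample; case: eqP => [->|]. Qed.

Lemma scaled_op_resample (beta E : R) L V n (nL : n \in L) (t : R) :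
  scaled_op H0 beta E L (resample V n t) =
  scaled_op H0 beta E L (resample V n 0) +
  (beta * t)%:C *: delta_mx (enum_rank [` nL]%fset) (enum_rank [` nL]%fset).
Proof.
apply/matrixP => i j; rewrite !mxE !anderson_delta /resample.
have e k : (k == enum_rank [` nL]%fset) = (val (enum_val k) == n) :> bool.
  by rewrite -(inj_eq enum_val_inj) enum_rankK -val_eqE.
rewrite !e.
have -> : (fsval (enum_val i) == fsval (enum_val j)) = (i == j).
  by rewrite (inj_eq val_inj) (inj_eq enum_val_inj).
have [ij|ij] := eqVneq i j; last first.
  have -> : (fsval (enum_val i) == n) && (fsval (enum_val j) == n) = false.
    apply/negP => /andP[/eqP h1 /eqP h2]; move/negP: ij; apply; apply/eqP.
    by apply: enum_val_inj; apply: val_inj; rewrite /= h1 h2.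
  have zR : false%:R = 0 :> R by [].
  have zC : false%:R = 0 :> C by [].
  by rewrite zR zC !mulr0 [RHS]addr0.
rewrite ij andbb; case: ifP => _; last by rewrite mulr0 [RHS]addr0.
have z : (0 : R)%:C = 0 by [].
by rewrite mulr1n !mulr1 realcM z; ring.
Qed.

(** Given the other potentials, [rank1_site] turns the site density into (r/s) times a Poisson
    kernel in t of width s/beta with s >= r. Its integral is at most (r/s) K (s/beta)^alpha, and
    (r/s)(s/r)^alpha <= 1 because alpha <= 1, so the unknown width s disappears. *)
Lemma wegner_cond : exists2 K : R, 0 <= K &
  forall (beta E : R) L V n (r u : R), 0 < beta -> n \in L -> 0 < r ->
  (\int[mu]_t (lsite (scaled_op H0 beta E L (resample V n t)) (pk r u) n)%:E <=
  (K * (r / beta) `^ alpha)%:E)%E.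
Proof.
have [K K0 hK] := integral_pk alpha_gt0 alpha_le1 mu_holder.
exists K => // beta E L V n r u b0 nL r0.
pose A := scaled_op H0 beta E L (resample V n 0).
pose k := enum_rank [` nL]%fset.
have hA : hermitian A by exact: scaled_op_hermitian.
have [v [s [rs hs]]] := rank1_site k u hA r0.
have s0 : 0 < s by exact: lt_le_trans rs.
have -> : (fun t => (lsite (scaled_op H0 beta E L (resample V n t)) (pk r u) n)%:E) =
    (fun t => (r / s)%:E * (pk (s / beta) (v / beta) t)%:E)%E.
  apply/funext => t; rewrite scaled_op_resample -/A -/k.
  rewrite -[n]/(val [` nL]%fset) lsiteE -/k (hs _).2 -EFinM; congr (_ * _)%:E.
  rewrite /pk; have q : (beta * t - v) ^+ 2 + s ^+ 2 != 0.
    by rewrite gt_eqF// ltr_wpDl ?sqr_ge0 ?exprn_gt0.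
  have q' : (t * beta - v) ^+ 2 + s ^+ 2 != 0 by rewrite mulrC.
  by field; rewrite gt_eqF//= q.
rewrite ge0_integralZl_EFin//; last 3 first.
- by move=> t _; rewrite lee_fin pk_ge0.
- by apply/measurable_EFinP; apply: measurable_pk; rewrite divr_gt0.
- by rewrite divr_ge0// ltW.
have sb : 0 < s / beta by rewrite divr_gt0.
apply: le_trans (lee_wpmul2l _ (hK _ _ sb)) _.
  by rewrite lee_fin divr_ge0// ltW.
rewrite -EFinM lee_fin mulrCA; apply: ler_wpM2l => //.
have -> : s / beta = (s / r) * (r / beta) by field; rewrite !gt_eqF.
have sr1 : 1 <= s / r by rewrite ler_pdivlMr// mul1r.
have sr0 : 0 <= s / r by exact: le_trans sr1.
have rb0 : 0 <= r / beta by rewrite divr_ge0 ?ltW.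
rewrite (powRM _ sr0 rb0) mulrA -[leRHS]mul1r.
apply: ler_wpM2r; first exact: powR_ge0.
have e : (s / r) `^ alpha <= s / r by rewrite -[leRHS](powRr1 sr0) ler_powR.
apply: le_trans (ler_wpM2l _ e) _; first by rewrite divr_ge0// ltW.
by rewrite mulrA mulfVK ?divff ?gt_eqF.
Qed.

Let mresample n (J := [set~ n] : set (lattice d)) x :
  measurable_fun [set: sigma_of omega J * R]
    (fun z => resample (omega ^~ (z.1 : T)) n z.2 x).
Proof.
rewrite /resample; case: eqVneq => [_|xn]; first exact: measurable_snd.
have h := @measurable_sigma_of R _ T P _ omega J x.
apply: (@measurableT_comp _ _ _ _ _ _ (omega x : sigma_of omega J -> R)) => //.
by apply: h; exact/eqP.
Qed.

Lemma lsite_measurable (disp' : measure_display) (S : measurableType disp')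
    (beta E : R) L (V : S -> lattice d -> R) n (r u : R) : 0 < r ->
  (forall x, x \in L -> measurable_fun [set: S] (fun s => V s x)) ->
  measurable_fun [set: S] (fun s => lsite (scaled_op H0 beta E L (V s)) (pk r u) n).
Proof.
move=> r0 mV; rewrite /lsite; case: insub => [i|]; last exact: measurable_cst.
apply: measurable_site_pk => // [s|]; first exact: scaled_op_hermitian.
exact: scaled_op_measurable.
Qed.

Lemma count_measurable (disp' : measure_display) (S : measurableType disp')
    (beta E : R) L (V : S -> lattice d -> R) (c e : R) : c < e ->
  (forall x, x \in L -> measurable_fun [set: S] (fun s => V s x)) ->
  measurable_fun [set: S]
    (fun s => strace (scaled_op H0 beta E L (V s)) \1_(`]c, e[%classic)).
Proof.
move=> ce mV; apply: measurable_count => // [s|]; first exact: scaled_op_hermitian.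
exact: scaled_op_measurable.
Qed.

Lemma lsite_ge0 L (A : 'M[C]_#|{: L}|) (g : R -> R) n : (forall t, 0 <= g t) ->
  0 <= lsite A g n.
Proof.
by move=> g0; rewrite /lsite; case: insub => // i; exact: site_ge0.
Qed.

Lemma wegner : exists2 K : R, 0 <= K &
  forall (beta E : R) L n (r u : R), 0 < beta -> n \in L -> 0 < r ->
  (\int[P]_w (lsite (scaled_op H0 beta E L (omega ^~ w)) (pk r u) n)%:E <=
  (K * (r / beta) `^ alpha)%:E)%E.
Proof.
have [K K0 hK] := wegner_cond; exists K => // beta E L n r u b0 nL r0.
pose J : set (lattice d) := [set~ n].
pose phi (z : sigma_of omega J * R) : \bar R :=
  (lsite (scaled_op H0 beta E L (resample (omega ^~ (z.1 : T)) n z.2)) (pk r u) n)%:E.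
have mphi : measurable_fun [set: sigma_of omega J * R] phi.
  apply/measurable_EFinP; apply: lsite_measurable => // x _; exact: mresample.
have phi0 z : (0 <= phi z)%E.
  by rewrite lee_fin; apply: lsite_ge0 => ?; exact: pk_ge0.
have [e _ mI] := integral_resample omega_indep omega_distr mphi phi0.
rewrite (_ : (fun w => _) = (fun w => phi ((w : sigma_of omega J), omega n w))); last first.
  by apply/funext => w; rewrite /phi /= resample_id.
rewrite e; apply: (@le_trans _ _ (\int[P]_w (K * (r / beta) `^ alpha)%:E)%E).
  apply: ge0_le_integral => //.
  - by move=> w _; apply: integral_ge0 => t _.
  - by move=> w _; exact: (hK beta E L (omega ^~ w) n r u b0 nL r0).
by rewrite integral_cst_probability.
Qed.

Lemma sum_ereal_le_card L (F : lattice d -> \bar R) (K : R) :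
  (forall n, n \in L -> (F n <= K%:E)%E) ->
  (\sum_(n <- L) F n <= (#|` L|%:R * K)%:E)%E.
Proof.
move=> FK; apply: (@le_trans _ _ (\sum_(n <- L) K%:E)%E).
  by rewrite [leLHS]big_seq [leRHS]big_seq; apply: lee_sum => n nL; exact: FK.
by rewrite sumEFin big_const_seq count_predT iter_addr_0 mulr_natl.
Qed.

Definition count (beta E c e : R) L V : R :=
  strace (scaled_op H0 beta E L V) \1_(`]c, e[%classic).

Lemma count_ge0 beta E c e L V : 0 <= count beta E c e L V.
Proof. by rewrite /count strace_indic. Qed.

(** The kernel whose width is half the length of the interval equals 1/2 at the endpoints, whence
    the factor 2. *)
Lemma indic_le_pk (c e t : R) : c < e ->
  \1_(`]c, e[%classic) t <= 2 * pk ((e - c) / 2) ((c + e) / 2) t.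
Proof.
move=> ce; rewrite indicE; case: (boolP (_ \in _)) => [|_]; last first.
  by rewrite mulr_ge0// pk_ge0.
rewrite inE /= in_itv /= => /andP[ct te]; rewrite /pk mulrA.
have r0 : 0 < (e - c) / 2 by rewrite divr_gt0 ?subr_gt0.
rewrite ler_pdivlMr ?ltr_wpDl ?sqr_ge0 ?exprn_gt0// mul1r.
rewrite -subr_ge0 (_ : _ - _ = (t - c) * (e - t)); last by field.
by rewrite mulr_ge0// subr_ge0 ltW.
Qed.

Lemma le_lsite L (A : 'M[C]_#|{: L}|) (f g : R -> R) n :
  (forall t, f t <= g t) -> lsite A f n <= lsite A g n.
Proof. by move=> fg; rewrite /lsite; case: insub => // i; exact: le_site. Qed.

Lemma lsiteZ L (A : 'M[C]_#|{: L}|) k (g : R -> R) n :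
  lsite A (fun t => k * g t) n = k * lsite A g n.
Proof. by rewrite /lsite; case: insub => [i|]; rewrite ?siteZ// mulr0. Qed.

Lemma count_le_sum (beta E c e : R) L V : c < e ->
  count beta E c e L V <= \sum_(n <- L)
    2 * lsite (scaled_op H0 beta E L V) (pk ((e - c) / 2) ((c + e) / 2)) n.
Proof.
move=> ce; rewrite /count -sum_lsite; apply: ler_sum => n _.
by rewrite -lsiteZ; apply: le_lsite => t; exact: indic_le_pk.
Qed.

Lemma count_resample (beta E c e : R) L V n (t : R) : c < e -> n \in L ->
  count beta E c e L V <= count beta E c e L (resample V n t) + 1.
Proof.
move=> ce nL; pose k := enum_rank [` nL]%fset.
apply: (@rank1_interlacing _ _ _ _ k) => //; try exact: scaled_op_hermitian.
move=> i j ik; rewrite [LHS]mxE [RHS]mxE; congr (_ * _).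
rewrite [LHS]mxE [RHS]mxE; congr (_ + _).
rewrite [LHS]mxE [RHS]mxE [LHS]anderson_delta [RHS]anderson_delta /resample.
suff -> : (fsval (enum_val i) == n) = false by [].
by rewrite -[n]/(val [` nL]%fset) (inj_eq val_inj) -(inj_eq enum_rank_inj)
  enum_valK (negPf ik).
Qed.

Lemma expected_count_le (beta E c e K : R) L :
  c < e -> 0 < beta ->
  (forall n, n \in L -> (\int[P]_w (lsite (scaled_op H0 beta E L (omega ^~ w))
     (pk ((e - c) / 2) ((c + e) / 2)) n)%:E <= K%:E)%E) ->
  (\int[P]_w (count beta E c e L (omega ^~ w))%:E <= (#|` L|%:R * (2 * K))%:E)%E.
Proof.
move=> ce b0 hK; have r0 : 0 < (e - c) / 2 by rewrite divr_gt0 ?subr_gt0.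
set q := fun n w => lsite (scaled_op H0 beta E L (omega ^~ w))
   (pk ((e - c) / 2) ((c + e) / 2)) n.
have q0 n w : 0 <= q n w by apply: lsite_ge0 => x; exact: pk_ge0.
have mq n : measurable_fun [set: T] (q n) by exact: lsite_measurable.
have mq2 n : measurable_fun [set: T] (fun w => 2 * q n w).
  by apply: measurable_funM; [exact: measurable_cst|exact: mq].
apply: (@le_trans _ _ (\int[P]_w \sum_(n <- L) (2 * q n w)%:E)%E).
  apply: ge0_le_integral => //.
  - by move=> w _; rewrite lee_fin count_ge0.
  - by apply/measurable_EFinP; exact: count_measurable.
  - under eq_fun do rewrite sumEFin; apply/measurable_EFinP.
    exact: (@measurable_rsum _ _ _ _ _ (fun n w => 2 * q n w)).
  - by move=> w _; rewrite sumEFin lee_fin; exact: count_le_sum.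
rewrite ge0_integral_sum//; last 2 first.
- by move=> n; apply/measurable_EFinP.
- by move=> n w _; rewrite lee_fin mulr_ge0.
apply: sum_ereal_le_card => n nL.
under eq_integral do rewrite EFinM.
rewrite ge0_integralZl_EFin//; last 2 first.
- by move=> w _; rewrite lee_fin.
- by apply/measurable_EFinP; exact: mq.
by rewrite EFinM; apply: lee_wpmul2l; [rewrite lee_fin|exact: hK].
Qed.

(* For every t, count - 1 is at most the count after resampling the potential
   at n to t; averaging over an independent copy t of the potential at n makes
   this bound independent of the potential at n. *)
Lemma minami : exists2 K : R, 0 <= K &
  forall (beta E c e : R) L, 0 < beta -> c < e ->
  (\int[P]_w (count beta E c e L (omega ^~ w) *
     (count beta E c e L (omega ^~ w) - 1))%:E <=
   ((K * #|` L|%:R * ((e - c) / 2 / beta) `^ alpha) ^+ 2)%:E)%E.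
Proof.
have [K K0 hK] := wegner; have [K' K'0 hK'] := wegner_cond.
pose K2 := 2 * Num.max K K'.
exists K2 => [|beta E c e L b0 ce].
  by rewrite mulr_ge0// le_max K0.
set r := (e - c) / 2; set u := (c + e) / 2.
have r0 : 0 < r by rewrite divr_gt0 ?subr_gt0.
pose q V n := lsite (scaled_op H0 beta E L V) (pk r u) n.
have q0 V n : 0 <= q V n by apply: lsite_ge0 => x; exact: pk_ge0.
pose N V := count beta E c e L V.
have N0 V : 0 <= N V by exact: count_ge0.
pose M n (w : T) : \bar R := (\int[mu]_t (N (resample (omega ^~ w) n t))%:E)%E.
have M0 n w : (0 <= M n w)%E by apply: integral_ge0 => t _; rewrite lee_fin.
pose kap : R := Num.max K K' * (r / beta) `^ alpha.
have kap0 : 0 <= kap by rewrite mulr_ge0 ?powR_ge0// le_max K0.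
have mN n : measurable_fun [set: sigma_of omega [set~ n] * R]
    (fun z => (N (resample (omega ^~ (z.1 : T)) n z.2))%:E).
  apply/measurable_EFinP; apply: count_measurable => // x _; exact: mresample.
have N0E n (z : sigma_of omega [set~ n] * R) :
  (0 <= (N (resample (omega ^~ (z.1 : T)) n z.2))%:E)%E by rewrite lee_fin.
have EN : (\int[P]_w (N (omega ^~ w))%:E <= (#|` L|%:R * (2 * kap))%:E)%E.
  apply: expected_count_le => // n nL; apply: le_trans (hK beta E L n r u b0 nL r0) _ => //.
  by rewrite lee_fin ler_wpM2r ?powR_ge0// le_max lexx.
have EM n : (\int[P]_w M n w)%E = (\int[P]_w (N (omega ^~ w))%:E)%E.
  have [e1 _ _] := integral_resample omega_indep omega_distr (mN n) (N0E n).
  by rewrite /M -e1; apply: eq_integral => w _; rewrite /= resample_id.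
have mMs n : measurable_fun [set: sigma_of omega [set~ n]] (M n : sigma_of omega [set~ n] -> \bar R).
  by have [_ h _] := integral_resample omega_indep omega_distr (mN n) (N0E n).
have mM n : measurable_fun [set: T] (M n).
  by have [_ _ h] := integral_resample omega_indep omega_distr (mN n) (N0E n).
have mq n : measurable_fun [set: T] (fun w => q (omega ^~ w) n).
  exact: lsite_measurable.
(* [M n] is a function of the potentials off n, so resampling at n averages q alone, and
   [wegner_cond] bounds that average. *)
have site_bound n : n \in L ->
    (\int[P]_w ((q (omega ^~ w) n)%:E * M n w) <= kap%:E * (\int[P]_w M n w))%E.
  move=> nL.
  pose phi (z : sigma_of omega [set~ n] * R) : \bar R :=
    ((q (resample (omega ^~ (z.1 : T)) n z.2) n)%:E * M n z.1)%E.
  have mq1 : measurable_fun [set: sigma_of omega [set~ n] * R]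
      (fun z => (q (resample (omega ^~ (z.1 : T)) n z.2) n)%:E).
    apply/measurable_EFinP; apply: lsite_measurable => // x _; exact: mresample.
  have mphi : measurable_fun [set: sigma_of omega [set~ n] * R] phi.
    apply: emeasurable_funM => //.
    by apply: (measurableT_comp (mMs n)); exact: measurable_fst.
  have phi0 z : (0 <= phi z)%E by rewrite mule_ge0// lee_fin.
  have [e1 _ mI] := integral_resample omega_indep omega_distr mphi phi0.
  rewrite (_ : (fun w => _) = (fun w => phi ((w : sigma_of omega [set~ n]), omega n w))); last first.
    by apply/funext => w; rewrite /phi /= resample_id.
  rewrite e1 -ge0_integralZl//.
  apply: ge0_le_integral; [exact: measurableT|
    by move=> w _; apply: integral_ge0 => t _; exact: phi0|
    exact: mI|by apply: measurable_funeM|].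
  move=> w _; rewrite /phi /= ge0_integralZr//; last 2 first.
  - apply/measurable_EFinP; apply: lsite_measurable => // x _.
    rewrite /resample; case: (x == n); first exact: measurable_id.
    exact: measurable_cst.
  - by move=> t _; rewrite lee_fin.
  apply: lee_wpmul2r => //; apply: le_trans (hK' beta E L (omega ^~ w) n r u b0 nL r0) _ => //.
  by rewrite lee_fin ler_wpM2r ?powR_ge0// le_max lexx orbT.
have NM n w : n \in L -> ((N (omega ^~ w) - 1)%:E <= M n w)%E.
  move=> nL; have [N1|N1] := leP 0 (N (omega ^~ w) - 1); last first.
    by apply: le_trans (M0 n w); rewrite lee_fin ltW.
  rewrite -[leLHS](integral_cst_probability mu); apply: ge0_le_integral => //.
    apply/measurable_EFinP; apply: count_measurable => // x _.
    rewrite /resample; case: (x == n); first exact: measurable_id.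
    exact: measurable_cst.
  by move=> t _; rewrite lee_fin lerBlDr; exact: count_resample.
have NN0 V : 0 <= N V * (N V - 1).
  rewrite /N /count strace_indic; case: #|_| => [|m]; first by rewrite mul0r.
  by rewrite mulr_ge0// subr_ge0 ler1n.
have mQM n : measurable_fun [set: T] (fun w => 2%:E * ((q (omega ^~ w) n)%:E * M n w))%E.
  apply: measurable_funeM; apply: emeasurable_funM => //.
  by apply/measurable_EFinP; exact: mq.
have QM0 n w : (0 <= 2%:E * ((q (omega ^~ w) n)%:E * M n w))%E.
  by rewrite !mule_ge0// lee_fin.
apply: (@le_trans _ _
   (\int[P]_w \sum_(n <- L) (2%:E * ((q (omega ^~ w) n)%:E * M n w)))%E).
  apply: ge0_le_integral => //.
  - by move=> w _; rewrite lee_fin.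
  - apply/measurable_EFinP; apply: measurable_funM.
      exact: count_measurable.
    apply: measurable_funB; last exact: measurable_cst.
    exact: count_measurable.
  - exact: emeasurable_sum.
  (* One factor of the product is expanded into sites, so that for each n the other factor can be
     replaced by [M n]. Where count - 1 is negative, the left side is nonpositive. *)
  move=> w _; rewrite {1}/count -sum_lsite mulr_suml -sumEFin.
  rewrite [leLHS]big_seq [leRHS]big_seq; apply: lee_sum => n nL.
  have [N1|N1] := leP 0 (N (omega ^~ w) - 1); last first.
    apply: le_trans (QM0 n w); rewrite lee_fin mulr_ge0_le0 ?(ltW N1)//.
    by apply: lsite_ge0 => t.
  rewrite muleA -EFinM [leLHS]EFinM; apply: lee_pmul; rewrite ?lee_fin//.
  - by apply: lsite_ge0 => t.
  - by rewrite /q -lsiteZ; apply: le_lsite => t; exact: indic_le_pk.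
  - exact: NM.
rewrite ge0_integral_sum//.
apply: (@le_trans _ _ (#|` L|%:R * (2 * (kap * (#|` L|%:R * (2 * kap)))))%:E).
  apply: sum_ereal_le_card => n nL.
  rewrite ge0_integralZl//; last 2 first.
  - apply: emeasurable_funM => //; apply/measurable_EFinP; exact: mq.
  - by move=> w _; rewrite mule_ge0// lee_fin.
  rewrite EFinM; apply: lee_wpmul2l; first by rewrite lee_fin.
  apply: le_trans (site_bound n nL) _; rewrite [leRHS]EFinM EM.
  by apply: lee_wpmul2l; [rewrite lee_fin|exact: EN].
rewrite lee_fin le_eqVlt; apply/orP; left; apply/eqP.
by rewrite /kap /K2 -/r; ring.
Qed.

End WegnerMinami.

(** * Poisson limit of sums of independent indicators *)

Section BernoulliSum.
Context (R : realType) (disp : measure_display) (T : measurableType disp)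
  (P : probability T R) (J : eqType) (A : J -> set T).
Hypothesis mA : forall i, measurable (A i).

Definition hits (r : seq J) (w : T) : nat := seq.count (fun i => `[< A i w >]) r.

Definition hits_eq (r : seq J) (k : nat) : set T := [set w | hits r w = k].

Lemma hits_indic (r : seq J) w : (hits r w)%:R = \sum_(i <- r) \1_(A i) w :> R.
Proof.
rewrite /hits -sum1_count natr_sum big_mkcond /=; apply: eq_bigr => k _.
by rewrite indicE /in_mem /= /in_set; case: asboolP.
Qed.

(** The form in which independence is used: one event against the number of hits among others. *)
Hypothesis hits_indep : forall i r k, i \notin r ->
  P (A i `&` hits_eq r k) = (P (A i) * P (hits_eq r k))%E.

Definition pr (B : set T) : R := fine (P B).

Lemma prE B : measurable B -> P B = (pr B)%:E.
Proof. by move=> mB; rewrite fineK// fin_num_measure. Qed.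

Lemma pr_ge0 B : 0 <= pr B.
Proof. by rewrite fine_ge0. Qed.

Lemma le_pr B D : measurable B -> measurable D -> B `<=` D -> pr B <= pr D.
Proof. by move=> mB mD BD; rewrite -lee_fin -!prE// le_measure ?inE. Qed.

Lemma measurable_hits_eq r k : measurable (hits_eq r k).
Proof.
elim: r k => [|i r IH] k.
  rewrite /hits_eq /hits /=; case: k => [|k].
    rewrite (_ : [set _ | _] = setT)//; first by apply/seteqP; split.
  by rewrite (_ : [set _ | _] = set0)//; apply/seteqP; split.
have -> : hits_eq (i :: r) k = (A i `&` (if k is k'.+1 then hits_eq r k' else set0))
    `|` (~` A i `&` hits_eq r k).
  apply/seteqP; split=> w; rewrite /hits_eq /hits /=.
    case: asboolP => iw; last by rewrite add0n => ?; right.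
    by rewrite add1n => <-; left.
  case: asboolP => iw; rewrite ?add0n ?add1n => -[[]|[]] //.
  by case: k => // k _ /= ->.
apply: measurableU; last by apply: measurableI => //; exact: measurableC.
by apply: measurableI => //; case: k.
Qed.

Lemma hits_eq0_pr r : uniq r -> pr (hits_eq r 0) = \prod_(i <- r) (1 - pr (A i)).
Proof.
elim: r => [_|i r IH /= /andP[ir ur]].
  rewrite big_nil /pr (_ : hits_eq _ _ = setT) ?probability_setT//.
  by apply/seteqP; split.
rewrite big_cons -IH//.
have -> : hits_eq (i :: r) 0 = hits_eq r 0 `\` A i.
  apply/seteqP; split=> w; rewrite /hits_eq /hits /=.
    by case: asboolP => // iw; rewrite add0n.
  by case: asboolP => iw [].
have mr := measurable_hits_eq r 0.
apply: EFin_inj; rewrite -prE; last exact: measurableD.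
transitivity (P (hits_eq r 0) - P (A i) * P (hits_eq r 0))%E.
  rewrite measureD//; last by rewrite ltey_eq fin_num_measure.
  by congr (_ - _)%E; rewrite setIC; exact: hits_indep.
by rewrite !prE// -EFinM -EFinB; congr (_%:E); ring.
Qed.

Lemma hits_rem r i w : i \in r -> hits r w = (`[< A i w >] + hits (rem i r) w)%N.
Proof. by move=> ir; rewrite /hits (seq.permP (perm_to_rem ir)). Qed.

(** Write S for the number of hits and S_i for the number without i. On S = k+1 exactly k+1 events
    occur, so (k+1) P(S=k+1) is the sum over i of P(A_i, S_i=k) = p_i P(S_i=k). Since S and S_i
    agree off A_i, P(S_i=k) differs from P(S=k) by at most p_i. *)
Lemma hits_eq_rec r k : uniq r ->
  `|k.+1%:R * pr (hits_eq r k.+1) - (\sum_(i <- r) pr (A i)) * pr (hits_eq r k)| <=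
  \sum_(i <- r) pr (A i) ^+ 2.
Proof.
move=> ur; have mr := measurable_hits_eq r.
have e1 : k.+1%:R * pr (hits_eq r k.+1) =
    \sum_(i <- r) pr (A i) * pr (hits_eq (rem i r) k).
  have mI i : measurable (A i `&` hits_eq r k.+1) by exact: measurableI.
  transitivity (\sum_(i <- r) pr (A i `&` hits_eq r k.+1)).
    apply: EFin_inj; rewrite EFinM -prE// -sumEFin.
    transitivity (\int[P]_w (k.+1%:R * \1_(hits_eq r k.+1) w)%:E)%E.
      under eq_integral do rewrite EFinM.
      rewrite ge0_integralZl_EFin//; last first.
        by apply/measurable_EFinP; exact: measurable_indic.
      by congr (_ * _)%E; rewrite [RHS]integral_indic// setIT.
    transitivity (\int[P]_w \sum_(i <- r) (\1_(A i `&` hits_eq r k.+1) w)%:E)%E.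
      apply: eq_integral => w _; rewrite sumEFin; congr (_%:E).
      have [wk|wk] := pselect (hits r w = k.+1); last first.
        rewrite indicE memNset// mulr0 big1// => i _.
        by rewrite indicE memNset// => -[].
      have wS : w \in hits_eq r k.+1 by rewrite inE.
      rewrite indicE wS mulr1; transitivity ((hits r w)%:R : R); first by rewrite wk.
      rewrite /hits -sum1_count natr_sum big_mkcond /=.
      apply: eq_bigr => i _; rewrite indicE in_setI wS andbT.
      by rewrite /in_mem /= /in_set; case: asboolP.
    rewrite ge0_integral_sum//; last by move=> i; exact/measurable_EFinP/measurable_indic.
    by apply: eq_bigr => i _; rewrite integral_indic// setIT; exact: prE.
  rewrite [LHS]big_seq [RHS]big_seq; apply: eq_bigr => i ir.
  apply: EFin_inj; rewrite -prE// EFinM -!prE//; last exact: measurable_hits_eq.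
  rewrite -hits_indep ?mem_rem_uniqF//; congr (P _).
  apply/seteqP; split=> w /= [Aw]; rewrite /hits_eq /= (hits_rem w ir).
    by rewrite asboolT// add1n => -[].
  by rewrite asboolT// add1n => ->.
rewrite e1 mulr_suml -sumrB; apply: le_trans (ler_norm_sum _ _ _) _.
rewrite [leLHS]big_seq [leRHS]big_seq; apply: ler_sum => i ir.
rewrite -mulrBr normrM ger0_norm ?pr_ge0// expr2.
apply: ler_wpM2l; first exact: pr_ge0.
have mi := measurable_hits_eq (rem i r) k.
have out (B D : set T) : measurable B -> measurable D ->
    (forall w, ~ A i w -> B w -> D w) -> pr B <= pr D + pr (A i).
  move=> mB mD BD; apply: (@le_trans _ _ (pr (D `|` A i))).
    apply: le_pr => //; first exact: measurableU.
    by move=> w Bw; have [|nA] := pselect (A i w); [right|left; exact: BD].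
  rewrite -lee_fin EFinD -!prE//; last exact: measurableU.
  exact: measureU2.
have same w : ~ A i w -> hits r w = hits (rem i r) w.
  by move=> nA; rewrite (hits_rem w ir) asboolF.
rewrite ler_norml lerBlDr lerNl opprB lerBlDr [_ + pr (hits_eq _ _)]addrC.
rewrite [pr (A i) + _]addrC.
apply/andP; split; apply: out => // w nA; rewrite /hits_eq /=.
  by rewrite same.
by rewrite same.
Qed.

(** The bound 1/4 forces every p_i <= 1/2, where exp(-p - 2p^2) <= 1 - p <= exp(-p); the product
    formula [hits_eq0_pr] does the rest. *)
Lemma hits_eq0_bounds r : uniq r -> \sum_(i <- r) pr (A i) ^+ 2 <= 1 / 4 ->
  expR (- (\sum_(i <- r) pr (A i)) - 2 * \sum_(i <- r) pr (A i) ^+ 2) <=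
  pr (hits_eq r 0) <= expR (- (\sum_(i <- r) pr (A i))).
Proof.
move=> ur s4; rewrite hits_eq0_pr//.
have half i : i \in r -> pr (A i) <= 1 / 2.
  move=> ir; rewrite leNgt; apply/negP => lt.
  have : pr (A i) ^+ 2 <= 1 / 4.
    apply: le_trans s4; rewrite (big_rem i)//= lerDl.
    by apply: sumr_ge0 => j _; exact: sqr_ge0.
  by nra.
rewrite -sumrN mulr_sumr -sumrB !expR_sum; apply/andP; split.
  rewrite [leLHS]big_seq [leRHS]big_seq; apply: ler_prod => i ir.
  rewrite expR_ge0/=; have := half _ ir; have := pr_ge0 (A i).
  move: (pr (A i)) => p p0 p2.
  have q0 : 0 < 1 - p by lra.
  have -> : - p - 2 * p ^+ 2 = - (p + 2 * p ^+ 2) by ring.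
  rewrite expRN invf_ple ?posrE ?expR_gt0//.
  apply: le_trans (expR_ge1Dx _); rewrite -[leLHS]mul1r ler_pdivrMr//.
  have : 0 <= p ^+ 2 * (1 - 2 * p) by rewrite mulr_ge0 ?sqr_ge0//; lra.
  by nra.
rewrite [leLHS]big_seq [leRHS]big_seq; apply: ler_prod => i ir.
rewrite expR_ge1Dx andbT subr_ge0 (le_trans (half _ ir))//.
by lra.
Qed.

End BernoulliSum.

Section PoissonLimit.
Variable R : realType.

Lemma poisson_recursion_cvg (u : nat -> nat -> R) (lam s : nat -> R) (gamma : R) :
  lam n @[n --> \oo] --> gamma -> s n @[n --> \oo] --> (0 : R) ->
  (forall n k, `|k.+1%:R * u n k.+1 - lam n * u n k| <= s n) ->
  (forall n, s n <= 1 / 4 ->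
     expR (- lam n - 2 * s n) <= u n 0 <= expR (- lam n)) ->
  forall k, u n k @[n --> \oo] --> gamma ^+ k / k`!%:R * expR (- gamma).
Proof.
move=> lamg s0 rec base; elim=> [|k IH].
  rewrite expr0 fact0 divr1 mul1r.
  have lo : expR (- lam n - 2 * s n) @[n --> \oo] --> expR (- gamma).
    apply: (@cvg_comp _ _ _ _ expR); last exact: continuous_expR.
    rewrite -[- gamma]subr0; apply: cvgB; first exact: cvgN.
    by rewrite -[X in _ --> X](mulr0 2); apply: cvgM => //; exact: cvg_cst.
  have hi : expR (- lam n) @[n --> \oo] --> expR (- gamma).
    apply: (@cvg_comp _ _ _ _ expR); last exact: continuous_expR.
    exact: cvgN.
  apply: (squeeze_cvgr _ lo hi); near=> n; apply: base.
  by near: n; apply: (cvgr_le (0 : R)) => //; lra.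
have k1 : k.+1%:R != 0 :> R by rewrite pnatr_eq0.
have e0 : (k.+1%:R * u n k.+1 - lam n * u n k) @[n --> \oo] --> (0 : R).
  apply/norm_cvg0P.
  by apply: (squeeze_cvgr _ (cvg_cst (0 : R)) s0); near=> n; rewrite normr_ge0 rec.
have -> : (fun n => u n k.+1) = (fun n =>
    (k.+1%:R * u n k.+1 - lam n * u n k + lam n * u n k) / k.+1%:R).
  by apply/funext => n; rewrite subrK mulrAC divff// mul1r.
have -> : gamma ^+ k.+1 / k.+1`!%:R * expR (- gamma) =
    (0 + gamma * (gamma ^+ k / k`!%:R * expR (- gamma))) / k.+1%:R.
  rewrite add0r factS natrM exprS; field.
  by rewrite nat1r k1 pnatr_eq0 -lt0n fact_gt0.
by apply: cvgM; [apply: cvgD => //; exact: cvgM|exact: cvg_cst].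
Unshelve. all: by end_near. Qed.

Section NatValued.
Context (disp : measure_display) (T : measurableType disp) (P : probability T R).
Variable X : T -> R.
Hypotheses (mX : measurable_fun [set: T] X)
  (natX : forall w, exists k : nat, X w = k%:R).

Lemma measurable_level (k : nat) : measurable [set w | X w = k%:R].
Proof.
have := mX measurableT (measurable_set1 (k%:R : R)); rewrite setTI.
by congr measurable; apply/seteqP; split.
Qed.

(** The sum is the expectation of f(X) cut off to the levels below K; what is lost is at most M on
    the event X >= K, whose probability is written as 1 minus the mass of these levels. *)
Lemma nat_expectation_approx (f : R -> R) (M : R) (K : nat) :
  measurable_fun [set: R] f -> (forall x, `|f x| <= M) ->
  'E_P[f \o X]%E \is a fin_num /\
  `|fine 'E_P[f \o X]%E - \sum_(k < K) f k%:R * fine (P [set w | X w = k%:R])| <=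
  M * (1 - \sum_(k < K) fine (P [set w | X w = k%:R])).
Proof.
move=> mf fM; have M0 : 0 <= M by rewrite (le_trans _ (fM 0)).
have mfX : measurable_fun [set: T] (f \o X) by exact: measurableT_comp.
have ifX : P.-integrable [set: T] (EFin \o (f \o X)).
  apply: measurable_bounded_integrable => //.
    by rewrite ltey_eq fin_num_measure.
  exists M; split; first exact: num_real.
  by move=> t Mt w _ /=; apply: le_trans (fM _) (ltW Mt).
pose S k := [set w | X w = k%:R].
have mS k : measurable (S k) by exact: measurable_level.
pose g (a : nat -> R) w : R := \sum_(k < K) a k * \1_(S k) w.
have gE a : EFin \o g a = (fun w => \sum_(k < K) ((a k)%:E * (\1_(S k) w)%:E))%E.
  by apply/funext => w; rewrite /g /= -sumEFin; apply: eq_bigr => k _; rewrite EFinM.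
have ig a : P.-integrable [set: T] (EFin \o g a).
  rewrite gE; apply: integrable_sum => // k _.
  by apply: integrableZl => //; exact: integrable_indic.
have Ig a : (\int[P]_w (g a w)%:E = (\sum_(k < K) a k * fine (P (S k)))%:E)%E.
  transitivity (\int[P]_w (EFin \o g a) w)%E => //; rewrite gE.
  rewrite integral_sum//; last first.
    by move=> k; apply: integrableZl => //; exact: integrable_indic.
  rewrite -sumEFin; apply: eq_bigr => k _.
  rewrite integralZl//; last exact: integrable_indic.
  by rewrite integral_indic// setIT EFinM fineK// fin_num_measure.
have EE : 'E_P[f \o X]%E = (\int[P]_w (f (X w))%:E)%E by rewrite unlock.
rewrite EE.
have fn : (\int[P]_w (f (X w))%:E)%E \is a fin_num by exact: (integrable_fin_num _ ifX).
split=> //; pose fk (k : nat) := f k%:R; pose Mk (k : nat) := M.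
have iM : P.-integrable [set: T] (EFin \o cst M).
  by apply/finite_measure_integrable_cst.
have IM : (\int[P]_w (cst M w)%:E = M%:E)%E.
  exact: integral_cst_probability.
rewrite -lee_fin -abse_EFin EFinB fineK// -(Ig fk).
rewrite mulrBr mulr1 mulr_sumr EFinB -IM -(Ig Mk) -!integralB_EFin//.
apply: le_trans (le_abse_integral _ _ _) _ => //.
  under eq_fun do rewrite -EFinB.
  apply/measurable_EFinP; apply: measurable_funB => //; apply/measurable_EFinP.
  by case/integrableP: (ig fk).
apply: le_integral => //.
- exact: (integrable_abse (integrableB measurableT ifX (ig fk))).
- exact: (integrableB measurableT iM (ig Mk)).
move=> w _; rewrite -!EFinB lee_fin /g /fk /Mk /=.
have [k kX] := natX w.
have S1 j : \1_(S j) w = (j == k)%:R :> R.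
  rewrite indicE /S; congr (nat_of_bool _)%:R; apply/idP/eqP.
    by rewrite inE /= kX => /eqP; rewrite eqr_nat => /eqP ->.
  by move=> ->; rewrite inE.
have [kK|Kk] := ltnP k K.
  have red (a : nat -> R) : \sum_(j < K) a j * \1_(S j) w = a k.
    rewrite (bigD1 (Ordinal kK))//= S1 eqxx mulr1 big1 ?addr0// => j.
    by rewrite S1 -val_eqE/= => /negPf ->; rewrite mulr0.
  by rewrite (red (fun j => f j%:R)) (red (fun=> M)) kX !subrr normr0.
have red (a : nat -> R) : \sum_(j < K) a j * \1_(S j) w = 0.
  rewrite big1// => j _; rewrite S1 (_ : _ == _ = false) ?mulr0//.
  by apply/negbTE; rewrite neq_ltn (leq_trans (ltn_ord j) Kk).
by rewrite (red (fun j => f j%:R)) (red (fun=> M)) !subr0 fM.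
Qed.

End NatValued.

(** No tightness is assumed: the limiting masses sum to 1, so finitely many levels carry almost all
    of Y, and by convergence of these levels almost all of X n for large n. *)
Lemma nat_cvg_in_distribution (disp disp' : measure_display) (T : measurableType disp)
    (T' : measurableType disp') (P : probability T R) (Q : probability T' R)
    (X : nat -> T -> R) (Y : T' -> R) :
  (forall n, measurable_fun [set: T] (X n)) -> measurable_fun [set: T'] Y ->
  (forall n w, exists k : nat, X n w = k%:R) ->
  (forall w, exists k : nat, Y w = k%:R) ->
  (forall k, fine (P [set w | X n w = k%:R]) @[n --> \oo] -->
     fine (Q [set w | Y w = k%:R])) ->
  cvg_in_distribution P X Q Y.
Proof.
move=> mX mY natX natY lev; split=> // f cf [M fM].
have mf : measurable_fun [set: R] f by exact: continuous_measurable_fun.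
have finX n : 'E_P[f \o X n]%E \is a fin_num.
  by case: (nat_expectation_approx P (mX n) (natX n) 0 mf fM).
have finY : 'E_Q[f \o Y]%E \is a fin_num.
  by case: (nat_expectation_approx Q mY natY 0 mf fM).
rewrite -(fineK finY); under eq_cvg do rewrite -(fineK (finX _)).
apply/cvg_EFin; first by near=> n.
have M0 : 0 <= M by rewrite (le_trans _ (fM 0)).
apply/cvgrPdist_le => /= eps eps0.
(* Budget: the tail of Y costs M t, that of X n at most 2 M t, the finite sums t; together at most
   eps. The 1 in M + 1 covers M = 0. *)
pose t := eps / (4 * (M + 1)).
have t0 : 0 < t by rewrite /t divr_gt0// mulr_gt0// ltr_wpDl.
have Mt : M * t <= eps / 4.
  rewrite /t mulrA ler_pdivrMr; last by rewrite mulr_gt0// ltr_wpDl.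
  by nra.
pose S k := [set w | Y w = k%:R].
have sum1 : \sum_(0 <= k < K) Q (S k) @[K --> \oo] --> 1%E.
  have -> : 1%E = Q (\bigcup_k S k).
    rewrite (_ : \bigcup_k S k = setT) ?probability_setT//.
    by apply/seteqP; split=> // w _; have [k Yk] := natY w; exists k.
  apply: measure_semi_sigma_additive.
  - by move=> k; exact: measurable_level.
  - apply/trivIsetP => i j _ _ ij; apply/seteqP; split=> // w.
    rewrite /S /= => -[-> /eqP]; by rewrite eqr_nat (negPf ij).
  - by apply: bigcup_measurable => k _; exact: measurable_level.
have finS k : Q (S k) \is a fin_num by rewrite fin_num_measure//; exact: measurable_level.
have {}sum1 : \sum_(k < K) fine (Q (S k)) @[K --> \oo] --> (1 : R).
  move/fine_cvgP: sum1 => [_]; apply: cvg_trans; apply: near_eq_cvg; near=> K.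
  rewrite /= big_mkord; transitivity (fine (\sum_(k < K) (fine (Q (S k)))%:E)%E).
    by congr fine; apply: eq_bigr => k _; rewrite fineK.
  by rewrite sumEFin.
move/cvgrPdist_le: sum1 => /(_ t t0)[K _ /(_ K (leqnn _)) /= sK].
have cs (a : nat -> R) :
    \forall n \near \oo, `|\sum_(k < K) a k * fine (Q (S k)) -
      \sum_(k < K) a k * fine (P [set w | X n w = k%:R])| <= t.
  suff /cvgrPdist_le : \sum_(k < K) a k * fine (P [set w | X n w = k%:R])
      @[n --> \oo] --> \sum_(k < K) a k * fine (Q (S k)) by exact.
  apply: cvg_big => //; first exact: add_continuous.
  by move=> k _; apply: cvgM; [exact: cvg_cst|exact: lev].
have [_ hY] := nat_expectation_approx Q mY natY K mf fM.
near=> n; have [_ hX] := nat_expectation_approx P (mX n) (natX n) K mf fM.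
have h1 : `|\sum_(k < K) fine (Q (S k)) -
    \sum_(k < K) fine (P [set w | X n w = k%:R])| <= t.
  have : `|\sum_(k < K) 1 * fine (Q (S k)) -
      \sum_(k < K) 1 * fine (P [set w | X n w = k%:R])| <= t.
    by near: n; exact: (cs (fun=> 1)).
  by under eq_bigr do rewrite mul1r; under [X in _ - X]eq_bigr do rewrite mul1r.
have h2 : `|\sum_(k < K) f k%:R * fine (Q (S k)) -
    \sum_(k < K) f k%:R * fine (P [set w | X n w = k%:R])| <= t.
  by near: n; exact: (cs (fun k => f k%:R)).
move: hX hY h1 h2; set ex := fine _; set ey := fine _.
move: (\sum_(k < K) f k%:R * fine (P _)) (\sum_(k < K) fine (P _)) => A p.
move: sK; rewrite -/S; move: (\sum_(k < K) f k%:R * fine (Q _)) (\sum_(k < K) fine (Q _)) => B q.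
have te : t <= eps / 4 by rewrite /t invfM mulrA ler_piMr ?divr_ge0 ?invf_le1 ?lerDr ?ltr_wpDl// ltW.
rewrite !ler_norml => /andP[_ q1] /andP[a1 a2] /andP[b1 b2] /andP[c1 c2] /andP[d1 d2].
have m1 : M * (1 - q) <= M * t by apply: ler_wpM2l.
have m2 : M * (q - p) <= M * t by apply: ler_wpM2l.
by apply/andP; split; lra.
Unshelve. all: by end_near. Qed.

Lemma poisson_level (gamma : R) (j : nat) : 0 < gamma ->
  fine (poisson_prob gamma 0%N [set k : nat | (k%:R : R) = j%:R]) =
  gamma ^+ j / j`!%:R * expR (- gamma).
Proof.
move=> g0; rewrite (_ : [set _ | _] = [set j]); last first.
  by apply/seteqP; split=> k /= => [/eqP|->//]; rewrite eqr_nat => /eqP.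
rewrite /poisson_prob g0 esum_set1 ?lee_fin ?poisson_pmf_ge0//=.
by rewrite /poisson_pmf g0.
Qed.

End PoissonLimit.

(** * Comparison of the box with its cells *)

Section MeanBound.
Context (R : realType) (disp : measure_display) (T : measurableType disp)
  (P : probability T R).
Implicit Types (f g : T -> R).

(** Carries the side conditions of integration along, so that L^1 bounds can be added, scaled and
    compared pointwise. *)
Definition mean_le f (r : R) : Prop :=
  [/\ measurable_fun [set: T] f, forall w, 0 <= f w &
      (\int[P]_w (f w)%:E <= r%:E)%E].

Lemma mean_le_cst (r : R) : 0 <= r -> mean_le (fun=> r) r.
Proof. by move=> r0; split=> //; rewrite integral_cst_probability. Qed.

Lemma mean_leD f g (r s : R) : mean_le f r -> mean_le g s ->
  mean_le (fun w => f w + g w) (r + s).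
Proof.
move=> [mf f0 fr] [mg g0 gs]; split.
- exact: measurable_funD.
- by move=> w; rewrite addr_ge0.
under eq_integral do rewrite EFinD.
rewrite ge0_integralD//; try (by move=> w _; rewrite lee_fin); try exact/measurable_EFinP.
by rewrite EFinD; exact: leeD.
Qed.

Lemma mean_leZ (k : R) f r : 0 <= k -> mean_le f r -> mean_le (fun w => k * f w) (k * r).
Proof.
move=> k0 [mf f0 fr]; split.
- exact: measurable_funM.
- by move=> w; rewrite mulr_ge0.
under eq_integral do rewrite EFinM.
rewrite ge0_integralZl_EFin//; last exact/measurable_EFinP; last first.
  by move=> w _; rewrite lee_fin.
by rewrite EFinM; exact: lee_wpmul2l.
Qed.

Lemma mean_le_sum (I : eqType) (r : seq I) (F : I -> T -> R) (b : I -> R) :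
  (forall i, i \in r -> mean_le (F i) (b i)) ->
  mean_le (fun w => \sum_(i <- r) F i w) (\sum_(i <- r) b i).
Proof.
elim: r => [|i r IH] h.
  rewrite (_ : (fun w => _) = fun=> 0); last by apply/funext => w; rewrite big_nil.
  by rewrite big_nil; exact: mean_le_cst.
rewrite (_ : (fun w => _) = fun w => F i w + \sum_(j <- r) F j w); last first.
  by apply/funext => w; rewrite big_cons.
rewrite big_cons; apply: mean_leD; first by apply: h; rewrite mem_head.
by apply: IH => j jr; apply: h; rewrite inE jr orbT.
Qed.

Lemma mean_le_mono f g (r s : R) : measurable_fun [set: T] f ->
  (forall w, 0 <= f w <= g w) -> mean_le g r -> r <= s -> mean_le f s.
Proof.
move=> mf fg [mg g0 gr] rs; split=> // [w|].
  by case/andP: (fg w).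
apply: le_trans (le_trans gr _) => //; apply: ge0_le_integral => //.
- by move=> w _; rewrite lee_fin; case/andP: (fg w).
- exact/measurable_EFinP.
- exact/measurable_EFinP.
by move=> w _; rewrite lee_fin; case/andP: (fg w).
Qed.

Lemma mean_le_weaken f (r s : R) : mean_le f r -> r <= s -> mean_le f s.
Proof. by move=> [mf f0 fr] rs; split=> //; rewrite (le_trans fr)// lee_fin. Qed.

End MeanBound.

(** * Mean comparison at one site, from fractional moments *)

Section SiteBounds.
Context (R : realType) (d : nat) (disp : measure_display)
  (T : measurableType disp) (P : probability T R)
  (H0 : {linear ell2 R d -> ell2 R d}).
Hypothesis H0_selfadjoint : selfadjoint_op H0.
Variables (omega : lattice d -> {RV P >-> R}).
Variables (E : R).
Local Notation C := R[i].
Implicit Types (L : {fset lattice d}) (x u v : lattice d).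

Lemma green_measurable L (z : C) u v (sg : R) : 0 < complex.Im z ->
  measurable_fun [set: T] (fun w => normc (kernel
    (invmx (compression H0 (omega ^~ w) L - z%:M)) u v) `^ sg).
Proof.
move=> z0; apply: (@measurableT_comp _ _ _ _ _ _ (fun t : R => t `^ sg)).
  exact: measurable_powR.
rewrite /kernel; case: (insub u) => [i|]; last exact: measurable_cst.
case: (insub v) => [j|]; last exact: measurable_cst.
have e w : compression H0 (omega ^~ w) L = scaled_op H0 1 0 L (omega ^~ w).
  by rewrite /scaled_op scale1r -[LHS]subr0; congr (_ - _); rewrite raddf0.
apply/measurable_normc/cmeasurable_invmx => [w|].
  rewrite e; have [] // := @resolventE _ _ (scaled_op H0 1 0 L (omega ^~ w)) z.
    exact: scaled_op_hermitian.
  by rewrite gt_eqF.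
apply: mxmeasurableD; last exact: mxmeasurable_cst.
under eq_fun do rewrite e.
exact: scaled_op_measurable.
Qed.

Definition green_decay L (r : nat) (sg s bet B : R) : Prop := forall u v,
  u \in L -> v \in L -> far r u v ->
  mean_le P (fun w => normc (kernel
    (invmx (compression H0 (omega ^~ w) L - (E +i* (s / bet))%:M)) u v) `^ sg) B.

Lemma lsite_horner_measurable (bet c e s : R) (p : {poly R}) L x : 0 < s ->
  measurable_fun [set: T] (fun w =>
    lsite (scaled_op H0 bet E L (omega ^~ w)) (fun t => p.[window_fun c e s t]) x).
Proof.
move=> s0; rewrite /lsite; case: insub => [i|]; last exact: measurable_cst.
apply: measurable_site_horner => // [w|]; first exact: scaled_op_hermitian.
exact: scaled_op_measurable.
Qed.

Lemma lsite_norm_diff_le1 L L' (A : 'M[C]_#|{: L}|) (A' : 'M[C]_#|{: L'}|) (g : R -> R) x :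
  (forall t, 0 <= g t <= 1) -> `|lsite A g x - lsite A' g x| <= 1.
Proof.
move=> g01; have h (M : {fset lattice d}) (D : 'M[C]_#|{: M}|) : 0 <= lsite D g x <= 1.
  rewrite /lsite; case: insub => [i|]; last by rewrite lexx ler01.
  apply/andP; split; first by apply: site_ge0 => t; case/andP: (g01 t).
  rewrite -[leRHS](site_cst D 1 (enum_rank i)).
  by apply: le_site => t; case/andP: (g01 t).
have /andP[a0 a1] := h L A; have /andP[b0 b1] := h L' A'.
by rewrite ler_norml; apply/andP; split; lra.
Qed.

(* If some far Green function entry exceeds theta, its normalised moment is at
   least 1 and dominates the difference; otherwise the entries are small. *)
Lemma mean_site_decoupling L L' (bet s theta h0 c e sg B : R) (r : nat)
    (p : {poly R}) x :
  {subset L' <= L} -> 1 <= bet -> 0 < s -> 0 < theta -> 0 <= h0 -> 0 < sg -> 0 <= B ->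
  (forall y z, normc (H0 (delta R z) y : C) <= h0) ->
  (forall t, 0 <= p.[window_fun c e s t] <= 1) ->
  green_decay L r sg s bet B -> green_decay L' r sg s bet B ->
  deep (@far d) L L' ((size p + 2) * r) x ->
  mean_le P (fun w =>
    `|lsite (scaled_op H0 bet E L (omega ^~ w)) (fun t => p.[window_fun c e s t]) x -
      lsite (scaled_op H0 bet E L' (omega ^~ w)) (fun t => p.[window_fun c e s t]) x|)
    (decoupling_bound #|` L| c e s bet h0 theta p +
     2 * #|` L|%:R ^+ 2 * (theta `^ sg)^-1 * B).
Proof.
move=> L'L bet1 s0 t0 h00 sg0 B0 Hh p01 gL gL' dx.
pose G (M : {fset lattice d}) u v w : R := normc (kernel
    (invmx (compression H0 (omega ^~ w) M - (E +i* (s / bet))%:M)) u v).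
pose F (M : {fset lattice d}) w : R := \sum_(u <- M) \sum_(v <- M)
  (if far r u v then (theta `^ sg)^-1 * G M u v w `^ sg else 0).
have ts : 0 < theta `^ sg by exact: powR_gt0.
have tsV : 0 <= (theta `^ sg)^-1 by rewrite invr_ge0 ltW.
have cL (M : {fset lattice d}) (b : R) : \sum_(u <- M) b = #|` M|%:R * b.
  by rewrite big_const_seq count_predT iter_addr_0 mulr_natl.
have mF (M : {fset lattice d}) : {subset M <= L} -> green_decay M r sg s bet B ->
    mean_le P (F M) (#|` L|%:R ^+ 2 * (theta `^ sg)^-1 * B).
  move=> ML gM.
  have h : mean_le P (F M) (\sum_(u <- M) \sum_(v <- M) (theta `^ sg)^-1 * B).
    apply: mean_le_sum => u uM; apply: mean_le_sum => v vM.
    case: (boolP (far r u v)) => fuv; last by split=> //; rewrite integral_cst_probability lee_fin mulr_ge0.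
    by apply: mean_leZ => //; exact: gM.
  case: (h) => mFM F0 _; apply: mean_le_mono h _ => // [w|].
    by rewrite lexx andbT.
  rewrite !cL mulrA -expr2 -[leRHS]mulrA; apply: ler_wpM2r; first by rewrite mulr_ge0.
  rewrite lerXn2r ?nnegrE// ler_nat; apply: fsubset_leq_card.
  by apply/fsubsetP.
have -> : 2 * #|` L|%:R ^+ 2 * (theta `^ sg)^-1 * B =
  #|` L|%:R ^+ 2 * (theta `^ sg)^-1 * B + #|` L|%:R ^+ 2 * (theta `^ sg)^-1 * B by ring.
set db := decoupling_bound _ _ _ _ _ _ _ _.
have db0 : 0 <= db.
  have sV : 0 <= s^-1 by rewrite invr_ge0 ltW.
  have a0 := normc_ge0 (window_coef c e s).
  have b0 : 0 <= bet by exact: le_trans bet1.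
  rewrite /db /decoupling_bound; apply: mulr_ge0; first apply: mulr_ge0.
  - by apply: sumr_ge0.
  - by apply: exprn_ge0; rewrite !(mulr_ge0, addr_ge0).
  - apply: mulr_ge0; first exact: mulr_ge0.
    apply: mulr_ge0; first exact: ltW.
    apply: addr_ge0 => //; apply: mulr_ge0 => //; apply: mulr_ge0; last exact: mulr_ge0.
    by rewrite exprn_ge0.
have hD := mean_leD (mean_le_cst P db0) (mean_leD (mF L (fun _ => id) gL) (mF L' L'L gL')).
apply: mean_le_mono hD _ => //.
  apply: measurableT_comp => //.
  by apply: measurable_funB; exact: lsite_horner_measurable.
move=> w; rewrite normr_ge0 /=.
have F0 M : 0 <= F M w.
  apply: sumr_ge0 => u _; apply: sumr_ge0 => v _; case: ifP => // _.
  by rewrite mulr_ge0// powR_ge0.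
have big M u v : u \in M -> v \in M -> far r u v -> theta < G M u v w -> 1 <= F M w.
  move=> uM vM fuv tG; rewrite /F (big_rem u)//= (big_rem v)//= fuv.
  have g1 : 1 <= (theta `^ sg)^-1 * G M u v w `^ sg.
    rewrite mulrC ler_pdivlMr// mul1r; apply: ge0_ler_powR; rewrite ?nnegrE.
    - exact: ltW.
    - exact: ltW.
    - exact: normc_ge0.
    - exact: ltW.
  have q (b : bool) (y : R) : 0 <= y -> 0 <= (if b then y else 0) by case: b.
  rewrite -addrA; apply: le_trans g1 _; rewrite lerDl addr_ge0//.
    by apply: sumr_ge0 => u' _; apply: q; rewrite mulr_ge0// powR_ge0.
  by apply: sumr_ge0 => u' _; apply: sumr_ge0 => v' _; apply: q; rewrite mulr_ge0// powR_ge0.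
have [bad|good] := pselect (exists (M : {fset lattice d}) u v, [/\ M = L \/ M = L', u \in M, v \in M,
    far r u v & theta < G M u v w]).
  have [M [u [v [ML uM vM fuv tG]]]] := bad.
  have F1 := big M u v uM vM fuv tG.
  apply: le_trans (lsite_norm_diff_le1 _ _ _ _) _ => //.
  have FL := F0 L; have FL' := F0 L'.
  by case: ML F1 => -> F1; lra.
have small M u v : M = L \/ M = L' -> u \in M -> v \in M -> far r u v -> G M u v w <= theta.
  move=> ML uM vM fuv; rewrite leNgt; apply/negP => lt; apply: good.
  by exists M, u, v.
apply: (@le_trans _ _ db); last by rewrite lerDl addr_ge0.
apply: site_decoupling dx => //; first exact: ltW.
  by move=> u v uL vL fuv; apply: (small L); [left|..].
by move=> u v uL vL fuv; apply: (small L'); [right|..].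
Qed.

End SiteBounds.

(** * Partition into cells, for an arbitrary labelling *)

Section Cells.
Context (R : realType) (d : nat) (disp : measure_display)
  (T : measurableType disp) (P : probability T R)
  (H0 : {linear ell2 R d -> ell2 R d}).
Hypothesis H0_selfadjoint : selfadjoint_op H0.
Variables (omega : lattice d -> {RV P >-> R}).
Variables (alpha E : R) (L : {fset lattice d}) (key : lattice d -> lattice d).
Local Notation C := R[i].
Implicit Types (x k : lattice d).

(** Cells are the fibres of a labelling [key], so that they are disjoint and cover L by
    construction, whatever their shape. *)
Definition cell k : {fset lattice d} := [fset y in L | key y == k]%fset.

Definition keys : {fset lattice d} := [fset key y | y in L]%fset.

Lemma in_cell k x : (x \in cell k) = (x \in L) && (key x == k).
Proof. by rewrite !inE. Qed.

Lemma sum_cells (F : lattice d -> R) :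
  \sum_(k <- keys) \sum_(x <- cell k) F x = \sum_(x <- L) F x.
Proof.
rewrite [RHS](partition_big_imfset _ key); apply: eq_bigr => k _.
by rewrite big_fset.
Qed.

Lemma sum_count_cells (bet c e : R) V :
  \sum_(k <- keys) count H0 bet E c e (cell k) V =
  \sum_(x <- L) lsite (scaled_op H0 bet E (cell (key x)) V) \1_(`]c, e[%classic) x.
Proof.
rewrite -sum_cells; apply: eq_bigr => k _.
rewrite /count -sum_lsite big_seq [RHS]big_seq; apply: eq_bigr => x.
by rewrite in_cell => /andP[_ /eqP ->].
Qed.

Lemma sum_card_cells : (\sum_(k <- keys) #|` cell k|)%N = #|` L|.
Proof.
apply/eqP; rewrite -(eqr_nat R) natr_sum -[X in _ == X%:R]sum1_size natr_sum -sum_cells.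
by apply/eqP; apply: eq_bigr => k _; rewrite -natr_sum sum1_size.
Qed.

Lemma lsiteD (M : {fset lattice d}) (A : 'M[C]_#|{: M}|) f g x :
  lsite A (fun t => f t + g t) x = lsite A f x + lsite A g x.
Proof. by rewrite /lsite; case: insub => [i|]; rewrite ?siteD ?addr0. Qed.

Lemma le_norm_lsiteB (M : {fset lattice d}) (A : 'M[C]_#|{: M}|) f g x :
  `|lsite A f x - lsite A g x| <= lsite A (fun t => `|f t - g t|) x.
Proof.
by rewrite /lsite; case: insub => [i|]; rewrite ?le_norm_siteB// subrr normr0.
Qed.

(** Both counts are sums over the same sites of L. At each site the indicator is replaced by p(v)
    for the box and for the cell, which costs kernels of mean given by the Wegner bound; the two
    values of p(v) differ by c0 in mean on the bulk, and elsewhere each is at most M times a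
    kernel. *)
Lemma mean_count_cells (bet c e K y eps M c0 : R) (p : {poly R})
    (bulk : pred (lattice d)) :
  0 <= K -> 0 < bet -> c < e -> 0 < y -> 0 < eps -> 0 <= M -> 0 <= c0 ->
  (forall (L' : {fset lattice d}) n r u, n \in L' -> 0 < r ->
    (\int[P]_w (lsite (scaled_op H0 bet E L' (omega ^~ w)) (pk r u) n)%:E <=
     (K * (r / bet) `^ alpha)%:E)%E) ->
  (forall t, [/\ 0 <= p.[window_fun c e y t], p.[window_fun c e y t] <= 1,
      p.[window_fun c e y t] <= M * pk y 0 t &
      `|\1_(`]c, e[%classic) t - p.[window_fun c e y t]| <=
      2 * pk eps c t + 2 * pk eps e t + eps * pk y 0 t]) ->
  (forall x, x \in L -> bulk x -> mean_le P (fun w =>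
    `|lsite (scaled_op H0 bet E L (omega ^~ w)) (fun t => p.[window_fun c e y t]) x -
      lsite (scaled_op H0 bet E (cell (key x)) (omega ^~ w))
        (fun t => p.[window_fun c e y t]) x|) c0) ->
  mean_le P (fun w => `|count H0 bet E c e L (omega ^~ w) -
      \sum_(k <- keys) count H0 bet E c e (cell k) (omega ^~ w)|)
    (#|` L|%:R * (2 * K * (4 * (eps / bet) `^ alpha + eps * (y / bet) `^ alpha) + c0) +
     (\sum_(x <- L | ~~ bulk x) 1) * (2 * M * K * (y / bet) `^ alpha)).
Proof.
move=> K0 b0 ce y0 eps0 M0 c00 hW win hbulk.
pose A (L' : {fset lattice d}) w := scaled_op H0 bet E L' (omega ^~ w).
pose f t := p.[window_fun c e y t].
have hpk (L' : {fset lattice d}) n r u : n \in L' -> 0 < r ->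
    mean_le P (fun w => lsite (A L' w) (pk r u) n) (K * (r / bet) `^ alpha).
  move=> nL r0; split; last exact: hW.
    by apply: lsite_measurable.
  by move=> w; apply: lsite_ge0 => t; exact: pk_ge0.
pose h (L' : {fset lattice d}) n w := 2 * lsite (A L' w) (pk eps c) n +
  2 * lsite (A L' w) (pk eps e) n + eps * lsite (A L' w) (pk y 0) n.
have mh (L' : {fset lattice d}) n : n \in L' -> mean_le P (h L' n)
    (2 * (K * (eps / bet) `^ alpha) + 2 * (K * (eps / bet) `^ alpha) +
     eps * (K * (y / bet) `^ alpha)).
  move=> nL; apply: mean_leD; first apply: mean_leD.
  - by apply: mean_leZ => //; exact: hpk.
  - by apply: mean_leZ => //; exact: hpk.
  - by apply: mean_leZ; [exact: ltW|exact: hpk].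
have hle (L' : {fset lattice d}) n w :
    `|lsite (A L' w) \1_(`]c, e[%classic) n - lsite (A L' w) f n| <= h L' n w.
  apply: le_trans (le_norm_lsiteB _ _ _ _) _; rewrite /h -!lsiteZ -!lsiteD.
  by apply: le_lsite => t; case: (win t).
pose D x w := `|lsite (A L w) f x - lsite (A (cell (key x)) w) f x|.
have mD x : x \in L -> mean_le P (D x)
    (c0 + if bulk x then 0 else 2 * M * K * (y / bet) `^ alpha).
  move=> xL; have xC : x \in cell (key x) by rewrite in_cell xL eqxx.
  have [bx|bx] := boolP (bulk x); first by rewrite addr0; exact: hbulk.
  have hM := mean_leD (mean_leZ M0 (hpk L x y 0 xL y0)) (mean_leZ M0 (hpk _ x y 0 xC y0)).
  apply: mean_le_mono hM _; last by lra.
    apply: measurableT_comp => //.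
    by apply: measurable_funB; exact: lsite_horner_measurable.
  move=> w; rewrite normr_ge0 /=.
  have bd (L' : {fset lattice d}) : 0 <= lsite (A L' w) f x <= M * lsite (A L' w) (pk y 0) x.
    apply/andP; split; first by apply: lsite_ge0 => t; case: (win t).
    by rewrite -lsiteZ; apply: le_lsite => t; case: (win t).
  have /andP[a0 a1] := bd L; have /andP[e0 e1] := bd (cell (key x)).
  by rewrite ler_norml; apply/andP; split; lra.
have sumW := @mean_le_sum _ _ _ P _ L (fun x w => h L x w + h (cell (key x)) x w + D x w) _
  (fun x xL => mean_leD (mean_leD (mh L x xL)
     (mh (cell (key x)) x (eqbRL (in_cell _ _) (introT andP (conj xL (eqxx _)))))) (mD x xL)).
apply: mean_le_mono sumW _.
- apply: measurableT_comp => //; apply: measurable_funB.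
    by apply: count_measurable.
  apply: (@measurable_rsum _ _ _ _ _ (fun k w => count H0 bet E c e (cell k) (omega ^~ w))).
  by move=> k; apply: count_measurable.
- move=> w; rewrite normr_ge0 /= sum_count_cells /count -sum_lsite -sumrB.
  apply: le_trans (ler_norm_sum _ _ _) _; apply: ler_sum => x _.
  have := hle L x w; have := hle (cell (key x)) x w; rewrite /D -/(A L w) -/(A (cell (key x)) w).
  move: (lsite _ \1__ x) (lsite _ \1__ x) (lsite _ f x) (lsite _ f x) => a1 a2 a3 a4.
  move: (h _ _ _) (h _ _ _) => h1 h2; rewrite !ler_norml => /andP[i1 i2] /andP[i3 i4].
  have i5 := ler_norm (a3 - a4); have := ler_norm (a4 - a3); rewrite distrC => i6.
  by apply/andP; split; lra.
set X := 2 * K * _ + c0; set B := 2 * M * K * _.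
rewrite (eq_bigr (fun x => X + (if ~~ bulk x then 1 else 0) * B)); last first.
  by move=> x _; rewrite /X /B; case: (bulk x) => /=; ring.
rewrite big_split /= -mulr_suml -big_mkcond /= big_const_seq count_predT iter_addr_0.
by rewrite -[X *+ _]mulr_natl lexx.
Qed.

Definition occupied (bet c e : R) k : set T :=
  [set w | 1 <= count H0 bet E c e (cell k) (omega ^~ w)].

Lemma measurable_occupied (bet c e : R) k : c < e -> measurable (occupied bet c e k).
Proof.
move=> ce; have mc : measurable_fun [set: T]
    (fun w => count H0 bet E c e (cell k) (omega ^~ w)) by exact: count_measurable.
have := mc measurableT _ (measurable_itv `[1, +oo[); rewrite setTI.
by congr measurable; apply/seteqP; split=> w /=; rewrite in_itv /= andbT.
Qed.

Lemma count_natr (bet c e : R) (M : {fset lattice d}) V :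
  exists m : nat, count H0 bet E c e M V = m%:R.
Proof. by rewrite /count strace_indic; eexists. Qed.

(** For a natural number m, the difference between m and the indicator of m >= 1 is at most m(m -
    1), the quantity that a Minami bound controls. *)
Lemma mean_count_hits (bet c e : R) (b : lattice d -> R) : c < e ->
  (forall k, (\int[P]_w (count H0 bet E c e (cell k) (omega ^~ w) *
     (count H0 bet E c e (cell k) (omega ^~ w) - 1))%:E <= (b k)%:E)%E) ->
  mean_le P (fun w => `|\sum_(k <- keys) count H0 bet E c e (cell k) (omega ^~ w) -
    (hits (occupied bet c e) keys w)%:R|) (\sum_(k <- keys) b k).
Proof.
move=> ce hb; pose q k w := count H0 bet E c e (cell k) (omega ^~ w).
have mq k : measurable_fun [set: T] (q k) by exact: count_measurable.
have mb k : mean_le P (fun w => q k w * (q k w - 1)) (b k).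
  split; last exact: hb.
    by apply: measurable_funM => //; apply: measurable_funB => //; exact: measurable_cst.
  move=> w; rewrite /q; have [[|m] ->] := count_natr bet c e (cell k) (omega ^~ w).
    by rewrite mul0r.
  by rewrite mulr_ge0// subr_ge0 ler1n.
apply: mean_le_mono (mean_le_sum (fun k _ => mb k)) _ => //.
  apply: measurableT_comp => //; apply: measurable_funB.
    exact: (@measurable_rsum _ _ _ _ _ q).
  under eq_fun do rewrite hits_indic.
  apply: (@measurable_rsum _ _ _ _ _ (fun k w => \1_(occupied bet c e k) w)) => k.
  by apply: measurable_indic; exact: measurable_occupied.
move=> w; rewrite normr_ge0 /= hits_indic -sumrB; apply: le_trans (ler_norm_sum _ _ _) _.
apply: ler_sum => k _; rewrite indicE -/(q k w).
have [m qm] := count_natr bet c e (cell k) (omega ^~ w).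
have -> : (w \in occupied bet c e k) = (0 < m)%N.
  by apply/idP/idP; rewrite inE /occupied /= qm ler1n.
rewrite /q qm; case: m qm => [|m] _ /=; first by rewrite subrr normr0 mul0r.
by rewrite ger0_norm ?subr_ge0 ?ler1n// ler_peMl ?subr_ge0 ?ler1n.
Qed.

Hypothesis omega_indep : mutually_independent omega.

(** The event for cell i depends on the potentials in that cell, those for the other cells on
    potentials in the complement. *)
Lemma hits_occupied_indep (bet c e : R) i (r : seq (lattice d)) (m : nat) : c < e ->
  i \notin r ->
  P (occupied bet c e i `&` hits_eq (occupied bet c e) r m) =
  (P (occupied bet c e i) * P (hits_eq (occupied bet c e) r m))%E.
Proof.
move=> ce ir; pose J : set (lattice d) := [set` cell i].
have occ (J' : set (lattice d)) k : [set` cell k] `<=` J' ->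
    measurable (occupied bet c e k : set (sigma_of omega J')).
  move=> kJ; have mc : measurable_fun [set: sigma_of omega J']
      (fun w => count H0 bet E c e (cell k) (omega ^~ (w : T))).
    by apply: count_measurable => // x xk; apply: measurable_sigma_of; exact: kJ.
  have := mc measurableT _ (measurable_itv `[1, +oo[); rewrite setTI.
  by congr measurable; apply/seteqP; split=> w /=; rewrite in_itv /= andbT.
apply: (@sigma_of_indep _ _ _ _ _ omega omega_indep J (~` J)).
- by rewrite disj_set2E setICr.
- exact: occ.
(* The index i does not occur in r; giving it the empty event makes every A k measurable for the
   complement of the cell, as [measurable_hits_eq] requires. *)
pose A k := if k == i then set0 else occupied bet c e k.
have -> : hits_eq (occupied bet c e) r m = hits_eq A r m.
  apply/funext => w; rewrite /hits_eq /= /hits; congr (_ = m).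
  apply: eq_in_count => k kr; rewrite /A; case: eqP => // ki.
  by move: ir; rewrite -ki kr.
apply: (@measurable_hits_eq _ (sigma_of omega (~` J)) _ A) => k.
rewrite /A; have [//|ki] := eqVneq k i.
apply: occ => x /=; rewrite in_cell => /andP[xL /eqP xk].
by rewrite /J /= in_cell xL xk /=; exact/negP.
Qed.

End Cells.

(** * Cubic cells in the box *)

Section Geometry.
Variables (d L l : nat).
Hypothesis l_gt0 : (0 < l)%N.
Implicit Types (x y k : lattice d).

Lemma card_cube x m : #|` cube x m| = (m ^ d)%N.
Proof.
rewrite /cube card_imfset /=; first by rewrite -cardE card_ffun !card_ord.
move=> f g /rowP fg; apply/ffunP => i; apply: val_inj.
by have := fg i; rewrite !mxE => /addrI [].
Qed.

(** The shift by L starts the first cell at the corner of the box, so that only cells at the upper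
    faces can be cut off. *)
Definition cell_key x : lattice d := \row_i ((x ord0 i + L%:Z) %/ l%:Z)%Z.

Lemma divz_eqP (t k : int) : (t %/ l%:Z)%Z == k = (k * l%:Z <= t < (k + 1) * l%:Z).
Proof.
have l0 : (0 : int) < l%:Z by rewrite ltz_nat.
have e := divz_eq t l; have m0 := modz_ge0 t (lt0r_neq0 l0); have m1 := ltz_pmod t l0.
apply/eqP/idP => [<-|]; first by lia.
by move: e m0 m1; move: (t %/ l)%Z (t %% l)%Z => q m; nia.
Qed.

Definition corner k : lattice d := \row_i (k ord0 i * l%:Z - L%:Z).

Lemma in_cell_box k x :
  (x \in cell (box d L) cell_key k) = (x \in box d L) && (x \in cube (corner k) l).
Proof.
rewrite in_cell; congr andb; rewrite in_cube; apply/eqP/forallP => [<- i|h].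
  have := divz_eqP (x ord0 i + L%:Z) (cell_key x ord0 i); rewrite !mxE eqxx.
  by move: (_ %/ _)%Z => kk; lia.
apply/rowP => i; rewrite mxE; apply/eqP; rewrite divz_eqP.
rewrite -[k 0 i]/(k ord0 i); have := h i; rewrite mxE.
by move: (k ord0 i) => kk; lia.
Qed.

Lemma card_cell_le k : (#|` cell (box d L) cell_key k| <= l ^ d)%N.
Proof.
rewrite -(card_cube (corner k) l); apply: fsubset_leq_card; apply/fsubsetP => x.
by rewrite in_cell_box => /andP[].
Qed.

Variables (q rho : nat).
Hypothesis ql : (q * l <= (2 * L).+1)%N.

(** Of the q^d cells lying completely in the box, the points that keep a margin rho on every side.
    The subtraction is truncated, so for d > 0 nothing is left of cells thinner than 2 rho. *)
Definition inner : {fset lattice d} :=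
  let pt (f : {ffun 'I_d -> 'I_q * 'I_(l - 2 * rho)}) : lattice d :=
    \row_i ((f i).1%:Z * l%:Z + rho%:Z + (f i).2%:Z - L%:Z) in
  [fset pt f | f in {: {ffun 'I_d -> 'I_q * 'I_(l - 2 * rho)}}]%fset.

Lemma card_inner : #|` inner| = ((q * (l - 2 * rho)) ^ d)%N.
Proof.
rewrite /inner card_imfset /=; first by rewrite -cardE card_ffun card_prod !card_ord.
move=> f g /rowP fg; apply/ffunP => i; have := fg i; rewrite !mxE.
case: (f i) (g i) => [a b] [a' b'] /=; have := ltn_ord b; have := ltn_ord b'.
move=> h1 h2 e; suff [e1 e2] : a = a' :> nat /\ b = b' :> nat.
  by congr (_, _); apply: val_inj.
have : ((a : nat) * l + b = a' * l + b')%N by lia.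
move=> e'; have e3 : a = a' :> nat by nia.
by split=> //; lia.
Qed.

Lemma innerP x : x \in inner -> exists (k : lattice d) (b : 'I_d -> nat),
  forall i, [/\ 0 <= k ord0 i, k ord0 i < q%:Z, (b i < l - 2 * rho)%N &
    x ord0 i = k ord0 i * l%:Z + rho%:Z + (b i)%:Z - L%:Z].
Proof.
move=> /imfsetP[f _ ->]; exists (\row_i (f i).1%:Z), (fun i => (f i).2 : nat) => i.
by rewrite !mxE; split=> //; rewrite ltz_nat.
Qed.

(** The cell of an inner point is a whole cube, which is the shape that (Loc) speaks about; cells
    cut off by the box need not be cubes. *)
Lemma inner_cell x : x \in inner ->
  [/\ x \in box d L, cell (box d L) cell_key (cell_key x) = cube (corner (cell_key x)) l &
      deep (@far d) (box d L) (cell (box d L) cell_key (cell_key x)) rho x].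
Proof.
move=> /innerP[k [b h]].
have kx : cell_key x = k.
  apply/rowP => i; rewrite mxE; apply/eqP; rewrite divz_eqP -[k 0 i]/(k ord0 i).
  by have [k0 kq bl ->] := h i; move: bl k0 kq; move: (k ord0 i) (b i) => kk bb; lia.
have sub y : y \in cube (corner k) l -> y \in box d L.
  rewrite !in_cube => /forallP hy; apply/forallP => i; have := hy i.
  have [k0 kq bl _] := h i; rewrite !mxE; move: kq k0; move: (k ord0 i) (y ord0 i) => kk yy.
  by move=> kq k0; nia.
have xcube : x \in cube (corner k) l.
  rewrite in_cube; apply/forallP => i; rewrite mxE.
  by have [k0 kq bl ->] := h i; move: bl k0 kq; move: (k ord0 i) (b i) => kk bb; lia.
have cE : cell (box d L) cell_key (cell_key x) = cube (corner (cell_key x)) l.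
  apply/fsetP => y; rewrite in_cell_box; apply: andb_idl; rewrite kx; exact: sub.
split=> //; first exact: sub.
rewrite /deep cE kx xcube /=; apply/forallP => u; apply/implyP.
rewrite in_cube negb_forall => /existsP[j]; rewrite mxE => hj; apply/existsP; exists j.
have [k0 kq bl ->] := h j; move: hj bl; move: (k ord0 j) (b j) (fsval u ord0 j) => kk bb uu.
by lia.
Qed.

Lemma card_not_inner (R : realType) :
  \sum_(x <- box d L | x \notin inner) (1 : R) =
  (2 * L).+1%:R ^+ d - (q * (l - 2 * rho))%:R ^+ d.
Proof.
apply/eqP; rewrite eq_sym subr_eq; apply/eqP.
rewrite -!natrX -card_inner -(card_cube (const_mx (- L%:Z)) (2 * L).+1) -/(box d L).
rewrite -[in LHS]sum1_size natr_sum (bigID (fun x => x \notin inner)) /=; congr (_ + _).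
under eq_bigl do rewrite negbK.
rewrite big_fset_condE (_ : [fset i in box d L | i \in inner]%fset = inner).
  by rewrite -natr_sum sum1_size.
by apply/fsetP => x; rewrite !inE andb_idl// => /inner_cell[].
Qed.

End Geometry.

(** * Choice of scales and polynomial against exponential bounds *)

Section Scales.
Variable R : realType.

Lemma fourth_root_exists (M : nat) : exists s, (s ^ 4 <= M < s.+1 ^ 4)%N.
Proof.
elim: M => [|M [s /andP[s1 s2]]]; first by exists 0%N.
have [le|lt] := leqP (s.+1 ^ 4) M.+1; last by exists s; rewrite lt andbT leqW.
exists s.+1; rewrite le /=; apply: (leq_ltn_trans s2).
by rewrite ltn_exp2r.
Qed.

Definition fourth_root M := xchoose (fourth_root_exists M).

Lemma fourth_rootP M : (fourth_root M ^ 4 <= M < (fourth_root M).+1 ^ 4)%N.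
Proof. exact: xchooseP (fourth_root_exists M). Qed.

Lemma fourth_root_ge S M : (S ^ 4 <= M)%N -> (S <= fourth_root M)%N.
Proof.
move=> SM; have /andP[_ lt] := fourth_rootP M; rewrite -ltnS.
by rewrite -(@ltn_exp2r _ _ 4)// (leq_ltn_trans SM).
Qed.

(** The term of order k+1 of the exponential series at g(s+1) leaves one spare power of s+1; the
    factor exp g pays for passing from s+1 to s. *)
Lemma expR_decay (g : R) (k : nat) : 0 < g -> exists2 C : R, 0 <= C &
  forall s : nat, s.+1%:R ^+ k * expR (- (g * s%:R)) <= C / s.+1%:R.
Proof.
move=> g0; exists (expR g * (k.+1)`!%:R / g ^+ k.+1).
  by rewrite divr_ge0 ?mulr_ge0 ?expR_ge0// exprn_ge0// ltW.
move=> s; set x : R := s.+1%:R; have x0 : 0 < x by rewrite ltr0n.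
have gx : 0 <= g * x by rewrite mulr_ge0 // ltW.
have -> : - (g * s%:R) = g - g * x by rewrite /x -natr1; ring.
rewrite expRD expRN.
have := expR_ge1Dxn k gx => h.
have {}h : (g * x) ^+ k.+1 / (k.+1)`!%:R <= expR (g * x).
  by apply: le_trans h; rewrite lerDr.
have f0 : (0 : R) < (k.+1)`!%:R by rewrite ltr0n fact_gt0.
have e0 := expR_gt0 (g * x); have gk : 0 < g ^+ k.+1 by rewrite exprn_gt0.
rewrite ler_pdivlMr// mulrAC -exprSr mulrCA -mulrA ler_wpM2l ?expR_ge0//.
rewrite ler_pdivrMr// mulrAC ler_pdivlMr// mulrC.
by move: h; rewrite ler_pdivrMr// exprMn [leRHS]mulrC.
Qed.

(** Per direction at most s^2 + 2 q rho s of the M points are lost, which with q s^2 <= M and s^4 <=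
    M is a fraction at most (1 + 2 rho)/s. Bernoulli's inequality turns this into d times that
    fraction of the volume. *)
Lemma inner_fraction (d M s rho q : nat) : (0 < s)%N -> (s ^ 4 <= M)%N ->
  q = (M %/ s ^ 2)%N ->
  M%:R ^+ d - (q * (s ^ 2 - 2 * (rho * s)))%:R ^+ d <=
  M%:R ^+ d * (d%:R * ((1 + 2 * rho%:R) / s%:R)) :> R.
Proof.
move=> s0 sM qE; set v := (q * _)%N; pose t : R := 1 - v%:R / M%:R.
have M0 : (0 : R) < M%:R by rewrite ltr0n (leq_trans _ sM)// expn_gt0 s0.
have qM : (q * s ^ 2 <= M)%N by rewrite qE leq_trunc_div.
have t0 : 0 <= t.
  rewrite subr_ge0 ler_pdivrMr// mul1r ler_nat; apply: leq_trans qM.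
  by rewrite leq_mul2l leq_subr orbT.
have sR : (0 : R) < s%:R by rewrite ltr0n.
have t1 : t <= 1 by rewrite /t lerBlDr lerDl divr_ge0// ler0n.
have vE : v%:R = M%:R * (1 - t) by rewrite /t subKr mulrCA divff ?mulr1// gt_eqF.
have bern := @bernoulli_lower R t d; rewrite t0 t1 in bern.
rewrite vE exprMn -{1}[M%:R ^+ d]mulr1 -mulrBr.
apply: ler_wpM2l; first by rewrite exprn_ge0// ltW.
apply: (@le_trans _ _ (d%:R * t)); first by have := bern isT; lra.
apply: ler_wpM2l => //.
have vge : (M <= v + s ^ 2 + 2 * (q * (rho * s)))%N.
  rewrite /v mulnBr; have := divn_eq M (s ^ 2); rewrite -qE.
  have : (M %% s ^ 2 < s ^ 2)%N by rewrite ltn_mod expn_gt0 s0.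
  by lia.
have vgeR : M%:R <= v%:R + s%:R ^+ 2 + 2 * (q%:R * (rho%:R * s%:R)) :> R.
  by rewrite -natrX -!natrM -!natrD ler_nat.
have qMR : q%:R * s%:R ^+ 2 <= M%:R :> R by rewrite -natrX -natrM ler_nat.
have sMR : s%:R ^+ 4 <= M%:R :> R by rewrite -natrX ler_nat.
rewrite ler_pdivlMr//.
have s1 : (1 : R) <= s%:R by rewrite ler1n.
have tM : M%:R * t <= s%:R ^+ 2 + 2 * (q%:R * (rho%:R * s%:R)).
  by move: vE; rewrite mulrBr mulr1; lra.
rewrite -(ler_pM2l M0) mulrA.
apply: (@le_trans _ _ (s%:R ^+ 3 + 2 * rho%:R * (q%:R * s%:R ^+ 2))).
  rewrite (_ : _ + _ = (s%:R ^+ 2 + 2 * (q%:R * (rho%:R * s%:R))) * s%:R); last by ring.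
  by apply: ler_wpM2r tM; exact: ltW.
rewrite mulrDr mulr1 lerD//.
  by apply: le_trans sMR; rewrite [leRHS]exprSr ler_peMr// exprn_ge0// ltW.
by rewrite [leRHS]mulrC; apply: ler_wpM2l; rewrite ?mulr_ge0.
Qed.

Variables (d : nat) (alpha : R).
Hypotheses (d_gt0 : (0 < d)%N) (alpha_gt0 : 0 < alpha) (alpha_le1 : alpha <= 1).

Definition volume (L : nat) : R := (2 * L).+1%:R ^+ d.

Lemma volume_ge1 L : 1 <= volume L.
Proof. by rewrite exprn_ege1// ler1n. Qed.

Lemma beta_ge1 L : 1 <= beta d alpha L.
Proof.
by rewrite /beta -[leLHS](powRr0 (2 * L).+1%:R) ler_powR ?ler1n// divr_ge0 ?ler0n// ltW.
Qed.

Lemma beta_powR L : beta d alpha L `^ alpha = volume L.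
Proof. by rewrite /beta -powRrM divfK ?gt_eqF// powR_mulrn. Qed.

Lemma powR_beta L (r : R) : 0 <= r -> (r / beta d alpha L) `^ alpha = r `^ alpha / volume L.
Proof.
move=> r0; have b0 : 0 < beta d alpha L by exact: lt_le_trans (beta_ge1 L).
rewrite powRM ?invr_ge0// ?(ltW b0)//; congr (_ * _).
by rewrite -beta_powR -powR_inv1 ?(ltW b0)// powRAC powR_inv1// powR_ge0.
Qed.

(** Only a polynomial bound in the volume is wanted: in [decoupling_bound_le] it is multiplied by
    theta, which will be exponentially small in s. *)
Lemma beta_le_volume : exists N : nat, forall L, beta d alpha L <= volume L ^+ N.
Proof.
exists (Num.truncn alpha^-1).+1 => L; rewrite /beta /volume -exprM -powR_mulrn ?ler0n//.
apply: ler_powR; first by rewrite ler1n.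
by rewrite natrM ler_wpM2l ?ler0n// ltW// Num.Theory.truncnS_gt.
Qed.

Lemma decoupling_bound_le (c e y h0 : R) (p : {poly R}) : 0 < y -> 0 <= h0 ->
  exists (k : nat) (K : R), 0 <= K /\ forall (N L : nat) theta, 0 <= theta ->
  N%:R = volume L ->
  decoupling_bound N c e y (beta d alpha L) h0 theta p <= K * volume L ^+ k * theta.
Proof.
move=> y0 h00; have [B hB] := beta_le_volume.
set a := normc (window_coef c e y); have a0 : 0 <= a by exact: normc_ge0.
have yV : 0 <= y^-1 by rewrite invr_ge0 ltW.
have A0 : 0 <= \sum_(j < size p) `|p`_j| by apply: sumr_ge0.
exists (size p + (2 + B))%N, ((\sum_(j < size p) `|p`_j|) *
  (4 * (1 + 2 * a * y^-1)) ^+ size p * (2 * a * (2 + h0 * y^-1))).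
have ge0 : 0 <= 1 + 2 * a * y^-1 by rewrite addr_ge0// !mulr_ge0.
split; first by rewrite !(mulr_ge0, exprn_ge0, addr_ge0).
move=> N L theta t0 NL; rewrite /decoupling_bound -/a NL.
have v1 := volume_ge1 L; have v0 : 0 <= volume L by exact: le_trans v1.
have -> : 4 * (volume L * (1 + 2 * a * y^-1)) = volume L * (4 * (1 + 2 * a * y^-1)) by ring.
rewrite exprMn exprD.
have key : 2 + volume L ^+ 2 * (beta d alpha L * h0) * y^-1 <=
    volume L ^+ (2 + B) * (2 + h0 * y^-1).
  rewrite mulrDr lerD//; first by rewrite ler_peMl// exprn_ege1.
  rewrite exprD -[leLHS]mulrA -[leRHS]mulrA -[X in _ * X <= _]mulrA.
  apply: ler_wpM2l; first exact: exprn_ge0.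
  by apply: ler_wpM2r => //; exact: mulr_ge0.
set S := \sum_(j < _) _; set q := _ ^+ size p; set V := _ ^+ size p.
have -> : S * V * (2 * a * (2 + h0 * y^-1)) * (q * volume L ^+ (2 + B)) * theta =
  S * (q * V) * (2 * a * (theta * (volume L ^+ (2 + B) * (2 + h0 * y^-1)))) by ring.
have V0 : 0 <= V by apply: exprn_ge0; rewrite mulr_ge0.
have q0 : 0 <= q by apply: exprn_ge0.
apply: ler_wpM2l; first by apply: mulr_ge0 => //; exact: mulr_ge0.
apply: ler_wpM2l; first exact: mulr_ge0.
exact: ler_wpM2l.
Qed.

End Scales.

(** * The box count is close in mean to the sum of the cell counts *)

Section Assembly.
Context (R : realType) (d : nat) (d_gt0 : (0 < d)%N)
  (disp : measure_display) (T : measurableType disp) (P : probability T R)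
  (H0 : {linear ell2 R d -> ell2 R d}).
Hypotheses (H0_bounded : bounded_op H0) (H0_selfadjoint : selfadjoint_op H0).
Variables (mu : probability R R) (omega : lattice d -> {RV P >-> R}).
Hypotheses (omega_indep : mutually_independent omega)
  (omega_distr : identically_distributed omega mu).
Variables (alpha : R).
Hypotheses (alpha_gt0 : 0 < alpha) (alpha_le1 : alpha <= 1)
  (mu_holder : uniformly_holder alpha mu).
Variables (a b : R) (E : R) (c e : R).
Hypotheses (loc : exp_localized H0 omega a b) (E_ab : a <= E <= b) (ce : c < e).
Local Notation C := R[i].
Local Notation scale L := (fourth_root (2 * L).+1).
Local Notation box_key L := (cell_key L (scale L ^ 2)).
Local Notation box_cell L := (cell (box d L) (box_key L)).
Local Notation box_keys L := (keys (box d L) (box_key L)).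
Local Notation num L S w := (count H0 (beta d alpha L) E c e S (omega ^~ w)).

Lemma green_decay_cube : exists sg g B : R, [/\ 0 < sg, 0 < g, 0 <= B &
  exists l0 : nat, forall (x : lattice d) (l : nat), (l0 <= l)%N ->
  forall (r : nat) (y bet : R), 0 < y -> 0 < bet ->
  green_decay H0 omega E (cube x l) r sg y bet (B * expR (- (g * r%:R)))].
Proof.
have [sg [g [B [sg0 g0 [l0 h]]]]] := loc.
(* The constant of (Loc) carries no sign; its absolute value makes the bound monotone in the
   distance. *)
exists sg, g, `|B|; split=> //; exists l0 => x l ll r y bet y0 b0 u v ux vx fuv.
have z0 : 0 < complex.Im (E +i* (y / bet)) by rewrite divr_gt0.
split; first exact: green_measurable.
  by move=> w; exact: powR_ge0.
have := h x l ll [` ux]%fset [` vx]%fset (E +i* (y / bet)) z0 E_ab.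
rewrite unlock /green => hE.
rewrite (_ : (fun w => _) = (fun w => (normc (invmx (compression H0 (omega ^~ w) (cube x l) -
   (E +i* (y / bet))%:M) (enum_rank [` ux]%fset) (enum_rank [` vx]%fset)) `^ sg)%:E)); last first.
  apply/funext => w; congr ((normc _ `^ _)%:E).
  by rewrite -[u in kernel _ u]/(val [` ux]%fset) -[v in kernel _ _ v]/(val [` vx]%fset) kernelE.
apply: le_trans hE _; rewrite lee_fin.
apply: le_trans (ler_wpM2r (expR_ge0 _) (ler_norm _)) _.
apply: ler_wpM2l => //; rewrite ler_expR mulNr lerN2; apply: ler_wpM2l; first exact: ltW.
exact: far_euclid.
Qed.

Lemma card_box L : #|` box d L|%:R = volume R d L.
Proof. by rewrite /box card_cube natrX. Qed.

Lemma scale_gt0 L : (0 < scale L)%N.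
Proof. exact: (fourth_root_ge (S := 1)). Qed.

Lemma le_scale S L : (S ^ 4 <= L)%N -> (S <= scale L)%N.
Proof.
by move=> h; apply: fourth_root_ge; rewrite (leq_trans h)// mul2n -addnn leqW// leq_addr.
Qed.

Lemma small_eps (t : R) : 0 < t -> exists2 eps : R, 0 < eps & eps <= t /\ eps `^ alpha <= t.
Proof.
move=> t0; pose u := Num.min t 1.
have u0 : 0 < u by rewrite lt_min t0 ltr01.
exists (u `^ alpha^-1); first exact: powR_gt0.
split.
  apply: (@le_trans _ _ u); last by rewrite ge_min lexx.
  apply: ge1r_powR; first by rewrite u0 ge_min lexx orbT.
  by rewrite invf_ge1.
by rewrite -powRrM mulVf ?gt_eqF// powRr1 ?(ltW u0)// ge_min lexx.
Qed.

Lemma mean_count_cells_small (tol : R) : 0 < tol -> exists L0, forall L, (L0 <= L)%N ->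
  mean_le P (fun w => `|num L (box d L) w - \sum_(k <- box_keys L) num L (box_cell L k) w|)
    tol.
Proof.
move=> tol0.
have [K K0 hW] := wegner H0_selfadjoint omega_indep omega_distr alpha_gt0 alpha_le1 mu_holder.
have [h0 h00 Hh] := bounded_op_entry H0_bounded.
have [sg [g [B [sg0 g0 B0 [l0 hG]]]]] := green_decay_cube.
have [y y0 win] := window_approx ce.
pose Y := y `^ alpha; have Y0 : 0 <= Y by exact: powR_ge0.
have K1 : 0 < K + 1 by lra.
have Y4 : 0 < 4 + Y by lra.
(* Chosen for [e1]: the approximation error of all sites is at most 2K t (4 + Y) <= tol/4. The 1 in
   K + 1 guards against K = 0. *)
pose t := tol / (8 * (K + 1) * (4 + Y)).
have t0 : 0 < t by rewrite /t divr_gt0// !mulr_gt0.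
have [eps eps0 [eps1 eps2]] := small_eps t0.
have [p [M [M0 winp]]] := win eps eps0.
have [kd [Kd [Kd0 hdb]]] := decoupling_bound_le d alpha c e p y0 h00.
have g20 : 0 < g / (2 * sg) by rewrite divr_gt0// mulr_gt0.
(* The volume is at most (s+1)^(4d). The exponents kd + 1 and 3 are those of the volume in [c0],
   increased by one for the sum over the sites. *)
have [C1 C10 hC1] := expR_decay (4 * d * kd.+1) g20.
have g2 : 0 < g / 2 by rewrite divr_gt0.
have [C2 C20 hC2] := expR_decay (4 * d * 3) g2.
pose rho := (size p + 2)%N.
pose Ctot := Kd * C1 + 2 * B * C2 + 2 * M * K * Y * (d%:R * (1 + 2 * rho%:R)).
have Ctot0 : 0 <= Ctot by rewrite /Ctot !(addr_ge0, mulr_ge0).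
(* L >= S^4 gives s >= S; then the box and the cells have side at least l0, as (Loc) demands, and
   the terms of order 1/s add up to at most tol/2. *)
pose S := maxn (maxn l0 1) (Num.truncn (2 * Ctot / tol)).+1.
have S1 : (1 <= S)%N by rewrite /S -maxnA maxnCA leq_max.
have l0S : (l0 <= S)%N by rewrite /S -maxnA leq_max leqnn.
have Sbig : 2 * Ctot / tol <= S%:R.
  apply: le_trans (ltW (Num.Theory.truncnS_gt _)) _.
  by rewrite ler_nat /S leq_maxr.
clearbody S; exists (S ^ 4)%N => L SL.
have Ss := le_scale SL.
have SL' : (S <= L)%N by apply: leq_trans SL; rewrite -[leqLHS]expn1 leq_pexp2l.
have l0M : (l0 <= (2 * L).+1)%N.
  by apply: leq_trans (leq_trans l0S SL') _; rewrite mul2n -addnn leqW// leq_addr.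
set s := scale L in Ss *; have s0 : (0 < s)%N by exact: scale_gt0.
have sR : (0 : R) < s%:R by rewrite ltr0n.
have l2 : (0 < s ^ 2)%N by rewrite expn_gt0 s0.
have l0l : (l0 <= s ^ 2)%N.
  by apply: leq_trans (leq_trans l0S Ss) _; rewrite -[leqLHS]expn1 leq_pexp2l.
have /andP[s4 s5] := fourth_rootP (2 * L).+1; rewrite -/s in s4 s5.
pose m := volume R d L; have m1 : 1 <= m by exact: volume_ge1.
have m0 : 0 < m by exact: lt_le_trans m1.
pose bet := beta d alpha L; have b1 : 1 <= bet by exact: beta_ge1.
have b0 : 0 < bet by exact: lt_le_trans b1.
(* The decay exp(-g s) is split evenly: theta^sg = exp(-g s/2), so the normalised moment theta^-sg B
   exp(-g s) keeps the other half. *)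
pose theta := expR (- (g / (2 * sg) * s%:R)); have th0 : 0 < theta by exact: expR_gt0.
pose Bs := B * expR (- (g * s%:R)); have Bs0 : 0 <= Bs by rewrite mulr_ge0 ?expR_ge0.
pose c0 := Kd * m ^+ kd * theta + 2 * m ^+ 2 * (B * expR (- (g / 2 * s%:R))).
have c00 : 0 <= c0.
  by rewrite /c0 addr_ge0// !mulr_ge0 ?exprn_ge0 ?expR_ge0// ltW.
have thE : (theta `^ sg)^-1 * Bs = B * expR (- (g / 2 * s%:R)).
  rewrite /theta -expRM -expRN /Bs mulrCA -expRD; congr (_ * expR _).
  by field; rewrite gt_eqF.
pose q := ((2 * L).+1 %/ s ^ 2)%N.
have ql : (q * s ^ 2 <= (2 * L).+1)%N by exact: leq_trunc_div.
(* The range of the far entries is s, and [mean_site_decoupling] asks for depth (size p + 2) times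
   that range: hence the margin rho s. *)
pose bulk x := x \in inner d L (s ^ 2) q (rho * s).
have hbulk x : x \in box d L -> bulk x -> mean_le P (fun w =>
    `|lsite (scaled_op H0 bet E (box d L) (omega ^~ w)) (fun t => p.[window_fun c e y t]) x -
      lsite (scaled_op H0 bet E (box_cell L (box_key L x)) (omega ^~ w))
        (fun t => p.[window_fun c e y t]) x|) c0.
  move=> _ bx; have [xL cellE dx] := inner_cell l2 ql bx.
  have sub : {subset box_cell L (box_key L x) <= box d L}.
    by move=> u; rewrite in_cell => /andP[].
  have gL : green_decay H0 omega E (box d L) s sg y bet Bs.
    exact: (hG (const_mx (- L%:Z)) _ l0M s y bet y0 b0).
  have gC : green_decay H0 omega E (box_cell L (box_key L x)) s sg y bet Bs.
    by rewrite cellE; exact: (hG _ _ l0l s y bet y0 b0).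
  have p01 u : 0 <= p.[window_fun c e y u] <= 1 by apply/andP; split; case: (winp u).
  apply: mean_le_weaken (mean_site_decoupling H0_selfadjoint
    sub b1 y0 th0 h00 sg0 Bs0 Hh p01 gL gC dx) _.
  rewrite card_box -mulrA thE; apply: lerD => //.
  by apply: hdb; [exact: ltW|exact: card_box].
have hW' (L' : {fset lattice d}) n r u (nL : n \in L') (r0 : 0 < r) := hW bet E L' n r u b0 nL r0.
apply: mean_le_weaken (mean_count_cells H0_selfadjoint K0 b0 ce y0 eps0 M0 c00 hW' winp hbulk) _.
have nb : \sum_(x <- box d L | ~~ bulk x) (1 : R) <= m * (d%:R * ((1 + 2 * rho%:R) / s%:R)).
  rewrite (card_not_inner d l2 (rho * s) ql R).
  exact: (inner_fraction R d rho s0 s4 (erefl q)).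
rewrite card_box -/m !(powR_beta d alpha_gt0 L) ?ltW// -/m -/Y.
set X := \sum_(_ <- _ | _) _ in nb *.
have ms : m <= s.+1%:R ^+ (4 * d).
  by rewrite /m /volume -natrX -natrX ler_nat expnM leq_exp2r// ltnW.
have mk k : m ^+ k <= s.+1%:R ^+ (4 * d * k).
  rewrite exprM; apply: lerXn2r; rewrite ?nnegrE; [exact: ltW|exact: exprn_ge0|exact: ms].
have s1R : s%:R <= s.+1%:R :> R by rewrite ler_nat.
have inv_s (z : R) : 0 <= z -> z / s.+1%:R <= z / s%:R.
  by move=> z0; apply: ler_wpM2l => //; rewrite lef_pV2 ?posrE// ltr0n.
have e1 : m * (2 * K * (4 * (eps `^ alpha / m) + eps * (Y / m))) <= tol / 4.
  have -> : m * (2 * K * (4 * (eps `^ alpha / m) + eps * (Y / m))) =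
      2 * K * (4 * eps `^ alpha + eps * Y) by field; rewrite gt_eqF.
  apply: (@le_trans _ _ (2 * K * (t * (4 + Y)))).
    apply: ler_wpM2l; first exact: mulr_ge0.
    by rewrite mulrDr lerD ?ler_wpM2r// mulrC ler_wpM2r.
  have -> : 2 * K * (t * (4 + Y)) = tol / 4 * (K / (K + 1)).
    by rewrite /t; field; rewrite !gt_eqF.
  rewrite ler_piMr ?divr_ge0 ?(ltW tol0)//.
  by rewrite ler_pdivrMr// mul1r; lra.
have e2 : m * c0 <= (Kd * C1 + 2 * B * C2) / s%:R.
  apply: le_trans _ (inv_s _ _); last by rewrite !(addr_ge0, mulr_ge0).
  have -> : m * c0 = Kd * (m ^+ kd.+1 * theta) +
      2 * B * (m ^+ 3 * expR (- (g / 2 * s%:R))) by rewrite /c0 [m ^+ kd.+1]exprS; ring.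
  rewrite [leRHS]mulrDl; apply: lerD.
    rewrite -[leRHS]mulrA; apply: ler_wpM2l => //; apply: le_trans (hC1 s).
    by apply: ler_wpM2r; [exact: ltW|exact: mk].
  rewrite -[leRHS]mulrA; apply: ler_wpM2l; first by rewrite mulr_ge0.
  apply: le_trans (hC2 s).
  by apply: ler_wpM2r; [exact: expR_ge0|exact: mk].
have e3 : X * (2 * M * K * (Y / m)) <= 2 * M * K * Y * (d%:R * (1 + 2 * rho%:R)) / s%:R.
  apply: le_trans (ler_wpM2r _ nb) _.
    by rewrite !mulr_ge0// invr_ge0 ltW.
  rewrite le_eqVlt; apply/orP; left; apply/eqP.
  by field; rewrite !gt_eqF.
have e4 : Ctot / s%:R <= tol / 2.
  have : 2 * Ctot / tol <= s%:R by apply: le_trans Sbig _; rewrite ler_nat.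
  by rewrite ler_pdivrMr// ler_pdivrMr//; lra.
move: e4; rewrite /Ctot mulrDl => e4.
by rewrite mulrDr; lra.
Qed.

End Assembly.

(** * From closeness in mean to closeness of probabilities *)

Section MeanClose.
Context (R : realType) (disp : measure_display) (T : measurableType disp)
  (P : probability T R).

Lemma pr_le_mean (B : set T) (f : T -> R) (r : R) : measurable B ->
  (forall w, \1_B w <= f w) -> mean_le P f r -> pr P B <= r.
Proof.
move=> mB Bf [mf f0 fr]; rewrite -lee_fin -prE//; apply: le_trans fr.
rewrite -[leLHS](_ : \int[P]_w (\1_B w)%:E = _)%E; last by rewrite integral_indic// setIT.
apply: ge0_le_integral => //; first exact/measurable_EFinP/measurable_indic.
- exact/measurable_EFinP.
- by move=> w _; rewrite lee_fin.
Qed.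

Lemma integral_le_mean (f g : T -> R) (t : R) :
  measurable_fun [set: T] f -> measurable_fun [set: T] g ->
  (forall w, 0 <= f w) -> (forall w, 0 <= g w) ->
  mean_le P (fun w => `|f w - g w|) t ->
  (\int[P]_w (f w)%:E <= \int[P]_w (g w)%:E + t%:E)%E.
Proof.
move=> mf mg f0 g0 [md _ dt]; apply: le_trans (leeD (lexx _) dt).
rewrite -ge0_integralD//; try (by move=> w _; rewrite lee_fin); try exact/measurable_EFinP.
apply: ge0_le_integral => //.
- by move=> w _; rewrite lee_fin.
- exact/measurable_EFinP.
- by apply: emeasurable_funD; exact/measurable_EFinP.
move=> w _; rewrite -EFinD lee_fin -lerBlDl; exact: ler_norm.
Qed.

(* Two integers that differ are at distance at least 1. *)
Lemma pr_level_close (f g : T -> R) (k : nat) (t : R) :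
  measurable_fun [set: T] f -> measurable_fun [set: T] g ->
  (forall w, exists m : nat, f w = m%:R) -> (forall w, exists m : nat, g w = m%:R) ->
  mean_le P (fun w => `|f w - g w|) t ->
  pr P [set w | f w = k%:R] <= pr P [set w | g w = k%:R] + t.
Proof.
move=> mf mg nf ng fgt.
have mF := measurable_level mf k; have mG := measurable_level mg k.
have h : mean_le P (fun w => \1_[set w | g w = k%:R] w + `|f w - g w|)
    (pr P [set w | g w = k%:R] + t).
  apply: mean_leD fgt; split; [exact: measurable_indic|by []|].
  by rewrite integral_indic// setIT -prE.
apply: pr_le_mean h => // w; rewrite !indicE.
have [i fi] := nf w; have [j gj] := ng w.
have -> : (w \in [set w | f w = k%:R]) = (i == k).
  by apply/idP/eqP => [|ik]; rewrite inE /= fi ?ik// => /eqP; rewrite eqr_nat => /eqP.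
have -> : (w \in [set w | g w = k%:R]) = (j == k).
  by apply/idP/eqP => [|ik]; rewrite inE /= gj ?ik// => /eqP; rewrite eqr_nat => /eqP.
rewrite fi gj; have [->|ij] := eqVneq i j; first by rewrite lerDl.
apply: (@le_trans _ _ `|i%:R - j%:R|); last by rewrite lerDr.
have : (1 : R) <= `|i%:R - j%:R|.
  have -> : (i%:R - j%:R : R) = (i%:Z - j%:Z)%:~R by rewrite intrD intrN.
  by rewrite -intr_norm -[1]/(1%:~R) ler_int; lia.
by apply: le_trans; case: (i == k).
Qed.

End MeanClose.

(** * Occupied cells and the limit of the level probabilities *)

Section HitsBounds.
Context (R : realType) (d : nat) (d_gt0 : (0 < d)%N)
  (disp : measure_display) (T : measurableType disp) (P : probability T R)
  (H0 : {linear ell2 R d -> ell2 R d}).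
Hypotheses (H0_bounded : bounded_op H0) (H0_selfadjoint : selfadjoint_op H0).
Variables (mu : probability R R) (omega : lattice d -> {RV P >-> R}).
Hypotheses (omega_indep : mutually_independent omega)
  (omega_distr : identically_distributed omega mu).
Variables (alpha : R).
Hypotheses (alpha_gt0 : 0 < alpha) (alpha_le1 : alpha <= 1)
  (mu_holder : uniformly_holder alpha mu).
Variables (a b : R) (E : R) (c e : R).
Hypotheses (loc : exp_localized H0 omega a b) (E_ab : a <= E <= b) (ce : c < e).
Local Notation C := R[i].
Local Notation scale L := (fourth_root (2 * L).+1).
Local Notation box_key L := (cell_key L (scale L ^ 2)).
Local Notation box_cell L := (cell (box d L) (box_key L)).
Local Notation box_keys L := (keys (box d L) (box_key L)).
Local Notation num L S w := (count H0 (beta d alpha L) E c e S (omega ^~ w)).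
Local Notation occ L := (occupied H0 omega E (box d L) (box_key L) (beta d alpha L) c e).

Lemma hits_measurable L (r : seq (lattice d)) :
  measurable_fun [set: T] (fun w => (hits (occ L) r w)%:R : R).
Proof.
under eq_fun do rewrite hits_indic.
apply: (@measurable_rsum _ _ _ _ _ (fun k w => \1_(occ L k) w)) => k.
by apply: measurable_indic; exact: measurable_occupied.
Qed.

Lemma mean_hits L (r : seq (lattice d)) :
  (\int[P]_w (hits (occ L) r w)%:R%:E = (\sum_(k <- r) pr P (occ L k))%:E)%E.
Proof.
under eq_integral do rewrite hits_indic -sumEFin.
have mo k : measurable (occ L k) by exact: measurable_occupied.
rewrite ge0_integral_sum//; last by move=> k; exact/measurable_EFinP/measurable_indic.
by rewrite -sumEFin; apply: eq_bigr => k _; rewrite integral_indic// setIT -prE.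
Qed.

(** The fractions of the box taken by the cells sum to 1, and each is at most s^(2d)/M^d <= 1/s,
    since M >= s^4 and d > 0. *)
Lemma sum_sqr_cells L :
  \sum_(k <- box_keys L) (#|` box_cell L k|%:R / volume R d L) ^+ 2 <= (scale L)%:R^-1.
Proof.
have v0 : 0 < volume R d L by exact: lt_le_trans (volume_ge1 R d L).
have s0 := scale_gt0 L; set s := scale L in s0 *.
have sR : (0 : R) < s%:R by rewrite ltr0n.
have l2 : (0 < s ^ 2)%N by rewrite expn_gt0 s0.
have frac k : #|` box_cell L k|%:R / volume R d L <= s%:R^-1.
  rewrite ler_pdivrMr// mulrC ler_pdivlMr// /volume -natrX -natrM ler_nat.
  have /andP[s4 _] := fourth_rootP (2 * L).+1; rewrite -/s in s4.
  have hc : (#|` box_cell L k| <= (s ^ 2) ^ d)%N by exact: card_cell_le.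
  apply: leq_trans (leq_mul hc (leqnn s)) _.
  apply: (@leq_trans ((s ^ 4) ^ d)); last by rewrite leq_exp2r.
  rewrite -[4%N]/(2 + 2)%N expnD expnMn leq_mul2l; apply/orP; right.
  by rewrite -expnM -[leqLHS]expn1 leq_pexp2l// muln_gt0.
apply: (@le_trans _ _ (\sum_(k <- box_keys L)
    #|` box_cell L k|%:R / volume R d L * s%:R^-1)).
  apply: ler_sum => k _; rewrite expr2; apply: ler_wpM2l => //.
  by rewrite divr_ge0// ltW.
rewrite -!mulr_suml.
have -> : \sum_(k <- box_keys L) #|` box_cell L k|%:R = volume R d L.
  by rewrite -card_box -natr_sum (sum_card_cells R).
by rewrite divff ?mul1r// gt_eqF.
Qed.

(** Since beta^alpha is the volume, a cell taking the fraction f of the box is occupied with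
    probability O(f) by Wegner, and its count exceeds the indicator by O(f^2) in mean by Minami.
    Both sums thus reduce to [sum_sqr_cells]. *)
Lemma mean_hits_bound : exists2 K : R, 0 <= K & forall L,
  mean_le P (fun w => `|\sum_(k <- box_keys L) num L (box_cell L k) w -
    (hits (occ L) (box_keys L) w)%:R|) (K / (scale L)%:R) /\
  \sum_(k <- box_keys L) pr P (occ L k) ^+ 2 <= K / (scale L)%:R.
Proof.
have [K K0 hW] := wegner H0_selfadjoint omega_indep omega_distr alpha_gt0 alpha_le1 mu_holder.
have [K' K'0 hM] := minami H0_selfadjoint omega_indep omega_distr alpha_gt0 alpha_le1 mu_holder.
have r0 : 0 < (e - c) / 2 by rewrite divr_gt0// subr_gt0.
pose W := ((e - c) / 2) `^ alpha; have W0 : 0 <= W by exact: powR_ge0.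
exists ((K' * W) ^+ 2 + (2 * K * W) ^+ 2) => [|L].
  by rewrite addr_ge0// sqr_ge0.
have b0 : 0 < beta d alpha L by exact: lt_le_trans (beta_ge1 d alpha_gt0 L).
have v0 : 0 < volume R d L by exact: lt_le_trans (volume_ge1 R d L).
have sV : 0 <= (scale L)%:R^-1 :> R by rewrite invr_ge0.
have sq0 (x : R) : 0 <= x ^+ 2 by exact: sqr_ge0.
have ps := powR_beta d alpha_gt0 L (ltW r0).
split.
  apply: mean_le_weaken (mean_count_hits H0_selfadjoint ce (fun k => hM _ _ _ _ _ b0 ce)) _.
  rewrite ps -/W mulrDl; apply: ler_wpDr; first by rewrite mulr_ge0.
  apply: le_trans (ler_wpM2l (sq0 _) (sum_sqr_cells L)); rewrite mulr_sumr.
  by apply: ler_sum => k _; rewrite -exprMn le_eqVlt; apply/orP; left; apply/eqP; congr (_ ^+ 2); ring.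
rewrite mulrDl; apply: ler_wpDl; first by rewrite mulr_ge0.
apply: le_trans (ler_wpM2l (sq0 _) (sum_sqr_cells L)); rewrite mulr_sumr.
apply: ler_sum => k _; rewrite -exprMn.
have h : pr P (occ L k) <= 2 * K * W * (#|` box_cell L k|%:R / volume R d L).
  apply: (@pr_le_mean _ _ _ _ _ (fun w => num L (box_cell L k) w)).
  - exact: measurable_occupied.
  - move=> w; rewrite indicE; case: (boolP (w \in _)) => [|_]; last exact: count_ge0.
    by rewrite inE.
  split; [exact: count_measurable|by move=> w; exact: count_ge0|].
  rewrite (_ : 2 * K * W * _ = #|` box_cell L k|%:R * (2 * (K * (W / volume R d L)))); last by ring.
  apply: expected_count_le => // x xk; rewrite -ps; exact: hW.
by apply: lerXn2r; rewrite ?nnegrE ?pr_ge0// (le_trans (pr_ge0 P _) h).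
Qed.

Lemma mean_box_hits_small (tol : R) : 0 < tol -> exists L0, forall L, (L0 <= L)%N ->
  mean_le P (fun w => `|num L (box d L) w - (hits (occ L) (box_keys L) w)%:R|) tol /\
  \sum_(k <- box_keys L) pr P (occ L k) ^+ 2 <= tol.
Proof.
move=> tol0; have [K K0 hK] := mean_hits_bound.
have tol2 : 0 < tol / 2 by rewrite divr_gt0.
have [L1 h1] := mean_count_cells_small d_gt0 H0_bounded H0_selfadjoint omega_indep
  omega_distr alpha_gt0 alpha_le1 mu_holder loc E_ab ce tol2.
exists (maxn L1 ((Num.truncn (2 * K / tol)).+1 ^ 4)) => L.
rewrite geq_max => /andP[L1L /le_scale sL].
have s0 : (0 : R) < (scale L)%:R by rewrite ltr0n scale_gt0.
have Ks : K / (scale L)%:R <= tol / 2.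
  have : 2 * K / tol <= (scale L)%:R.
    by apply: le_trans (ltW (Num.Theory.truncnS_gt _)) _; rewrite ler_nat.
  by rewrite ler_pdivrMr// ler_pdivrMr//; lra.
have [m1 m2] := hK L; split; last by lra.
apply: mean_le_mono (mean_leD (h1 L L1L) m1) _; last by lra.
- apply: measurableT_comp => //; apply: measurable_funB; first exact: count_measurable.
  exact: hits_measurable.
- by move=> w; rewrite normr_ge0 /= ler_distD.
Qed.

Lemma count_hits_close (tol : R) (k : nat) L : 0 < tol ->
  mean_le P (fun w => `|num L (box d L) w - (hits (occ L) (box_keys L) w)%:R|) tol ->
  `|pr P [set w | num L (box d L) w = k%:R] - pr P (hits_eq (occ L) (box_keys L) k)| <= tol.
Proof.
move=> tol0 close.
have mc : measurable_fun [set: T] (fun w => num L (box d L) w) by exact: count_measurable.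
have mh := hits_measurable L (box_keys L).
have nc w : exists m : nat, num L (box d L) w = m%:R by exact: count_natr.
have nh w : exists m : nat, (hits (occ L) (box_keys L) w)%:R = m%:R :> R by eexists.
have -> : hits_eq (occ L) (box_keys L) k =
    [set w | (hits (occ L) (box_keys L) w)%:R = k%:R :> R].
  by apply/funext => w; rewrite /hits_eq /=; apply/propext; split=> [->//|/eqP]; rewrite eqr_nat => /eqP.
have close' : mean_le P (fun w => `|(hits (occ L) (box_keys L) w)%:R - num L (box d L) w|) tol.
  by under eq_fun do rewrite distrC.
have := pr_level_close k mc mh nc nh close; have := pr_level_close k mh mc nh nc close'.
by move=> h1 h2; rewrite ler_norml; apply/andP; split; lra.
Qed.

Lemma mean_count_close (tol : R) L :
  mean_le P (fun w => `|num L (box d L) w - (hits (occ L) (box_keys L) w)%:R|) tol ->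
  forall lam, lam = \sum_(k <- box_keys L) pr P (occ L k) ->
  ((lam - tol)%:E <= \int[P]_w (num L (box d L) w)%:E <= (lam + tol)%:E)%E.
Proof.
move=> close lam lamE.
have mc : measurable_fun [set: T] (fun w => num L (box d L) w) by exact: count_measurable.
have mh := hits_measurable L (box_keys L).
have c0 w : 0 <= num L (box d L) w by exact: count_ge0.
have h0 w : 0 <= (hits (occ L) (box_keys L) w)%:R :> R by [].
have close' : mean_le P (fun w => `|(hits (occ L) (box_keys L) w)%:R - num L (box d L) w|) tol.
  by under eq_fun do rewrite distrC.
have := integral_le_mean mc mh c0 h0 close; have := integral_le_mean mh mc h0 c0 close'.
rewrite mean_hits -lamE => h1 h2; apply/andP; split; last by rewrite EFinD.
by rewrite EFinB leeBlDr.
Qed.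

(** Closeness in L^1 is used twice: it carries the assumed limit of the mean count over to the sum
    of the p_k, the mean number of occupied cells, and it carries the limiting levels of that number
    back to the count. *)
Lemma count_level_cvg (L : nat -> nat) (gamma : R) : L @ \oo --> \oo ->
  (\int[P]_w (num (L n) (box d (L n)) w)%:E)%E @[n --> \oo] --> gamma%:E ->
  0 <= gamma /\
  forall k, pr P [set w | num (L n) (box d (L n)) w = k%:R] @[n --> \oo] -->
    gamma ^+ k / k`!%:R * expR (- gamma).
Proof.
move=> Loo Eg.
have small tol : 0 < tol -> \forall n \near \oo,
    mean_le P (fun w => `|num (L n) (box d (L n)) w -
      (hits (occ (L n)) (box_keys (L n)) w)%:R|) tol /\
    \sum_(k <- box_keys (L n)) pr P (occ (L n) k) ^+ 2 <= tol.
  move=> tol0; have [L0 h] := mean_box_hits_small tol0.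
  have /cvgnyPge/(_ L0) := Loo; apply: filterS => n; exact: h.
pose lam n := \sum_(k <- box_keys (L n)) pr P (occ (L n) k).
pose s n := \sum_(k <- box_keys (L n)) pr P (occ (L n) k) ^+ 2.
have s0 n : 0 <= s n by apply: sumr_ge0 => k _; exact: sqr_ge0.
have s_cvg : s n @[n --> \oo] --> (0 : R).
  apply/cvgrPdist_le => tol tol0; near=> n; rewrite sub0r normrN ger0_norm//.
  by near: n; apply: filterS (small _ tol0) => n [].
have /fine_cvgP[finE fE] := Eg.
have lam_cvg : lam n @[n --> \oo] --> gamma.
  apply/cvgrPdist_le => tol tol0.
  have tol2 : 0 < tol / 2 by rewrite divr_gt0.
  move/cvgrPdist_le: (fE) => /(_ _ tol2) fE2.
  near=> n.
  have fin : (\int[P]_w (num (L n) (box d (L n)) w)%:E)%E \is a fin_num by near: n.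
  have [m1 _] : mean_le P (fun w => `|num (L n) (box d (L n)) w -
      (hits (occ (L n)) (box_keys (L n)) w)%:R|) (tol / 2) /\ s n <= tol / 2.
    by near: n; exact: small.
  have := mean_count_close m1 (erefl (lam n)); rewrite -(fineK fin) !lee_fin => /andP[h1 h2].
  have : `|gamma - fine (\int[P]_w (num (L n) (box d (L n)) w)%:E)%E| <= tol / 2 by near: n.
  by rewrite !ler_norml => /andP[h3 h4]; apply/andP; split; lra.
have g0 : 0 <= gamma.
  by apply: cvgr_to_ge lam_cvg _; near=> n; apply: sumr_ge0 => k _; exact: pr_ge0.
split=> // k.
have hcvg : pr P (hits_eq (occ (L n)) (box_keys (L n)) k) @[n --> \oo] -->
    gamma ^+ k / k`!%:R * expR (- gamma).
  pose u n k := pr P (hits_eq (occ (L n)) (box_keys (L n)) k).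
  have ind n i (r : seq (lattice d)) m : i \notin r -> P (occ (L n) i `&` hits_eq (occ (L n)) r m) =
      (P (occ (L n) i) * P (hits_eq (occ (L n)) r m))%E by exact: hits_occupied_indep.
  have mo n i : measurable (occ (L n) i) by exact: measurable_occupied.
  have uq n : uniq (box_keys (L n)) by exact: fset_uniq.
  apply: (@poisson_recursion_cvg _ u lam s gamma lam_cvg s_cvg) => [n j|n sn].
    exact: (hits_eq_rec (mo n) (ind n) j (uq n)).
  exact: (hits_eq0_bounds (mo n) (ind n) (uq n) sn).
apply/cvgrPdist_le => tol tol0; have tol2 : 0 < tol / 2 by rewrite divr_gt0.
move/cvgrPdist_le: hcvg => /(_ _ tol2) hcvg; near=> n.
have [m1 _] : mean_le P (fun w => `|num (L n) (box d (L n)) w -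
    (hits (occ (L n)) (box_keys (L n)) w)%:R|) (tol / 2) /\ s n <= tol / 2.
  by near: n; exact: small.
have := count_hits_close k tol2 m1.
have : `|gamma ^+ k / k`!%:R * expR (- gamma) -
    pr P (hits_eq (occ (L n)) (box_keys (L n)) k)| <= tol / 2 by near: n.
by rewrite !ler_norml => /andP[h3 h4] /andP[h1 h2]; apply/andP; split; lra.
Unshelve. all: by end_near. Qed.

End HitsBounds.

Lemma xi_count (R : realType) (d : nat) (H0 : {linear ell2 R d -> ell2 R d})
    (alpha E c e : R) L V : selfadjoint_op H0 ->
  xi H0 alpha L E `]c, e[%classic V = count H0 (beta d alpha L) E c e (box d L) V.
Proof.
by move=> sa; rewrite /xi spectral_proj_trace//; exact: scaled_op_hermitian.
Qed.

(* The second argument of [poisson_prob] is ignored by its definition. *)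
Theorem theorem1p4 (R : realType) (d : nat) (d_gt0 : (0 < d)%N)
  (disp : measure_display) (T : measurableType disp) (P : probability T R)
  (H0 : {linear ell2 R d -> ell2 R d})
  (H0_bounded : bounded_op H0) (H0_selfadjoint : selfadjoint_op H0)
  (H0_translation : translation_invariant H0)
  (mu : probability R R) (omega : lattice d -> {RV P >-> R})
  (omega_indep : mutually_independent omega)
  (omega_distr : identically_distributed omega mu)
  (alpha : R) (alpha_gt0 : 0 < alpha) (alpha_le1 : alpha <= 1)
  (mu_holder : uniformly_holder alpha mu)
  (a b : R) (loc : exp_localized H0 omega a b)
  (E : R) (E_ab : a <= E <= b)
  (E_spectrum : {ae P, forall w, spectrum (anderson H0 (omega ^~ w)) E%:C})
  (c e : R) (L : nat -> nat) (L_gt0 : forall n, (0 < L n)%N)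
  (L_cvg : L @ \oo --> \oo)
  (gamma : R) (gamma_neq0 : gamma != 0)
  (gamma_lim :
    ('E_P[fun w => xi H0 alpha (L n) E `]c, e[%classic (omega ^~ w)])%E
      @[n --> \oo]
      --> gamma%:E) :
  cvg_in_distribution P
    (fun n w => xi H0 alpha (L n) E `]c, e[%classic (omega ^~ w))
    (poisson_prob gamma 0%N) (fun k : nat => k%:R).
Proof.
have xiE n : (fun w => xi H0 alpha (L n) E `]c, e[%classic (omega ^~ w)) =
    fun w => count H0 (beta d alpha (L n)) E c e (box d (L n)) (omega ^~ w).
  by apply/funext => w; exact: xi_count.
have -> : (fun n w => xi H0 alpha (L n) E `]c, e[%classic (omega ^~ w)) =
    fun n w => count H0 (beta d alpha (L n)) E c e (box d (L n)) (omega ^~ w).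
  by apply/funext => n; exact: xiE.
have lim : (\int[P]_w (count H0 (beta d alpha (L n)) E c e (box d (L n)) (omega ^~ w))%:E)%E
    @[n --> \oo] --> gamma%:E.
  by move: gamma_lim; under eq_fun do rewrite xiE unlock.
(* For e <= c the interval is empty, all counts vanish and gamma would be 0. *)
have [ce|ec] := ltP c e; last first.
  exfalso; move/eqP: gamma_neq0; apply.
  have z : (fun n => (\int[P]_w (count H0 (beta d alpha (L n)) E c e (box d (L n))
      (omega ^~ w))%:E)%E) = fun=> 0%E.
    apply/funext => n; rewrite integral0_eq// => w _; congr (_%:E).
    rewrite /count set_itv_ge ?bnd_simp -?leNgt// indic0.
    by apply: big1.
  rewrite z in lim; have : gamma%:E = 0%E by exact: (cvg_unique (@ereal_hausdorff R) lim (cvg_cst _)).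
  by case.
have [g0 lev] := count_level_cvg d_gt0 H0_bounded H0_selfadjoint omega_indep
  omega_distr alpha_gt0 alpha_le1 mu_holder loc E_ab ce L_cvg lim.
(* Positivity selects the Poisson weights in the definition of [poisson_prob]. *)
have g1 : 0 < gamma by rewrite lt_def gamma_neq0.
apply: nat_cvg_in_distribution.
- by move=> n; exact: count_measurable.
- by [].
- by move=> n w; exact: count_natr.
- by move=> w; exists w.
- by move=> k; rewrite poisson_level//; exact: lev.
Qed.
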